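(* Let $(X,\mathcal{B}_X,\mu,T)$ be a $\mathbb{Z}^2$-MPS, let $\vec{v}=(1,\beta)\in\mathbb{R}^2$ be a direction vector and let $b\in(0,\infty)$. Let $\alpha$ be a finite measurable partition of $X$. Then for any infinite subset $S'$ of $\Lambda^{\vec{v}}(b)$, $$h^{S'}_{\mu}(T,\alpha)\leq H_\mu(\alpha|\mathcal{K}_\mu^{\vec{v}}).$$ Moreover, there exists an infinite subset $S=\{(m_i,n_i)\}_{i=1}^{\infty}$ of $\Lambda^{\vec{v}}(b)$ such that $\{m_i\}_{i=1}^{\infty}$ is strictly monotone and $$h^{S}_{\mu}(T,\alpha)=H_\mu(\alpha|\mathcal{K}_\mu^{\vec{v}}).$$
   Context: A $\mathbb{Z}^2$-measure preserving dynamical system ($\mathbb{Z}^2$-MPS) is a quadruple $(X,\mathcal{B}_X,\mu,T)$ where $X$ is a compact metric space, $\mathcal{B}_X$ its Borel $\sigma$-algebra, $T$ assigns to each $\vec{w}\in\mathbb{Z}^2$ a homeomorphism $T^{\vec{w}}:X\to X$ with $T^{\vec{w}}\circ T^{\vec{u}}=T^{\vec{w}+\vec{u}}$ and $T^{\vec{0}}=\mathrm{id}_X$, and $\mu$ is a Borel probability measure on $X$ invariant under every $T^{\vec{w}}$. For $\vec{v}=(1,\beta)\in\mathbb{R}^2$ and $b>0$ put $\Lambda^{\vec{v}}(b)=\{(m,n)\in\mathbb{Z}^2:\beta m-b/2\leq n\leq \beta m+b/2\}$. For a finite measurable partition $\alpha$, $H_\mu(\alpha)=-\sum_{A\in\alpha}\mu(A)\log\mu(A)$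 (with $0\log 0=0$), and for a sub-$\sigma$-algebra $\mathcal{F}\subset\mathcal{B}_X$, $H_\mu(\alpha|\mathcal{F})=-\sum_{A\in\alpha}\int_X \mathbb{E}(1_A|\mathcal{F})\log\mathbb{E}(1_A|\mathcal{F})\,d\mu$. An infinite subset $S=\{(m_i,n_i)\}_{i=1}^\infty$ of $\mathbb{Z}^2$ is understood to come with an enumeration as a sequence of pairwise distinct elements, and $$h^S_{\mu}(T,\alpha)=\limsup_{k\to\infty}\frac1k H_\mu\left(\bigvee_{i=1}^k T^{-(m_i,n_i)}\alpha\right).$$ Let $U_T^{(m,n)}f=f\circ T^{(m,n)}$ for $f\in L^2(X,\mathcal{B}_X,\mu)$. The $\vec{v}$-directional Kronecker algebra is $$\mathcal{K}_\mu^{\vec{v}}=\left\{B\in\mathcal{B}_X:\overline{\{U_T^{(m,n)}1_B:(m,n)\in\Lambda^{\vec{v}}(b)\}}\text{ is compact in }L^2(X,\mathcal{B}_X,\mu)\right\};$$ it is a $\sigma$-algebra and does not depend on the choice of $b\in(0,\infty)$. *)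

(* Defs.v *)
From HB Require Import structures.
From mathcomp Require Import all_boot all_order all_algebra.
From mathcomp Require Import all_classical all_reals all_analysis.
From mathcomp Require Import measurable_realfun.

Set Implicit Arguments.
Unset Strict Implicit.
Unset Printing Implicit Defensive.

Import Order.TTheory GRing.Theory Num.Theory.
Import numFieldNormedType.Exports.

Local Open Scope classical_set_scope.
Local Open Scope ring_scope.

(* Measurable types are pointed in the library; a compact metric space that
   carries a probability measure is nonempty, so nothing is lost. *)
#[short(type="pmetricType")]
HB.structure Definition PMetric (K : numDomainType) :=
  {M of Metric K M & isPointed M}.

Notation borel X := (g_sigma_algebraType (@open X)).

Section Lspace_metric.
Context {d} {T : measurableType d} {R : realType}.
Variables (mu : {measure set T -> \bar R}) (p : \bar R) (p1 : (1 <= p)%E).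
Implicit Types f g h : LspaceType mu p1.

(* The library does not equip its L^p spaces with a topology; the instance below
   provides the one induced by the L^p norm. *)
Definition Lspace_dist f g : R :=
  fine 'N[mu]_p [EFin \o ((f : T -> R) \- (g : T -> R))%R]%E.

Let mLspace f : measurable_fun setT (f : T -> R).
Proof.
exact: (measurable_funPT (repr (f : {mfun_ mu, T >-> measurableTypeR R}))).
Qed.

Let Lspace_normB_fin f g :
  'N[mu]_p [EFin \o ((f : T -> R) \- (g : T -> R))%R]%E \is a fin_num.
Proof.
rewrite ge0_fin_numE ?Lnorm_ge0//.
have mN : measurable_fun setT (\- (g : T -> R)) by exact: measurableT_comp.
have := @eminkowski _ _ _ mu (f : T -> R) (\- (g : T -> R)) p (mLspace f) mN p1.
move=> /le_lt_trans; apply.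
rewrite lte_add_pinfty//; first exact: Lebesgue_finite.
have -> : EFin \o (\- (g : T -> R)) = (\- (EFin \o (g : T -> R)))%E by [].
by rewrite oppe_Lnorm; exact: Lebesgue_finite.
Qed.

Let Lspace_distE f g : (Lspace_dist f g)%:E =
  'N[mu]_p [EFin \o ((f : T -> R) \- (g : T -> R))%R]%E.
Proof. by rewrite fineK. Qed.

Let Lspace_distxx f : Lspace_dist f f = 0.
Proof.
apply: EFin_inj; rewrite Lspace_distE.
have -> : EFin \o ((f : T -> R) \- (f : T -> R)) = cst 0%E :> (T -> \bar R).
  by apply/funext => x /=; rewrite subrr.
by rewrite Lnorm0// gt_eqF// (lt_le_trans _ p1).
Qed.

Let Lspace_dist_eq0 f g : Lspace_dist f g = 0 -> f = g.
Proof.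
move=> fg0; have {}fg0 : (Lspace_dist f g)%:E = 0%E by rewrite fg0.
rewrite Lspace_distE in fg0.
have mB : measurable_fun setT
    (EFin \o ((f : T -> R) \- (g : T -> R)) : T -> \bar R).
  by apply/measurable_EFinP; exact: measurable_funB.
have fg : (f : T -> R) = g %[ae mu].
  have := Lnorm_eq0_eq0 mB (lt_le_trans lte01 p1) fg0.
  by apply: filterS => x /(_ I)[/subr0_eq].
have e : (f : {mfun_ mu, T >-> measurableTypeR R}) = g.
  rewrite -(reprK (f : {mfun_ mu, _ >-> _})) -(reprK (g : {mfun_ mu, _ >-> _})).
  by apply/eqmodP/asboolP.
by case: f g e {fg0 mB fg} => f [[pf]] [g [[pg]]] /= e; subst g;
   rewrite (Prop_irrelevance pf pg).
Qed.

Let Lspace_dist_sym f g : Lspace_dist f g = Lspace_dist g f.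
Proof.
apply: EFin_inj; rewrite !Lspace_distE -oppe_Lnorm; congr Lnorm.
by apply/funext => x /=; rewrite opprB.
Qed.

Let Lspace_dist_triangle g f h :
  Lspace_dist f h <= Lspace_dist f g + Lspace_dist g h.
Proof.
rewrite -lee_fin EFinD !Lspace_distE.
have -> : EFin \o ((f : T -> R) \- (h : T -> R)) =
    EFin \o (((f : T -> R) \- (g : T -> R)) \+ ((g : T -> R) \- (h : T -> R))).
  by apply/funext => x /=; rewrite addrA subrK.
by apply: eminkowski => //; exact: measurable_funB.
Qed.

HB.instance Definition _ := gen_eqMixin (LspaceType mu p1).
HB.instance Definition _ := gen_choiceMixin (LspaceType mu p1).
HB.instance Definition _ := isMetric.Build R (LspaceType mu p1)
  Lspace_distxx Lspace_dist_eq0 Lspace_dist_sym Lspace_dist_triangle.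

End Lspace_metric.

(* A partition is an indexed family; empty cells are allowed and contribute
   nothing to the entropies. *)
Definition measurable_partition {d} {X : measurableType d} (I : finType)
    (A : I -> set X) : Prop :=
  [/\ forall i, measurable (A i), trivIset setT A & \bigcup_i A i = setT].

Definition partition_join {X : Type} {I : finType} {n : nat}
    (A : 'I_n -> I -> set X) (f : {ffun 'I_n -> I}) : set X :=
  \bigcap_i A i (f i).

Section entropy.
Context {d} {X : measurableType d} {R : realType}.
Variable mu : probability X R.
Local Open Scope ereal_scope.

Definition entropy {I : finType} (A : I -> set X) : R :=
  (- \sum_(i : I) fine (mu (A i)) * ln (fine (mu (A i))))%R.

Definition is_condexp (F : set (set X)) (f g : X -> R) : Prop :=
  [/\ forall Y : set R, measurable Y -> F (g @^-1` Y),
      mu.-integrable setT (EFin \o g) &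
      forall C, F C ->
        \int[mu]_(x in C) (g x)%:E = \int[mu]_(x in C) (f x)%:E].

(* A chosen version; any two versions agree mu-almost everywhere. *)
Definition condexp (F : set (set X)) (f : X -> R) : X -> R :=
  xget (cst 0%R) [set g | is_condexp F f g].

Definition cond_entropy {I : finType} (A : I -> set X) (F : set (set X))
    : \bar R :=
  - \sum_(i : I)
      \int[mu]_x (condexp F \1_(A i) x * ln (condexp F \1_(A i) x))%:E.

End entropy.

Section Z2_systems.
Context {R : realType} {X : pmetricType R}.
Variables (mu : probability (borel X) R) (T : int * int -> X -> X).

(* Each T w is a homeomorphism: its inverse is T (- w). *)
Record Z2_mps : Prop := {
  Z2_mps_compact : compact [set: X] ;
  Z2_mps_continuous : forall w, continuous (T w) ;
  Z2_mps_add : forall w u, T w \o T u = T (w + u) ;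
  Z2_mps_0 : T 0 = id ;
  Z2_mps_invariant : forall (w : int * int) (B : set (borel X)),
    measurable B -> mu (T w @^-1` B) = mu B
}.

Definition strip (beta b : R) : set (int * int) :=
  [set w | beta * w.1%:~R - b / 2 <= w.2%:~R <= beta * w.1%:~R + b / 2].

(* s enumerates the infinite set; T^{-w} A is the preimage T w @^-1` A. *)
Definition seq_entropy (s : nat -> int * int) {I : finType}
    (A : I -> set (borel X)) : \bar R :=
  limn_esup (fun k : nat =>
    (k%:R^-1 * entropy mu
       (partition_join (fun (i : 'I_k) (j : I) => T (s i) @^-1` A j)))%:E).

(* {U_T^w 1_B : w in L} as a subset of L^2, whose elements are classes modulo
   mu-almost everywhere equality. *)
Definition koopman_orbit (L : set (int * int)) (B : set (borel X))
    : set (LspaceType2 mu) :=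
  [set f : LspaceType2 mu |
    exists2 w, L w & (f : borel X -> R) = \1_B \o T w %[ae mu]].

Definition directional_kronecker (beta b : R) : set (set (borel X)) :=
  [set B | measurable B /\ compact (closure (koopman_orbit (strip beta b) B))].

End Z2_systems.

(* Main.v *)
Require Import Defs.
From HB Require Import structures.
From mathcomp Require Import all_boot all_order all_algebra.
From mathcomp Require Import all_classical all_reals all_analysis.
From mathcomp Require Import measurable_realfun.
From mathcomp Require Import ring lra zify.

Set Implicit Arguments.
Unset Strict Implicit.
Unset Printing Implicit Defensive.

Import Order.TTheory GRing.Theory Num.Theory.
Import numFieldNormedType.Exports.

Local Open Scope classical_set_scope.
Local Open Scope ring_scope.

(** Let K be the directional Kronecker algebra, U^w f = f o T^w, and write
    g_A for the conditional probability of a cell A of alpha given K.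

    Upper bound.  Quantizing the functions g_A gives a finite partition c into
    sets of K on whose cells every g_A is almost constant, and then
    H(alpha | c) <= H(alpha | K) + e ([cond_ent_le_mean_phi]).  Since the
    orbit of each cell of c along the strip is totally bounded, the translates
    T^-w c with w in the strip fall into finitely many classes of almost equal
    partitions.  Let d_i be a fixed representative of the class of T^-(s_i) c.
    The inequality
      H(join_i T^-(s_i) alpha) <= H(join_i d_i) + sum_i H(T^-(s_i) alpha | d_i)
    ([ent_joint_le_cond]) has a first term bounded independently of the number
    of factors, and each summand is at most H(alpha | K) + 2e.  Divided by the
    number of factors, this is the upper bound ([ent_joint_upper]).

    Lower bound.  The sequence is chosen greedily, with increasing first
    coordinates, so that T^-(s_k) alpha has conditional entropy at least
    H(alpha | K) - 2^-k given the join of the previous translates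
    ([ent_joint_lower]).  By concavity of - t ln t ([mean_phi_jensen]) such a
    choice exists as soon as the functions U^w (1_A - g_A) are almost
    orthogonal to the finitely many cells of that join, for some w far out in
    the strip.  As 1_A - g_A is orthogonal to all K-measurable functions, this
    is weak mixing along the strip ([directional_weak_mixing]).

    Weak mixing.  A strip is not a group, so the ergodic theorem does not apply
    to it directly.  Let w(m) be the lattice point (m, n) with n nearest to
    beta m, weighted by a tent function psi(m) of beta m - n that vanishes
    outside the strip, and let E be a shift-invariant mean on bounded functions
    of m.  The form
      B(h, k) = E (psi(m) <U^w(m) f, h> <U^w(m) f, k>)
    has two properties.  For u close to the axis of the strip, translating h and
    k by U^u changes it by at most a constant times the distance
    |beta u_1 - u_2| to the axis, because psi is Lipschitz ([strip_form_translate]).  And it is small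
    on weakly null families, since Bessel's inequality bounds its trace
    ([strip_form_weakly_null]).  Let g represent h' |-> B(h, h').  The two
    properties together show that the orbit of g along the strip is totally
    bounded ([strip_form_density_ap]), so if f is orthogonal to K-measurable
    functions then <U^w f, g> = 0 for all w; hence <g, g> = B(h, g) = 0 and
    B(h, h) = 0.  As E psi > 0 by pigeonhole ([imean_tent_gt0]), correlations
    cannot stay away from 0 far out in the strip.

    Everything is done with bounded functions.  The only representation theorem
    needed is that a functional dominated by a multiple of the L1 norm is the
    integral against a bounded density ([L1_dual_density], from
    Radon-Nikodym).  It provides the g above, weak limits along ultrafilters
    ([weak_ulim]), conditional expectations ([condexp_exists]), and the
    completeness that turns totally bounded orbits into relatively compact ones
    ([ap_compact_orbit]). *)

(** * Bounded measurable functions and their means *)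

Section finite_colorings.
Context {R : realType}.

(** Total boundedness of an interval, in the form used throughout: finitely
    many colours such that points of equal colour are close.  Colourings combine
    by taking pairs, and measurable colour classes pull back to partitions. *)
Lemma interval_coloring (C e : R) : 0 < e ->
  exists (J : finType) (Q : R -> J), (forall j, measurable (Q @^-1` [set j])) /\
    (forall y z, `|y| <= C -> `|z| <= C -> Q y = Q z -> `|y - z| <= e).
Proof.
move=> e0.
(* the colour of y records which of the points p k lie above y; they have spacing e *)
pose m := (Num.trunc (2 * C / e)).+2.
pose p (k : nat) : R := k%:R * e - C.
exists {ffun 'I_m -> bool}, (fun y => [ffun k : 'I_m => y < p k]); split.
  move=> j.
  have -> : (fun y : R => [ffun k : 'I_m => y < p k]) @^-1` [set j] =
      \bigcap_(k in [set: 'I_m]) (if j k then [set` `]-oo, p k[] else [set` `[p k, +oo[]).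
    apply/seteqP; split => y /=.
      move=> <- k _; rewrite ffunE /=; case: ifPn => /=; rewrite in_itv /= ?andbT //.
      by rewrite -leNgt.
    move=> h; apply/ffunP => k; rewrite ffunE; have := h k I; case: ifPn => jk /=.
      by rewrite in_itv /= => ->.
    by rewrite in_itv /= andbT leNgt => /negbTE ->.
  apply: fin_bigcap_measurable; first exact: finite_finset.
  by move=> k _; case: ifP.
suff key y z : `|y| <= C -> `|z| <= C ->
    [ffun k : 'I_m => y < p k] = [ffun k : 'I_m => z < p k] -> z - y <= e.
  by move=> y z yC zC yz;
  rewrite ler_norml; have h1 := key _ _ yC zC yz; have h2 := key _ _ zC yC (esym yz); apply/andP; split; lra.
rewrite !ler_norml => /andP[y1 y2] /andP[z1 z2] /ffunP yz.
rewrite leNgt; apply/negP => zy.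
have yC0 : 0 <= (y + C) / e by rewrite divr_ge0 ?(ltW e0) //; lra.
have /andP[t1 t2] := truncn_itv yC0.
move: t1 t2; rewrite ler_pdivlMr // ltr_pdivrMr // => t1 t2.
have km : ((Num.trunc ((y + C) / e)).+1 < m)%N.
  rewrite ltnS ltnS.
  apply: le_truncn; rewrite ler_pM2r ?invr_gt0 //; lra.
have := yz (Ordinal km); rewrite !ffunE /p /=.
rewrite (_ : (y < _) = true); last by lra.
rewrite (_ : (z < _) = false) //; apply/negbTE; rewrite -leNgt.
rewrite -natr1; lra.
Qed.

End finite_colorings.

(** The step behind both Cauchy-Schwarz inequalities below. *)
Lemma discriminant_le {R : realFieldType} (a b c : R) : 0 <= a -> 0 <= c ->
  (forall t, 0 <= t ^+ 2 * a - 2 * t * b + c) -> b ^+ 2 <= a * c.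
Proof.
move=> a0 c0 quad; have [a0'|an0] := eqVneq a 0; last first.
  have {}a0 : 0 < a by rewrite lt_neqAle eq_sym an0.
  have := quad (b / a).
  have -> : (b / a) ^+ 2 * a - 2 * (b / a) * b + c = (a * c - b ^+ 2) / a.
    by field; rewrite gt_eqF.
  by rewrite pmulr_lge0 ?invr_gt0 // subr_ge0.
rewrite a0' mul0r.
have [->|b0] := eqVneq b 0; first by rewrite expr0n.
have := quad ((c + 1) / (2 * b)); rewrite a0' mulr0 add0r.
have -> : - (2 * ((c + 1) / (2 * b)) * b) + c = -1 by field.
by rewrite lerNr oppr0 ler10.
Qed.

Section bounded_measurable.
Context {d} {Y : measurableType d} {R : realType}.
Implicit Types f g : Y -> R.

(** On a probability space these functions are integrable and closed under
    products, so that sums, products and translates can be formed without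
    integrability conditions; they play the part of L2. *)
Definition bm (f : Y -> R) : Prop :=
  measurable_fun setT f /\ exists C, forall x, `|f x| <= C.

Lemma bm_cst c : bm (fun _ => c).
Proof. by split; [exact: measurable_cst|exists `|c|]. Qed.

Lemma bmD f g : bm f -> bm g -> bm (fun x => f x + g x).
Proof.
move=> [mf [C fC]] [mg [D gD]]; split; first exact: measurable_funD.
by exists (C + D) => x; rewrite (le_trans (ler_normD _ _)) // lerD.
Qed.

Lemma bmN f : bm f -> bm (fun x => - f x).
Proof.
move=> [mf [C fC]]; split; first exact: measurableT_comp.
by exists C => x; rewrite normrN.
Qed.

Lemma bmM f g : bm f -> bm g -> bm (fun x => f x * g x).
Proof.
move=> [mf [C fC]] [mg [D gD]]; split; first exact: measurable_funM.
by exists (C * D) => x; rewrite normrM ler_pM.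
Qed.

Lemma bmX f n : bm f -> bm (fun x => f x ^+ n).
Proof.
move=> bf; elim: n => [|n ih].
  by have -> : (fun x => f x ^+ 0) = (fun _ => 1) by []; exact: bm_cst.
by under eq_fun do rewrite exprS; exact: bmM.
Qed.

Lemma bm_norm f : bm f -> bm (fun x => `|f x|).
Proof.
move=> [mf [C fC]]; split; first exact: measurableT_comp.
by exists C => x; rewrite normr_id.
Qed.

Lemma bm_indic (A : set Y) : measurable A -> bm (\1_A).
Proof.
move=> mA; split; first exact: measurable_indic.
by exists 1 => x; rewrite indicE; case: (_ \in _); rewrite ?normr1 ?normr0.
Qed.

Lemma bm_sum (J : Type) (r : seq J) (F : J -> Y -> R) :
  (forall j, bm (F j)) -> bm (fun x => \sum_(j <- r) F j x).
Proof.
move=> bF; elim: r => [|j r ih].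
  by under eq_fun do rewrite big_nil; exact: bm_cst.
by under eq_fun do rewrite big_cons; exact: bmD.
Qed.

Lemma bm_post (phi : R -> R) f :
  measurable_fun setT phi -> (exists C, forall x, `|phi (f x)| <= C) ->
  bm f -> bm (fun x => phi (f x)).
Proof. by move=> mphi phiC [mf _]; split => //; exact: (measurableT_comp mphi mf). Qed.

Lemma bm_bound f : bm f -> exists2 C, 0 < C & forall x, `|f x| <= C.
Proof.
move=> [_ [C fC]]; exists (`|C| + 1); first by rewrite ltr_pwDr.
by move=> x; rewrite (le_trans (fC x)) // (le_trans (ler_norm _)) // lerDl.
Qed.

Lemma bm_preimage f (Z : set R) : bm f -> measurable Z -> measurable (f @^-1` Z).
Proof. by move=> [mf _] mZ; rewrite -[_ @^-1` _]setTI; exact: mf. Qed.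

Lemma simple_approximation f (e : R) : bm f -> 0 < e ->
  exists (J : finType) (Z : J -> set R) (v : J -> R), (forall j, measurable (Z j)) /\
    (forall x, `|f x - \sum_(j : J) v j * \1_(f @^-1` Z j) x| <= e).
Proof.
move=> bf e0; have [K K0 fK] := bm_bound bf.
have [J [Q [mQ Qe]]] := interval_coloring K e0.
pose v j := xget 0 [set t | `|t| <= K /\ Q t = j].
exists J, (fun j => Q @^-1` [set j]), v; split => // x.
rewrite (bigD1 (Q (f x))) //= indicE mem_set // mulr1 big1 ?addr0 => [|j jx]; last first.
  by rewrite indicE memNset ?mulr0 //= => /eqP; rewrite eq_sym (negbTE jx).
have [] : [set t | `|t| <= K /\ Q t = Q (f x)] (v (Q (f x))).
  by apply: (xgetPex 0); exists (f x).
by move=> vK vQ; apply: Qe.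
Qed.

End bounded_measurable.

Lemma bm_comp {d d'} {Y : measurableType d} {Z : measurableType d'} {R : realType}
    (h : Z -> Y) (f : Y -> R) : measurable_fun setT h -> bm f -> bm (fun z => f (h z)).
Proof.
move=> mh [mf [C fC]]; split; last by exists C => z.
exact: (measurableT_comp mf mh).
Qed.

Ltac bm := repeat first [assumption | apply: bm_indic; assumption | apply: bm_cst | apply: bmN
  | apply: bmM | apply: bmD | apply: bmX | apply: bm_norm].

Section mean.
Context {d} {Y : measurableType d} {R : realType}.
Variable mu : probability Y R.
Implicit Types f g : Y -> R.

Lemma bm_integrable f : bm f -> mu.-integrable setT (EFin \o f).
Proof.
move=> bf; apply: measurable_bounded_integrable => //.
- by apply: le_lt_trans (probability_le1 mu measurableT) _; rewrite ltry.
- by case: bf.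
- have [C C0 fC] := bm_bound bf.
  by exists C; split; [exact: num_real|move=> y Cy x _; exact: le_trans (fC x) (ltW Cy)].
Qed.

Definition mean f : R := \int[mu]_x f x.

Lemma EFin_mean f : bm f -> (mean f)%:E = (\int[mu]_x (f x)%:E)%E.
Proof. by move=> bf; rewrite fineK //; apply: integrable_fin_num => //; exact: bm_integrable. Qed.

Lemma mean_cst c : mean (fun _ => c) = c.
Proof.
rewrite /mean Rintegral_cst // (_ : fine _ = 1) ?mulr1 //.
rewrite [X in fine X](_ : _ = 1%E) //; exact: probability_setT.
Qed.

Lemma meanD f g : bm f -> bm g -> mean (fun x => f x + g x) = mean f + mean g.
Proof. by move=> bf bg; rewrite /mean RintegralD //; exact: bm_integrable. Qed.

Lemma meanB f g : bm f -> bm g -> mean (fun x => f x - g x) = mean f - mean g.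
Proof. by move=> bf bg; rewrite /mean RintegralB //; exact: bm_integrable. Qed.

Lemma meanZ c f : bm f -> mean (fun x => c * f x) = c * mean f.
Proof. by move=> bf; rewrite /mean RintegralZl //; exact: bm_integrable. Qed.

Lemma le_mean f g : bm f -> bm g -> (forall x, f x <= g x) -> mean f <= mean g.
Proof. by move=> bf bg fg; apply: le_Rintegral => //; exact: bm_integrable. Qed.

Lemma mean_ge0 f : (forall x, 0 <= f x) -> 0 <= mean f.
Proof. by move=> f0; exact: Rintegral_ge0. Qed.

Lemma le_norm_mean f : bm f -> `|mean f| <= mean (fun x => `|f x|).
Proof. by move=> bf; apply: le_normr_Rintegral => //; exact: bm_integrable. Qed.

Lemma mean_indic A : measurable A -> mean \1_A = fine (mu A).
Proof. by move=> mA; rewrite /mean /Rintegral integral_indic // setIT. Qed.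

Lemma eq_mean f g : f =1 g -> mean f = mean g.
Proof. by move=> /funext ->. Qed.

Lemma mean_sum (J : Type) (r : seq J) (F : J -> Y -> R) :
  (forall j, bm (F j)) -> mean (fun x => \sum_(j <- r) F j x) = \sum_(j <- r) mean (F j).
Proof.
move=> bF; elim: r => [|j r ih].
  by rewrite big_nil -[RHS](mean_cst 0); apply: eq_mean => x; rewrite big_nil.
rewrite big_cons -ih -meanD //; last exact: bm_sum.
by apply: eq_mean => x; rewrite big_cons.
Qed.

Lemma norm_mean_le f C : bm f -> (forall x, `|f x| <= C) -> `|mean f| <= C.
Proof.
move=> bf fC; rewrite (le_trans (le_norm_mean bf)) // -[leRHS]mean_cst.
by apply: le_mean => //; [exact: bm_norm|exact: bm_cst].
Qed.

Lemma mean_cauchy_schwarz f g : bm f -> bm g ->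
  (mean (fun x => f x * g x)) ^+ 2 <=
  mean (fun x => f x ^+ 2) * mean (fun x => g x ^+ 2).
Proof.
move=> bf bg.
set a := mean (fun x => f x ^+ 2); set b := mean (fun x => f x * g x).
set c := mean (fun x => g x ^+ 2).
have quad t : 0 <= t ^+ 2 * a - 2 * t * b + c.
  have -> : t ^+ 2 * a - 2 * t * b + c = mean (fun x => (t * f x - g x) ^+ 2).
    rewrite (@eq_mean _ (fun x => (t ^+ 2 * f x ^+ 2 - (2 * t) * (f x * g x)) + g x ^+ 2)).
      by rewrite meanD ?meanB ?meanZ //; bm.
    by move=> x; ring.
  by apply: mean_ge0 => x; exact: sqr_ge0.
by apply: discriminant_le quad; apply: mean_ge0 => x; exact: sqr_ge0.
Qed.

End mean.

(** * Representation of L1-continuous functionals *)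

Section ae_level.
Context {d} {Y : measurableType d} {R : realType}.
Variable mu : probability Y R.

(** An integrable function that exceeds c on a set of positive measure has an
    integral over that set exceeding c times its measure.  Only the level set
    itself is tested, which matters when h is measurable for a smaller
    sigma-algebra and its integrals are known on that algebra only. *)
Lemma ae_le_level (h : Y -> R) (c : R) : mu.-integrable setT (EFin \o h) ->
  \int[mu]_(x in [set x | c < h x]) h x <= c * fine (mu [set x | c < h x]) ->
  {ae mu, forall x, h x <= c}.
Proof.
move=> ih; set E := [set x | c < h x] => le_E.
have mh : measurable_fun setT h by apply/measurable_EFinP; case/integrableP : ih.
have mE : measurable E.
  have -> : E = h @^-1` [set` `]c, +oo[ ].
    by apply/seteqP; split => x /=; rewrite in_itv /= andbT.
  by rewrite -[_ @^-1` _]setTI; exact: mh.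
have iE : mu.-integrable E (EFin \o h) by exact: integrableS ih.
have ic : mu.-integrable setT (EFin \o cst c : Y -> \bar R) by apply: bm_integrable; exact: bm_cst.
have icE : mu.-integrable E (EFin \o cst c : Y -> \bar R) by exact: integrableS ic.
have ihc : mu.-integrable E (EFin \o (fun x => h x - c)).
  have := integrableB mE iE icE.
  by apply: eq_integrable => // x _ /=; rewrite EFinB.
have i0 : \int[mu]_(x in E) (h x - c) = 0.
  apply/eqP; rewrite eq_le; apply/andP; split; last first.
    by apply: Rintegral_ge0 => x; rewrite /E /= subr_ge0 => /ltW.
  by rewrite RintegralB // Rintegral_cst // subr_le0.
have : (\int[mu]_(x in E) `|(h x - c)%:E|)%E = 0%E.
  have -> : (\int[mu]_(x in E) `|(h x - c)%:E|)%E = (\int[mu]_(x in E) (h x - c)%:E)%E.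
    apply: eq_integral => x; rewrite inE /E /= => cx; rewrite ger0_norm //.
    by rewrite subr_ge0 ltW.
  by rewrite -(fineK (integrable_fin_num mE ihc)); congr EFin.
have mhc : measurable_fun E (EFin \o (fun x => h x - c)) by case/integrableP : ihc.
move/(ae_eq_integral_abs mu mE mhc).
apply: filterS => x /= hx; rewrite leNgt; apply/negP => cx.
have := hx cx => -[] /eqP; rewrite subr_eq0 => /eqP hxc.
by rewrite hxc ltxx in cx.
Qed.

End ae_level.

Module L1_dual.
Section L1_dual.
Context {d} {Y : measurableType d} {R : realType}.
Variable mu : probability Y R.
Variables (Lam : (Y -> R) -> R) (C : R).
Hypothesis LamD : forall f g, bm f -> bm g -> Lam (fun x => f x + g x) = Lam f + Lam g.
Hypothesis LamZ : forall c f, bm f -> Lam (fun x => c * f x) = c * Lam f.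
Hypothesis C0 : 0 <= C.
Hypothesis LamC : forall f, bm f -> `|Lam f| <= C * mean mu (fun x => `|f x|).

Definition nu (A : set Y) : \bar R := (Lam \1_A)%:E.

Let Lam0 : Lam (fun _ => 0) = 0.
Proof.
apply/eqP; rewrite -normr_le0 (le_trans (LamC (bm_cst 0))) //.
rewrite (_ : (fun x : Y => `|0|) = (fun _ => 0 : R)) ?mean_cst ?mulr0 //.
by apply/funext => x; rewrite normr0.
Qed.

Let nu0 : nu set0 = 0%E.
Proof. by rewrite /nu indic0 Lam0. Qed.

Let nu_fin A : measurable A -> nu A \is a fin_num.
Proof. by []. Qed.

Let Lam_sum (J : Type) (r : seq J) (F : J -> Y -> R) : (forall i, bm (F i)) ->
  Lam (fun x => \sum_(i <- r) F i x) = \sum_(i <- r) Lam (F i).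
Proof.
move=> bF; elim: r => [|j r ih].
  by under eq_fun do rewrite big_nil; rewrite Lam0 big_nil.
under eq_fun do rewrite big_cons.
by rewrite LamD ?ih ?big_cons //; exact: bm_sum.
Qed.

Let LamB f g : bm f -> bm g -> Lam f - Lam g = Lam (fun x => f x - g x).
Proof.
move=> bf bg; rewrite LamD //; last exact: bmN.
congr (_ + _); rewrite -mulN1r -LamZ //; congr Lam; apply/funext => x.
by rewrite mulN1r.
Qed.

Let indic_sum_le (F : nat -> set Y) n x : trivIset setT F ->
  \sum_(i < n) (\1_(F i) x : R) <= \1_(\bigcup_i F i) x.
Proof.
move=> tF; rewrite [leRHS]indicE; case: (boolP (x \in _)) => [|/negP xF]; last first.
  rewrite big1 // => i _; rewrite indicE; case: (boolP (x \in F i)) => // /set_mem Fx.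
  by exfalso; apply: xF; rewrite inE; exists i.
move=> /set_mem [j _ Fjx] /=.
have out i : i != j -> \1_(F i) x = 0 :> R.
  move=> ij; rewrite indicE; case: (boolP (x \in F i)) => // /set_mem Fx.
  by move/eqP : ij => []; apply: tF => //; exists x.
have [jn|nj] := ltnP j n.
  rewrite (bigD1 (Ordinal jn)) //= big1 => [|i ij].
    by rewrite addr0 indicE; case: (_ \in _).
  by apply: out; apply: contra ij => /eqP ij; apply/eqP/val_inj.
rewrite big1 => [//|i _]; apply: out; apply/eqP => ij.
by have := ltn_ord i; rewrite ij ltnNge nj.
Qed.

Let nu_sigma : semi_sigma_additive nu.
Proof.
move=> F mF tF mU.
have bF i : bm (\1_(F i) : Y -> R) by exact: bm_indic.
have bU : bm (\1_(\bigcup_i F i) : Y -> R) by exact: bm_indic.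
have nuE n : (\sum_(0 <= i < n) nu (F i))%E = (Lam (fun x => \sum_(i < n) (\1_(F i) x : R)))%:E.
  by rewrite (@Lam_sum _ _ (fun i : 'I_n => \1_(F i))) // sumEFin big_mkord.
rewrite (_ : (fun n => _) = (EFin \o fun n => Lam (fun x => \sum_(i < n) (\1_(F i) x : R)))); last first.
  by apply/funext => n; rewrite nuE.
apply: cvg_EFin; first by near=> n.
rewrite (_ : fine \o _ = (fun n => Lam (fun x => \sum_(i < n) (\1_(F i) x : R)))) //.
have c1 : (fun n => fine (mu (\bigcup_i F i)) - \sum_(i < n) fine (mu (F i))) @ \oo --> (0 : R).
  have c0 : (fun n => \sum_(i < n) fine (mu (F i))) @ \oo --> fine (mu (\bigcup_i F i)).
    have /fine_cvg : (fun n => (\sum_(0 <= i < n) mu (F i))%E) @ \oo -->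
        (fine (mu (\bigcup_i F i)))%:E.
      by rewrite fineK ?fin_num_measure //; exact: measure_semi_sigma_additive.
    rewrite (_ : fine \o _ = (fun n => \sum_(i < n) fine (mu (F i)))) //.
    by apply/funext => n /=; rewrite -sum_fine ?big_mkord // => i _; rewrite fin_num_measure.
  have := cvgB (cvg_cst (fine (mu (\bigcup_i F i)))) c0.
  rewrite (_ : fine (mu (\bigcup_i F i)) - fine (mu (\bigcup_i F i)) = 0) ?subrr //.
  by move=> h; exact: h.
apply/cvgrPdist_le => /= e e0.
have C10 : 0 < C + 1 by rewrite ltr_wpDl.
have /cvgrPdist_le/(_ (e / (C + 1))) := c1.
rewrite divr_gt0 // => /(_ isT); apply: filterS => n /=.
rewrite sub0r normrN => small.
have bS : bm (fun x => \sum_(i < n) (\1_(F i) x : R)) by exact: (@bm_sum _ _ _ _ _ (fun i : 'I_n => \1_(F i))).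
rewrite LamB // (le_trans (LamC _)) //; first exact: (bmD bU (bmN bS)).
rewrite (@eq_mean _ _ _ _ _ (fun x => \1_(\bigcup_i F i) x - \sum_(i < n) (\1_(F i) x : R))); last first.
  by move=> x; rewrite ger0_norm // subr_ge0; exact: indic_sum_le.
rewrite meanB // mean_indic // (@mean_sum _ _ _ _ _ _ (fun i : 'I_n => \1_(F i))) //.
under eq_bigr do rewrite mean_indic //.
apply: (@le_trans _ _ ((C + 1) * (e / (C + 1)))); last by rewrite mulrC divfK // gt_eqF.
apply: ler_pM => //; last exact: le_trans (ler_norm _) small.
- rewrite subr_ge0 -mean_indic //.
  under eq_bigr do rewrite -mean_indic //.
  rewrite -(@mean_sum _ _ _ _ _ _ (fun i : 'I_n => \1_(F i))) //; apply: le_mean => // x.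
  exact: indic_sum_le.
- by rewrite lerDl.
Unshelve. all: end_near. Qed.

HB.instance Definition _ := isCharge.Build _ _ _ nu nu0 nu_fin nu_sigma.

Let nu_dom : nu `<< mu.
Proof.
apply/null_content_dominatesP => A mA A0; apply/eqP; rewrite /nu eqe -normr_le0.
rewrite (le_trans (LamC _)) //; first exact: bm_indic.
rewrite (@eq_mean _ _ _ _ _ (\1_A)) ?mean_indic //.
  by move: A0 => /= ->; rewrite mulr0.
by move=> x; rewrite ger0_norm // indicE; case: (_ \in _).
Qed.

Lemma indicator_density : exists2 g, bm g & forall A, measurable A ->
  Lam \1_A = mean mu (fun x => g x * \1_A x).
Proof.
pose h := Radon_Nikodym nu mu; pose hr x := fine (h x).
have ih : mu.-integrable setT h := Radon_Nikodym_integrable nu_dom.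
have hrE : EFin \o hr = h by apply/funext => x /=; rewrite fineK //; exact: Radon_Nikodym_fin_num.
have ihr : mu.-integrable setT (EFin \o hr) by rewrite hrE.
have mh : measurable_fun setT hr by apply/measurable_EFinP; case/integrableP : ihr.
have LamE A : measurable A -> (Lam \1_A)%:E = (\int[mu]_(x in A) (hr x)%:E)%E.
  move=> mA; have := @Radon_Nikodym_integral _ _ _ nu mu A nu_dom mA.
  by rewrite -/h -hrE.
have Lam_le A : measurable A -> `|Lam \1_A| <= C * fine (mu A).
  move=> mA; rewrite (le_trans (LamC _)) //; first exact: bm_indic.
  rewrite (@eq_mean _ _ _ _ _ (\1_A)) ?mean_indic // => x.
  by rewrite ger0_norm // indicE; case: (_ \in _).
have mlev c : measurable [set x | c < hr x].
  have -> : [set x | c < hr x] = hr @^-1` [set` `]c, +oo[ ].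
    by apply/seteqP; split => x /=; rewrite in_itv /= andbT.
  by rewrite -[_ @^-1` _]setTI; exact: mh.
have mlev' c : measurable [set x | c < - hr x].
  have -> : [set x | c < - hr x] = hr @^-1` [set` `]-oo, -c[ ].
    by apply/seteqP; split => x /=; rewrite in_itv /= ltrNr.
  by rewrite -[_ @^-1` _]setTI; exact: mh.
have up : {ae mu, forall x, hr x <= C}.
  apply: ae_le_level => //; rewrite /Rintegral -LamE //=.
  exact: le_trans (ler_norm _) (Lam_le _ (mlev _)).
have dn : {ae mu, forall x, - hr x <= C}.
  apply: ae_le_level.
    by have := integrableN ihr; apply: eq_integrable.
  rewrite (_ : \int[mu]_(x in _) _ = - Lam \1_[set x | C < - hr x]).
    by rewrite (le_trans (ler_norm _)) // normrN; exact: Lam_le.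
  rewrite (_ : \int[mu]_(x in _) _ = \int[mu]_(x in [set x | C < - hr x]) (-1 * hr x)).
    by rewrite RintegralZl ?mulN1r //; [rewrite /Rintegral -LamE|exact: integrableS ihr].
  by apply: eq_Rintegral => x _; rewrite mulN1r.
pose g x := Num.max (- C) (Num.min C (hr x)).
have bg : bm g.
  split.
    apply: measurable_maxr; first exact: measurable_cst.
    by apply: measurable_minr => //; exact: measurable_cst.
  exists C => x; rewrite ler_norml /g le_max lexx /= ge_max ge_min lexx /= andbT.
  by rewrite (le_trans _ C0) // oppr_le0.
exists g => // A mA; apply: EFin_inj.
rewrite EFin_mean; last exact: (bmM bg (bm_indic mA)).
rewrite LamE // [LHS]integral_mkcond.
apply: ae_eq_integral => //.
- apply/(measurable_restrict _ mA) => //; rewrite ?setTI; apply/measurable_EFinP.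
  exact: measurable_funTS mh.
- by apply/measurable_EFinP; case: (bmM bg (bm_indic mA)).
- move: up dn; apply: filterS2 => x hx hx' _; rewrite /patch indicE.
  case: ifPn => xA; rewrite ?mulr0 // mulr1 /g min_r // max_r // lerNl //.
Qed.

Lemma density : exists2 g, bm g & forall k, bm k ->
  Lam k = mean mu (fun x => g x * k x).
Proof.
have [g bg gE] := indicator_density; exists g => // k bk.
have bgk : bm (fun x => g x * k x) by exact: bmM.
have [D D0 gD] := bm_bound bg.
apply/eqP; rewrite -subr_eq0 -normr_le0; apply/ler_addgt0Pl => e e0; rewrite addr0.
(* Lam contributes C e' and the density D e' to the error *)
pose e' := e / (C + D).
have e'0 : 0 < e' by rewrite divr_gt0 // ltr_wpDl.
have [J [Z [v [mZ close]]]] := simple_approximation bk e'0.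
pose k' x := \sum_(j : J) v j * \1_(k @^-1` Z j) x.
have mk j : measurable (k @^-1` Z j) by exact: bm_preimage.
have bk'j j : bm (fun x => v j * \1_(k @^-1` Z j) x).
  by apply: bmM; [exact: bm_cst|exact: bm_indic].
have bk' : bm k' by exact: (@bm_sum _ _ _ _ _ (fun j x => v j * \1_(k @^-1` Z j) x)).
have k'g : Lam k' = mean mu (fun x => g x * k' x).
  rewrite /k' (@Lam_sum _ _ (fun j x => v j * \1_(k @^-1` Z j) x)) //.
  under [RHS]eq_mean do rewrite mulr_sumr.
  rewrite (@mean_sum _ _ _ _ _ _ (fun j x => g x * (v j * \1_(k @^-1` Z j) x))); last first.
    by move=> j; exact: bmM.
  apply: eq_bigr => j _; rewrite LamZ; last exact: bm_indic.
  rewrite gE // -meanZ; last by apply: bmM => //; exact: bm_indic.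
  by apply: eq_mean => x; rewrite mulrCA.
have bkk' : bm (fun x => k x - k' x) by bm.
have -> : Lam k - mean mu (fun x => g x * k x) =
    Lam (fun x => k x - k' x) - mean mu (fun x => g x * (k x - k' x)).
  rewrite -LamB // (@eq_mean _ _ _ _ (fun x => g x * (k x - k' x)) (fun x => g x * k x - g x * k' x)).
    rewrite meanB //; [by rewrite k'g; ring|by bm].
  by move=> x; rewrite mulrBr.
rewrite (le_trans (ler_normB _ _)) //.
have -> : e = C * e' + D * e' by rewrite /e' -mulrDl mulrC divfK // gt_eqF // ltr_wpDl.
apply: lerD.
  rewrite (le_trans (LamC _)) // ler_wpM2l // (le_trans (ler_norm _)) //.
  by apply: norm_mean_le => [|x]; [exact: bm_norm|rewrite normr_id].
apply: norm_mean_le => [|x]; first by bm.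
by rewrite normrM ler_pM.
Qed.

End L1_dual.
End L1_dual.

Section L1_dual_statement.
Context {d} {Y : measurableType d} {R : realType}.
Variable mu : probability Y R.

Definition linear_on_bm (Lam : (Y -> R) -> R) :=
  (forall f g, bm f -> bm g -> Lam (fun x => f x + g x) = Lam f + Lam g) /\
  (forall c f, bm f -> Lam (fun x => c * f x) = c * Lam f).

(** The bound makes A |-> Lam 1_A countably additive and absolutely
    continuous; its Radon-Nikodym derivative lies in [-C, C] almost everywhere,
    and the formula extends from indicators by uniform approximation. *)
Lemma L1_dual_density (Lam : (Y -> R) -> R) (C : R) : linear_on_bm Lam ->
  (forall f, bm f -> `|Lam f| <= C * mean mu (fun x => `|f x|)) ->
  exists2 g, bm g & forall k, bm k -> Lam k = mean mu (fun x => g x * k x).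
Proof.
move=> [LamD LamZ] LamC; apply: (@L1_dual.density _ _ _ mu Lam C) => //.
have := LamC _ (bm_cst 1); rewrite (_ : (fun _ => _) = (fun _ : Y => 1 : R)).
  by rewrite mean_cst mulr1; apply: le_trans.
by apply/funext => x; rewrite normr1.
Qed.

End L1_dual_statement.

(** * Ultralimits and invariant means on the integers *)

Lemma ultra_fmap (W V : Type) (F : W -> V) (U : set_system W) :
  UltraFilter U -> UltraFilter (fmap F U).
Proof.
move=> UU; split; first exact: fmap_proper_filter.
move=> G PG sG; apply/seteqP; split=> // A GA; rewrite /= /fmap /=.
have [//|nA] := in_ultra_setVsetC (F @^-1` A) UU.
have : G (~` A) by apply: sG.
by move=> /(filterI GA); rewrite setICr => /filter_ex [].
Qed.

Section ultralimits.
Context {R : realType} {J : Type} (U : set_system J).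
Hypothesis UU : UltraFilter U.
Implicit Types a b : J -> R.

Definition bdd {K : Type} (a : K -> R) := exists C, forall j, `|a j| <= C.

Definition ulim a : R := lim (a @ U).

Lemma ulim_cvg a : bdd a -> a @ U --> ulim a.
Proof.
move=> [C aC]; apply/cvg_ex.
have := @segment_compact R (- C) C; rewrite compact_ultra => /(_ (a @ U) (ultra_fmap a UU)) [].
  by apply: nearW => j /=; rewrite in_itv /= -ler_norml.
by move=> l [_ al]; exists l.
Qed.

Lemma ulimD a b : bdd a -> bdd b -> ulim (fun j => a j + b j) = ulim a + ulim b.
Proof. by move=> ba bb; apply/cvg_lim => //; apply: cvgD; exact: ulim_cvg. Qed.

Lemma ulimZ c a : bdd a -> ulim (fun j => c * a j) = c * ulim a.
Proof. by move=> ba; apply/cvg_lim => //; apply: cvgMr; exact: ulim_cvg. Qed.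

Lemma ulim_cst c : ulim (fun=> c) = c.
Proof. by apply/cvg_lim => //; exact: cvg_cst. Qed.

Lemma ulim_ge0 a : bdd a -> (\forall j \near U, 0 <= a j) -> 0 <= ulim a.
Proof. by move=> ba a0; apply: limr_ge => //; apply/cvg_ex; exists (ulim a); exact: ulim_cvg. Qed.

End ultralimits.

Section bounded_families.
Context {R : realType} {J : Type}.
Implicit Types a b : J -> R.

Lemma bddD a b : bdd a -> bdd b -> bdd (fun j => a j + b j).
Proof.
move=> [C aC] [D bD]; exists (C + D) => j.
by rewrite (le_trans (ler_normD _ _)) // lerD.
Qed.

Lemma bddM a b : bdd a -> bdd b -> bdd (fun j => a j * b j).
Proof. by move=> [C aC] [D bD]; exists (C * D) => j; rewrite normrM ler_pM. Qed.

Lemma bdd_cst c : bdd (fun _ : J => c : R).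
Proof. by exists `|c|. Qed.

End bounded_families.

Section weak_limits.
Context {d} {Y : measurableType d} {R : realType}.
Variable mu : probability Y R.

(** Weak compactness of sets of uniformly bounded functions: the ultralimit
    of the pairings is a functional of k dominated by the L1 norm. *)
Lemma weak_ulim (J : Type) (U : set_system J) (f : J -> Y -> R) (C : R) :
  UltraFilter U -> (forall j, bm (f j)) -> (forall j x, `|f j x| <= C) ->
  exists2 g, bm g & forall k, bm k ->
    (fun j => mean mu (fun x => f j x * k x)) @ U --> mean mu (fun x => g x * k x).
Proof.
move=> UU bf fC.
pose Lam k := ulim U (fun j => mean mu (fun x => f j x * k x)).
have le_fk k j : bm k -> `|mean mu (fun x => f j x * k x)| <= C * mean mu (fun x => `|k x|).
  move=> bk; rewrite (le_trans (le_norm_mean _ _)) //; first exact: bmM.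
  rewrite -meanZ; last exact: bm_norm.
  apply: le_mean => [||x]; [by apply: bm_norm; exact: bmM|by bm|].
  by rewrite normrM ler_wpM2r.
have bdfk k : bm k -> bdd (fun j => mean mu (fun x => f j x * k x)).
  by move=> bk; exists (C * mean mu (fun x => `|k x|)) => j; exact: le_fk.
have [||g bg gE] := @L1_dual_density _ _ _ mu Lam C.
- split => [k l bk bl|c k bk]; rewrite /Lam.
    rewrite -ulimD; try exact: bdfk.
    congr ulim; apply/funext => j; rewrite -meanD; try exact: bmM.
    by apply: eq_mean => x; rewrite mulrDr.
  rewrite -ulimZ; try exact: bdfk.
  congr ulim; apply/funext => j; rewrite -meanZ; try exact: bmM.
  by apply: eq_mean => x; rewrite mulrCA.
- move=> k bk; rewrite /Lam.
  have h := ulim_cvg UU (bdfk _ bk).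
  rewrite -[leLHS](cvg_lim _ (cvg_norm h)) //.
  apply: limr_le; first by apply/cvg_ex; eexists; exact: cvg_norm h.
  by apply: nearW => j; exact: le_fk.
- by exists g => // k bk; rewrite -gE //; apply: ulim_cvg; exact: bdfk.
Qed.

End weak_limits.

Section invariant_means.
Context {R : realType}.
Implicit Types a b : int -> R.

Record invariant_mean (E : (int -> R) -> R) : Prop := {
  imeanD : forall a b, bdd a -> bdd b -> E (fun m => a m + b m) = E a + E b ;
  imeanZ : forall c a, bdd a -> E (fun m => c * a m) = c * E a ;
  imean_cst : forall c, E (fun=> c) = c ;
  imean_ge0 : forall a, bdd a -> (forall m, 0 <= a m) -> 0 <= E a ;
  imean_shift : forall a p, bdd a -> E (fun m => a (m + p)) = E a ;
  imean_tail : forall a (M : int), bdd a -> (forall m, M < m -> a m = 0) -> E a = 0 }.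

(** The ultralimit of the averages over 0, ..., N. *)
Lemma invariant_mean_exists : exists E, invariant_mean E.
Proof.
have [U [UU sU]] := @ultraFilterLemma nat \oo _.
pose avg a (N : nat) : R := (N.+1%:R)^-1 * \sum_(m < N.+1) a m%:Z.
have avg_le a C N : (forall m, `|a m| <= C) -> `|avg a N| <= C.
  move=> aC; rewrite /avg normrM ger0_norm ?invr_ge0 //.
  rewrite mulrC ler_pdivrMr ?ltr0n // (le_trans (ler_norm_sum _ _ _)) //.
  apply: (@le_trans _ _ (\sum_(m < N.+1) C)); first by apply: ler_sum.
  by rewrite sumr_const card_ord mulr_natr.
have bavg a : bdd a -> bdd (avg a) by move=> [C aC]; exists C => N; exact: avg_le.
have ulim0 (u : nat -> R) : u @ \oo --> 0 -> ulim U u = 0.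
  by move=> u0; apply/cvg_lim => //; apply: cvg_trans u0; exact: cvg_app.
have ulimN u v : bdd u -> bdd v -> ulim U (fun n => u n - v n) = 0 -> ulim U u = ulim U v.
  move=> bu bv; rewrite (_ : (fun n => u n - v n) = (fun n => u n + (-1) * v n)); last first.
    by apply/funext => n; rewrite mulN1r.
  rewrite ulimD ?ulimZ //; last by apply: bddM => //; exact: bdd_cst.
  by rewrite mulN1r => /eqP; rewrite subr_eq0 => /eqP.
have small (u : nat -> R) D : (forall N, `|u N| <= N.+1%:R^-1 * D) -> ulim U u = 0.
  move=> uD; apply: ulim0; apply/cvgr0Pnorm_le => e e0.
  have D0 : 0 <= D by have := uD 0; rewrite invr1 mul1r; apply: le_trans.
  near=> N; rewrite (le_trans (uD N)) // mulrC ler_pdivrMr ?ltr0n //.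
  rewrite mulrC -ler_pdivrMr //.
  apply: (@le_trans _ _ N%:R); last by rewrite ler_nat.
  by near: N; exact: nbhs_infty_ger.
have sh1 b : bdd b -> ulim U (avg (fun m => b (m + 1))) = ulim U (avg b).
  move=> bb; have bb' : bdd (fun m => b (m + 1)) by have [C bC] := bb; exists C.
  apply: ulimN; try exact: bavg.
  have [C bC] := bb; apply: (small _ (C + C)) => N.
  rewrite /avg -mulrBr normrM ger0_norm ?invr_ge0 // ler_wpM2l ?invr_ge0 //.
  rewrite big_ord_recr /= [X in _ - X]big_ord_recl /=.
  rewrite (eq_bigr (fun i : 'I_N => b (bump 0 i)%:Z)); last first.
    by move=> i _; rewrite /bump /= add1n -addn1 PoszD.
  set S := \sum_(i < N) _; have -> x y : S + x - (y + S) = x - y by ring.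
  by rewrite (le_trans (ler_normB _ _)) // lerD.
have shn b (q : nat) : bdd b -> ulim U (avg (fun m => b (m + q%:Z))) = ulim U (avg b).
  move=> bb; elim: q => [|q ih]; first by under eq_fun do rewrite addr0.
  rewrite -ih -(sh1 (fun m => b (m + q%:Z))); last by have [C bC] := bb; exists C.
  congr ulim; congr avg; apply/funext => m.
  by rewrite -addn1 PoszD [q%:Z + _]addrC addrA.
exists (fun a => ulim U (avg a)); split.
- move=> a b ba bb; rewrite -ulimD; try exact: bavg.
  by congr ulim; apply/funext => N; rewrite /avg big_split mulrDr.
- move=> c a ba; rewrite -ulimZ; last exact: bavg.
  by congr ulim; apply/funext => N; rewrite /avg -mulr_sumr mulrCA.
- move=> c; rewrite (_ : avg _ = fun=> c) ?ulim_cst //; apply/funext => N.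
  by rewrite /avg sumr_const card_ord -[c *+ _]mulr_natl mulKf // pnatr_eq0.
- move=> a ba a0; apply: ulim_ge0; first exact: bavg.
  by apply: nearW => N; rewrite /avg mulr_ge0 ?invr_ge0 // sumr_ge0.
- move=> a p ba; case: p => q; first exact: shn.
  have bN : bdd (fun m => a (m + Negz q)) by have [C aC] := ba; exists C.
  rewrite -(shn _ q.+1 bN); congr ulim; congr avg; apply/funext => m.
  by rewrite NegzE addrK.
- move=> a M ba aM; rewrite -(shn _ `|M|.+1 ba).
  rewrite (_ : avg _ = fun=> 0) ?ulim_cst //; apply/funext => N.
  rewrite /avg big1 ?mulr0 // => m _; apply: aM.
  rewrite (le_lt_trans (lez_abs M)) //; lia.
Unshelve. all: end_near. Qed.

End invariant_means.

(** * Almost periodic functions and sets *)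

Section vanishing.
Context {d} {Y : measurableType d} {R : realType}.
Variable mu : probability Y R.

(** Continuity from above at the empty set. *)
Lemma mean_vanish (F : nat -> set Y) (e : R) : (forall n, measurable (F n)) ->
  nonincreasing_seq F -> \bigcap_n F n = set0 -> 0 < e ->
  exists n, mean mu \1_(F n) <= e.
Proof.
move=> mF ncF F0 e0.
have cF : (mu \o F) @ \oo --> mu (\bigcap_n F n).
  apply: nonincreasing_cvg_mu => //; last exact: bigcapT_measurable.
  by rewrite (le_lt_trans (probability_le1 mu (mF 0%N))) // ltry.
move: cF; rewrite F0 measure0 => /fine_cvg /cvgr0Pnorm_le /(_ e e0) [n _ /(_ n (leqnn n))] /=.
by exists n; rewrite mean_indic //; exact: le_trans (ler_norm _) _.
Qed.

End vanishing.

Section action.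
Context {d} {Y : measurableType d} {R : realType}.
Variables (mu : probability Y R) (T : int * int -> Y -> Y).

Record mp_action : Prop := {
  mp_measurable : forall w, measurable_fun setT (T w) ;
  mp_invariant : forall w B, measurable B -> mu (T w @^-1` B) = mu B ;
  mp_add : forall w u x, T w (T u x) = T (w + u) x ;
  mp_0 : forall x, T 0 x = x }.

Hypothesis hT : mp_action.
Implicit Types f g : Y -> R.

Lemma bm_T f w : bm f -> bm (fun x => f (T w x)).
Proof. by move=> bf; apply: (bm_comp (mp_measurable hT w) bf). Qed.

Lemma mean_T f w : bm f -> mean mu (fun x => f (T w x)) = mean mu f.
Proof.
move=> bf; apply: EFin_inj; rewrite !EFin_mean //; last exact: bm_T.
have mf : measurable_fun setT (EFin \o f) by apply/measurable_EFinP; case: bf.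
have mT := mp_measurable hT w.
have -> : (\int[mu]_x (f (T w x))%:E = \int[pushforward mu (T w)]_x (EFin \o f) x)%E.
  rewrite integral_pushforward //; last exact: (bm_integrable mu (bm_T w bf)).
apply: eq_measure_integral => A mA _; exact: mp_invariant.
Qed.

Lemma T_comm w u x : T w (T u x) = T u (T w x).
Proof. by rewrite !mp_add // addrC. Qed.

End action.

Section almost_periodic.
Context {d} {Y : measurableType d} {R : realType}.
Variables (mu : probability Y R) (T : int * int -> Y -> Y) (L : set (int * int)).
Hypothesis hT : mp_action mu T.
Implicit Types f g : Y -> R.
Let bT := bm_T hT.

(** Total boundedness in L2 of the orbit of f along L. *)
Definition almost_periodic f : Prop := forall e, 0 < e ->
  exists (J : finType) (kappa : int * int -> J), forall u v, L u -> L v ->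
    kappa u = kappa v -> mean mu (fun x => (f (T u x) - f (T v x)) ^+ 2) <= e.

Lemma ap_translate f w : bm f -> almost_periodic f ->
  almost_periodic (fun x => f (T w x)).
Proof.
move=> bf apf e e0; have [J [kappa ke]] := apf e e0.
exists J, kappa => u v Lu Lv /(ke u v Lu Lv) h; apply: etrans h.
rewrite -[in RHS](mean_T hT w); last by apply: bmX; apply: bmD; [exact: bT|apply: bmN; exact: bT].
congr (_ <= _); apply: eq_mean => x.
by rewrite (T_comm hT w) (T_comm hT w v).
Qed.

(** Closure of almost periodic functions under operations: intersect the
    colourings of f and of g. *)
Lemma ap_dominated2 (f g h : Y -> R) (K : R) : bm f -> bm g -> bm h -> 0 < K ->
  (forall x y, (h x - h y) ^+ 2 <= K * (f x - f y) ^+ 2 + K * (g x - g y) ^+ 2) ->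
  almost_periodic f -> almost_periodic g -> almost_periodic h.
Proof.
move=> bf bg bh K0 hfg apf apg e e0.
have e'0 : 0 < e / (2 * K) by rewrite divr_gt0 // mulr_gt0.
have [J1 [k1 ke1]] := apf _ e'0; have [J2 [k2 ke2]] := apg _ e'0.
exists (J1 * J2)%type, (fun u => (k1 u, k2 u)) => u v Lu Lv [/(ke1 u v Lu Lv) h1 /(ke2 u v Lu Lv) h2].
have bq (k : Y -> R) : bm k -> bm (fun x => (k (T u x) - k (T v x)) ^+ 2).
  by move=> bk; apply: bmX; apply: bmD; [exact: bT|apply: bmN; exact: bT].
apply: (@le_trans _ _ (K * mean mu (fun x => (f (T u x) - f (T v x)) ^+ 2) +
                       K * mean mu (fun x => (g (T u x) - g (T v x)) ^+ 2))); last first.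
  have -> : e = K * (e / (2 * K)) + K * (e / (2 * K)) by field; rewrite gt_eqF.
  by apply: lerD; rewrite ler_pM2l.
rewrite -!meanZ; try exact: bq.
rewrite -meanD; try (by apply: bmM; [exact: bm_cst|exact: bq]).
apply: le_mean => //; first exact: bq.
by apply: bmD; apply: bmM; [exact: bm_cst|exact: bq|exact: bm_cst|exact: bq].
Qed.

Lemma ap_lipschitz (phi : R -> R) (K : R) f : 0 < K ->
  (forall y z, `|phi y - phi z| <= K * `|y - z|) -> bm f -> bm (fun x => phi (f x)) ->
  almost_periodic f -> almost_periodic (fun x => phi (f x)).
Proof.
move=> K0 phiK bf bphi apf; apply: (@ap_dominated2 f f _ (K ^+ 2)) => //; first exact: exprn_gt0.
move=> x y; apply: (@le_trans _ _ (K ^+ 2 * (f x - f y) ^+ 2)); last first.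
  by rewrite lerDl mulr_ge0 ?sqr_ge0.
by rewrite -exprMn -ler_sqrt ?sqr_ge0 // !sqrtr_sqr normrM [`|K|]ger0_norm // ltW.
Qed.

Lemma apM f g : bm f -> bm g -> almost_periodic f -> almost_periodic g ->
  almost_periodic (fun x => f x * g x).
Proof.
move=> bf bg; have [C C0 fC] := bm_bound bf; have [D D0 gD] := bm_bound bg.
apply: (@ap_dominated2 _ _ _ (2 * (C ^+ 2 + D ^+ 2))) => //; first exact: bmM.
  by rewrite mulr_gt0 // addr_gt0 // exprn_gt0.
move=> x y.
have gx : g x ^+ 2 <= D ^+ 2 by rewrite -[g x ^+ 2]real_normK ?num_real // lerXn2r ?nnegrE // ltW.
have fy : f y ^+ 2 <= C ^+ 2 by rewrite -[f y ^+ 2]real_normK ?num_real // lerXn2r ?nnegrE // ltW.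
have -> : f x * g x - f y * g y = (f x - f y) * g x + (g x - g y) * f y by ring.
set a := f x - f y; set b := g x - g y.
have h1 : 0 <= (a * g x - b * f y) ^+ 2 by exact: sqr_ge0.
have h2 : a ^+ 2 * g x ^+ 2 <= a ^+ 2 * D ^+ 2 by rewrite ler_wpM2l // sqr_ge0.
have h3 : b ^+ 2 * f y ^+ 2 <= b ^+ 2 * C ^+ 2 by rewrite ler_wpM2l // sqr_ge0.
have h4 : 0 <= a ^+ 2 * C ^+ 2 by rewrite mulr_ge0 // sqr_ge0.
have h5 : 0 <= b ^+ 2 * D ^+ 2 by rewrite mulr_ge0 // sqr_ge0.
nra.
Qed.

Lemma ap_closed f : bm f ->
  (forall e, 0 < e -> exists g, [/\ bm g, almost_periodic g &
     mean mu (fun x => (f x - g x) ^+ 2) <= e]) -> almost_periodic f.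
Proof.
move=> bf happ e e0.
(* (p + q + r)^2 <= 3 (p^2 + q^2 + r^2), and each of the three terms is at most e / 9 *)
have e9 : 0 < e / 9 by rewrite divr_gt0.
have [g [bg apg fg]] := happ _ e9.
have [J [k ke]] := apg _ e9; exists J, k => u v Lu Lv /(ke u v Lu Lv) guv.
have bd w : bm (fun x => (f (T w x) - g (T w x)) ^+ 2).
  by apply: bmX; apply: bmD; [exact: bT|apply: bmN; exact: bT].
have bq (h : Y -> R) : bm h -> bm (fun x => (h (T u x) - h (T v x)) ^+ 2).
  by move=> bk; apply: bmX; apply: bmD; [exact: bT|apply: bmN; exact: bT].
have fgw w : mean mu (fun x => (f (T w x) - g (T w x)) ^+ 2) <= e / 9.
  by rewrite (@mean_T _ _ _ _ _ hT (fun x => (f x - g x) ^+ 2)) //; bm.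
apply: (@le_trans _ _ (3 * (mean mu (fun x => (f (T u x) - g (T u x)) ^+ 2) +
   mean mu (fun x => (g (T u x) - g (T v x)) ^+ 2) +
   mean mu (fun x => (f (T v x) - g (T v x)) ^+ 2)))).
  rewrite -!meanD ?meanZ; try by [exact: bd|exact: bq|apply: bmD; [exact: bd|exact: bq]].
  rewrite -meanZ; last by apply: bmD; [apply: bmD; [exact: bd|exact: bq]|exact: bd].
  apply: le_mean => [||x]; first exact: bq.
    by apply: bmM; [exact: bm_cst|apply: bmD; [apply: bmD; [exact: bd|exact: bq]|exact: bd]].
  set a := f (T u x); set b := g (T u x); set c := g (T v x); set h := f (T v x).
  have := sqr_ge0 ((a - b) - (b - c)); have := sqr_ge0 ((a - b) - (c - h)).
  have := sqr_ge0 ((b - c) - (c - h)); nra.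
have := fgw u; have := fgw v; lra.
Qed.

Lemma ap_cst c : almost_periodic (fun _ => c).
Proof.
move=> e e0; exists unit, (fun _ => tt) => u v _ _ _.
rewrite (@eq_mean _ _ _ _ _ (fun _ => 0)) ?mean_cst ?ltW // => x.
by rewrite subrr expr0n.
Qed.

Definition ap_set (B : set Y) : Prop := measurable B /\ almost_periodic \1_B.

Lemma ap_setC B : ap_set B -> ap_set (~` B).
Proof.
move=> [mB aB]; split; first exact: measurableC.
have -> : \1_(~` B) = (fun x => 1 - \1_B x) :> (Y -> R).
  by apply/funext => x; rewrite indicC indicE; case: (x \in B); rewrite ?subrr ?subr0.
have bB : bm (\1_B : Y -> R) by exact: bm_indic.
apply: (@ap_lipschitz (fun y => 1 - y) 1 \1_B) => //; last by bm.
by move=> y z; rewrite mul1r (_ : 1 - y - (1 - z) = z - y) 1?distrC //; ring.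
Qed.

Lemma ap_setI A B : ap_set A -> ap_set B -> ap_set (A `&` B).
Proof.
move=> [mA aA] [mB aB]; split; first exact: measurableI.
by rewrite indicI; apply: apM => //; exact: bm_indic.
Qed.

Lemma ap_setU A B : ap_set A -> ap_set B -> ap_set (A `|` B).
Proof.
move=> aA aB; rewrite -[_ `|` _]setCK setCU; apply: ap_setC; apply: ap_setI; exact: ap_setC.
Qed.

Lemma ap_set0 : ap_set set0.
Proof. by split => //; rewrite indic0; exact: ap_cst. Qed.

(** Sets are reached from functions as L2 limits.  The error is supported on
    sets F n that decrease to the empty set, and its square is bounded by their
    indicators. *)
Lemma ap_set_approx (B : set Y) (F : nat -> set Y) (g : nat -> Y -> R) :
  measurable B -> (forall n, measurable (F n)) -> nonincreasing_seq F ->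
  \bigcap_n F n = set0 -> (forall n, bm (g n)) -> (forall n, almost_periodic (g n)) ->
  (forall n x, (\1_B x - g n x) ^+ 2 <= \1_(F n) x) -> ap_set B.
Proof.
move=> mB mF nF F0 bg ag Bg; split => //; apply: ap_closed; first exact: bm_indic.
move=> e e0; have [n Fn] := mean_vanish mu mF nF F0 e0.
exists (g n); split => //; apply: le_trans Fn; apply: le_mean => //; last exact: bm_indic.
by apply: bmX; apply: bmD; [exact: bm_indic|exact: bmN].
Qed.

(** Complements and intersections come from 1 - f and f g, countable unions from
    the approximation by finite unions. *)
Lemma sigma_algebra_ap_set : sigma_algebra setT ap_set.
Proof.
split; [exact: ap_set0|by move=> A aA; rewrite setTD; exact: ap_setC|move=> A aA].
have aU n : ap_set (\big[setU/set0]_(i < n) A i).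
  by elim: n => [|n ih]; [rewrite big_ord0; exact: ap_set0|rewrite big_ord_recr; exact: ap_setU].
have mU : measurable (\bigcup_n A n) by apply: bigcupT_measurable => n; case: (aA n).
apply: (@ap_set_approx _ (fun n => (\bigcup_i A i) `\` \big[setU/set0]_(i < n) A i)
   (fun n => \1_(\big[setU/set0]_(i < n) A i))) => //.
- by move=> n; apply: measurableD => //; case: (aU n).
- move=> m n mn; apply/subsetPset => x [Ux nx]; split => // mx; apply: nx.
  move: mx; rewrite -!bigcup_mkord => -[i /= im Aix]; exists i => //=; exact: leq_trans mn.
- apply/seteqP; split => // x h; have [[i _ Aix] _] := h 0%N I.
  have [_] := h i.+1 I; apply; rewrite -bigcup_mkord; exists i => //=.
- by move=> n; apply: bm_indic; case: (aU n).
- by move=> n; case: (aU n).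
- move=> n x; rewrite !indicE in_setD; case: (boolP (x \in \big[setU/set0]_(i < n) A i)) => [xn|_] /=.
    rewrite mem_set ?subrr ?expr0n //; move: (set_mem xn); rewrite -bigcup_mkord => -[i _ Aix].
    by exists i.
  by rewrite andbT subr0; case: (_ \in _); rewrite ?expr1n ?expr0n.
Qed.

(** The indicator of (t, +oo[ is the limit of the Lipschitz ramps
    min(1, n max(0, y - t)), which preserve almost periodicity; the ramp and the
    indicator differ only where t < f <= t + 1/n. *)
Lemma ap_level f t : bm f -> almost_periodic f -> ap_set [set x | t < f x].
Proof.
move=> bf apf; have [mf _] := bf.
have mlev a : measurable [set x | a < f x].
  have -> : [set x | a < f x] = f @^-1` [set` `]a, +oo[ ].
    by apply/seteqP; split => x /=; rewrite in_itv /= andbT.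
  by rewrite -[_ @^-1` _]setTI; exact: mf.
pose phi n (y : R) := Num.min 1 (n.+1%:R * Num.max 0 (y - t)).
have phiL n y z : `|phi n y - phi n z| <= n.+1%:R * `|y - z|.
  have N0 : 0 <= n.+1%:R :> R by [].
  have minL (a b : R) : `|Num.min 1 a - Num.min 1 b| <= `|a - b|.
    have h1 := ler_norm (a - b); have h2 := ler_norm (b - a); rewrite distrC in h2.
    by case: (lerP 1 a) => ?; case: (lerP 1 b) => ?; rewrite ler_norml; apply/andP; split; lra.
  have maxL (a b : R) : `|Num.max 0 a - Num.max 0 b| <= `|a - b|.
    have h1 := ler_norm (a - b); have h2 := ler_norm (b - a); rewrite distrC in h2.
    by case: (lerP 0 a) => ?; case: (lerP 0 b) => ?; rewrite ler_norml; apply/andP; split; lra.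
  rewrite (le_trans (minL _ _)) // -mulrBr normrM ger0_norm // ler_wpM2l //.
  by rewrite (le_trans (maxL _ _)) // opprB addrA subrK.
have phi01 n y : 0 <= phi n y <= 1.
  rewrite /phi ge_min lexx /= andbT le_min ler01 /= mulr_ge0 //.
  by rewrite le_max lexx.
have bphi n : bm (fun x => phi n (f x)).
  split; last first.
    by exists 1 => x; have /andP[h0 h1] := phi01 n (f x); rewrite ger0_norm.
  apply: measurable_minr; first exact: measurable_cst.
  apply: measurable_funM; first exact: measurable_cst.
  apply: measurable_maxr; first exact: measurable_cst.
  by apply: measurable_funB => //; exact: measurable_cst.
apply: (@ap_set_approx _ (fun n => [set x | t < f x] `\` [set x | t + n.+1%:R^-1 < f x])
   (fun n x => phi n (f x))) => //.
- by move=> n; apply: measurableD.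
- move=> m n mn; apply/subsetPset => x [Ux nx]; split => // mx; apply: nx.
  apply: le_lt_trans mx; rewrite /= lerD2l lef_pV2 ?posrE // ler_nat. lia.
- apply/seteqP; split => // x h; have [/= tx _] := h 0%N I.
  have [_] := h (Num.trunc (f x - t)^-1) I; apply => /=.
  rewrite -ltrBrDl invf_plt ?posrE ?subr_gt0 // ?ltr0n //.
  exact: truncnS_gt.
- by move=> n; apply: (@ap_lipschitz (phi n) n.+1%:R).
- move=> n x; have /andP[h0 h1] := phi01 n (f x).
  rewrite !indicE in_setD; case: (boolP (x \in [set y | t < f y])) => [/set_mem /= tx|/negP xt] /=; last first.
    have fxt : f x <= t by rewrite leNgt; apply/negP => tx; apply: xt; rewrite inE.
    by rewrite /phi (max_l (_ : f x - t <= 0)) ?subr_le0 // mulr0 min_r ?subrr ?expr0n.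
  case: (boolP (x \in [set y | t + n.+1%:R^-1 < f y])) => [/set_mem /= tx'|_] /=; last first.
    by have := phi01 n (f x); nra.
  rewrite /phi min_l ?subrr ?expr0n // max_r ?subr_ge0 ?(ltW tx) //.
  rewrite mulrC -ler_pdivrMr ?ltr0n // div1r lerBrDl; exact: ltW.
Qed.

Lemma ap_measurable f (Z : set R) : bm f -> almost_periodic f -> measurable Z ->
  ap_set (f @^-1` Z).
Proof.
move=> bf apf mZ.
have h : measurable_fun setT (f : g_sigma_algebraType ap_set -> R).
  apply: (measurability _ (RGenOInfty.measurableE R)) => // _ [_ [x ->] <-].
  rewrite setTI; apply: sub_sigma_algebra.
  rewrite (_ : _ @^-1` _ = [set y | x < f y]); first exact: ap_level.
  by apply/seteqP; split => y /=; rewrite in_itv /= andbT.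
have := h measurableT Z mZ; rewrite setTI.
by rewrite /measurable /= sigma_algebra_id //; exact: sigma_algebra_ap_set.
Qed.

End almost_periodic.

(** * Finite colourings from ultrafilters and an approximate Bessel inequality *)

Section ultrafilter_colorings.

(** If no finite colouring exists, the complements of finitely colourable sets
    form a proper filter.  An ultrafilter above it contains a set of small
    diameter, which one colour suffices for, so it also contains the complement. *)
Lemma ultra_coloring (W : Type) (L : set W) (small : W -> W -> Prop) :
  (forall G : set_system W, UltraFilter G -> G L ->
     exists2 A, G A & forall u v, A u -> A v -> small u v) ->
  exists (J : finType) (kappa : W -> J),
    forall u v, L u -> L v -> kappa u = kappa v -> small u v.
Proof.
move=> usmall.
pose col (A : set W) := exists (J : finType) (kappa : W -> J),
  forall u v, A u -> A v -> kappa u = kappa v -> small u v.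
apply: contrapT => ncol.
have colS A B : A `<=` B -> col B -> col A.
  by move=> AB [J [k h]]; exists J, k => u v /AB Bu /AB Bv; exact: h.
pose F : set_system W := [set A | col (L `\` A)].
have PF : ProperFilter F.
  apply: Build_ProperFilter_ex => [A cA|].
    have [[x Ax]|nA] := pselect (exists x, A x); first by exists x.
    exfalso; apply: ncol; apply: colS cA => x Lx; split => // Ax; apply: nA; by exists x.
  split.
  - by exists unit, (fun _ => tt) => u v [_ /(_ I)].
  - move=> A B [J1 [k1 h1]] [J2 [k2 h2]].
    exists (J1 + J2)%type, (fun w => if w \in A then inr (k2 w) else inl (k1 w)) => u v [Lu nu] [Lv nv].
    case: ifPn => uA; case: ifPn => vA // [].
    + by apply: h2; split => // ?; [apply: nu|apply: nv]; split => //; exact: set_mem.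
    + by apply: h1; split => //; [move/negP : uA|move/negP : vA] => + ?; apply; rewrite inE.
  - by move=> A B AB; apply: colS => x [Lx nB]; split => // /AB.
have [G [UG FG]] := ultraFilterLemma PF.
have GL : G L by apply: FG; exists unit, (fun _ => tt) => u v [Lu /(_ Lu)].
have [A GA sA] := usmall G UG GL.
have : G (~` A).
  by apply: FG; exists unit, (fun _ => tt) => u v [_ /= /contrapT Au] [_ /= /contrapT Av] _; exact: sA.
by move=> /(filterI GA); rewrite setICr => /filter_ex [].
Qed.

(** Each new point only has to satisfy finitely many conditions, each of which
    holds on a set of the ultrafilter. *)
Lemma ultra_select (W : Type) (G : set_system W) (Q : set W) (P : W -> W -> Prop) :
  UltraFilter G -> G Q -> (forall u, \forall w \near G, P u w) ->
  forall n, exists u : nat -> W, forall j, (j < n)%N ->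
    Q (u j) /\ forall i, (i < j)%N -> P (u i) (u j).
Proof.
move=> UG GQ GP; have [w0 Qw0] := filter_ex GQ; elim=> [|n [u hu]]; first by exists (fun _ => w0).
have [w [Qw Pw]] : (Q `&` [set w | forall i : 'I_n, P (u i) w]) !=set0.
  by apply: (@filter_ex _ G); apply: filterI => //;
    exact: (@filter_forall _ _ (fun (i : 'I_n) w => P (u i) w) G _ (fun i => GP (u i))).
exists (fun j => if (j < n)%N then u j else w) => j jn1.
have [jn|nj] := ltnP j n.
  by have [Qj Pj] := hu j jn; split => // i ij; rewrite (ltn_trans ij jn); exact: Pj.
split => // i ij; have iN : (i < n)%N by lia.
by rewrite iN; exact: (Pw (Ordinal iN)).
Qed.

Lemma ultra_finite_cover (W : Type) (K : finType) (F : K -> set W) (A : set W) (U : set_system W) :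
  UltraFilter U -> U A -> (forall x, A x -> exists k, F k x) -> exists k, U (F k).
Proof.
move=> UU UA AF; apply: contrapT => nU.
have hU k : \forall x \near U, ~ F k x.
  by have [Uk|//] := in_ultra_setVsetC (F k) UU; exfalso; apply: nU; exists k.
have [x [/AF [k Fk] /(_ k)]] := @filter_ex _ U _ _
  (filterI UA (@filter_forall _ _ (fun k x => ~ F k x) U _ hU)).
exact.
Qed.

End ultrafilter_colorings.

Section bessel.
Context {d} {Y : measurableType d} {R : realType}.
Variable mu : probability Y R.

(** With c_i = <phi, k_i> and S = sum_i c_i^2 one has S = <phi, sum_i c_i k_i>.
    By Cauchy-Schwarz S^2 <= |phi|^2 |sum_i c_i k_i|^2, and the last factor is
    at most (K + 1) S because the off-diagonal terms add up to at most S. *)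
Lemma almost_bessel (n : nat) (k : 'I_n -> Y -> R) (phi : Y -> R) (K : R) :
  0 <= K -> bm phi -> (forall i, bm (k i)) -> (forall i, mean mu (fun x => k i x ^+ 2) <= K) ->
  (forall i j, i != j -> `|mean mu (fun x => k i x * k j x)| <= n%:R^-1) ->
  \sum_i (mean mu (fun x => phi x * k i x)) ^+ 2 <= mean mu (fun x => phi x ^+ 2) * (K + 1).
Proof.
move=> K0 bphi bk kK kk.
pose c i := mean mu (fun x => phi x * k i x).
rewrite -/(c _); set S := \sum_i _.
have S0 : 0 <= S by apply: sumr_ge0 => i _; exact: sqr_ge0.
have bck i : bm (fun x => c i * k i x) by apply: bmM => //; exact: bm_cst.
have SE : S = mean mu (fun x => phi x * \sum_i c i * k i x).
  under eq_mean do rewrite mulr_sumr.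
  rewrite (@mean_sum _ _ _ _ _ _ (fun i x => phi x * (c i * k i x))) => [|i]; last exact: bmM.
  apply: eq_bigr => i _; rewrite expr2 {1}/c -/(c i) mulrC -meanZ; last exact: bmM.
  by apply: eq_mean => x; rewrite mulrCA.
have bs : bm (fun x => \sum_i c i * k i x) by exact: (@bm_sum _ _ _ _ _ (fun i x => c i * k i x)).
have := mean_cauchy_schwarz mu bphi bs; rewrite -SE => CS.
have sq : mean mu (fun x => (\sum_i c i * k i x) ^+ 2) <= (K + 1) * S.
  pose D i j := (if i == j then c i ^+ 2 * K else 0) + (c i ^+ 2 + c j ^+ 2) / 2 * n%:R^-1.
  apply: (@le_trans _ _ (\sum_i \sum_j D i j)); last first.
    rewrite [leLHS](_ : _ = (K + 1) * S) //.
    have nS i : \sum_(j < n) (c i ^+ 2 + c j ^+ 2) / 2 * n%:R^-1 =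
        c i ^+ 2 / 2 + S / 2 * n%:R^-1.
      rewrite -!mulr_suml big_split /= sumr_const card_ord -/S.
      have n0 : (n%:R : R) != 0 by rewrite pnatr_eq0; case: n i {k kK kk bk c S S0 bck SE bs CS D} => // -[].
      by rewrite -mulr_natr; field.
    rewrite (eq_bigr (fun i => c i ^+ 2 * K + (c i ^+ 2 / 2 + S / 2 * n%:R^-1))); last first.
      move=> i _; rewrite /D big_split /= nS -big_mkcond /= (big_pred1 i) //.
    rewrite !big_split /= -!mulr_suml -/S sumr_const card_ord.
    have [n0|n0] := posnP n.
      have -> : S = 0 by rewrite /S big1 // => i; exfalso; case: i; rewrite n0.
      by rewrite !(mul0r, mulr0, mul0rn, add0r).
    by rewrite -mulr_natr; field; rewrite pnatr_eq0 -lt0n.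
  rewrite (@eq_mean _ _ _ _ _ (fun x => \sum_i \sum_j (c i * c j) * (k i x * k j x))); last first.
    move=> x; rewrite expr2 mulr_suml; apply: eq_bigr => i _; rewrite mulr_sumr.
    by apply: eq_bigr => j _; ring.
  have bij i j : bm (fun x => (c i * c j) * (k i x * k j x)).
    by apply: bmM; [exact: bm_cst|exact: bmM].
  rewrite (@mean_sum _ _ _ _ _ _ (fun i x => \sum_j (c i * c j) * (k i x * k j x))) => [|i]; last first.
    exact: (@bm_sum _ _ _ _ _ (fun j x => (c i * c j) * (k i x * k j x))).
  apply: ler_sum => i _.
  rewrite (@mean_sum _ _ _ _ _ _ (fun j x => (c i * c j) * (k i x * k j x))) //.
  apply: ler_sum => j _; rewrite meanZ; last exact: bmM.
  have amgm : `|c i * c j| <= (c i ^+ 2 + c j ^+ 2) / 2.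
    by rewrite ler_norml; have := sqr_ge0 (c i - c j); have := sqr_ge0 (c i + c j); nra.
  have n0 : 0 <= n%:R^-1 :> R by rewrite invr_ge0.
  rewrite /D; case: eqP => [<-|/eqP ij].
    have -> : mean mu (fun x => k i x * k i x) = mean mu (fun x => k i x ^+ 2) by [].
    rewrite -expr2 ler_wpDr //; last by rewrite ler_wpM2l ?sqr_ge0.
    by rewrite mulr_ge0 // divr_ge0 // addr_ge0 // sqr_ge0.
  rewrite add0r (le_trans (ler_norm _)) // normrM ler_pM //; exact: kk.
have [S00|Sn0] := eqVneq S 0.
  rewrite S00; apply: mulr_ge0; first by apply: mean_ge0 => x; exact: sqr_ge0.
  by rewrite addr_ge0.
have Sp : 0 < S by rewrite lt_neqAle eq_sym Sn0.
rewrite -(ler_pM2r Sp) -expr2 (le_trans CS) // -mulrA ler_wpM2l //.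
by apply: mean_ge0 => x; exact: sqr_ge0.
Qed.

End bessel.

(** * Lattice points of a strip *)

Section strip_points.
Context {R : realType}.
Variables (beta b : R).
Hypothesis b0 : 0 < b.

(** Signed vertical distance from u to the axis of the strip. *)
Definition offset (u : int * int) : R := beta * u.1%:~R - u.2%:~R.

Definition nearest (m : int) : int * int := (m, Num.floor (beta * m%:~R + 2^-1)).

(** Capped at 1/4 so that the point nearest to the axis is unambiguous and
    additive for points of the narrower strip. *)
Definition width : R := Num.min b 4^-1.

(** Lipschitz in the offset, unlike the indicator of the strip; this is what
    makes averages along the strip almost invariant under small translations. *)
Definition tent (m : int) : R := Num.max 0 (width / 2 - `|offset (nearest m)|).

Lemma offset_strip u : strip beta b u = (`|offset u| <= b / 2) :> Prop.
Proof.
rewrite /strip /= /offset ler_norml; congr (is_true _).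
by apply/andP/andP => -[h1 h2]; split; lra.
Qed.

Lemma offsetB u v : offset (u - v) = offset u - offset v.
Proof. by rewrite /offset /= !rmorphB /=; ring. Qed.

Lemma nearest_unique m n : `|offset (m, n)| < 2^-1 -> nearest m = (m, n).
Proof.
rewrite /offset /= ltr_norml /nearest => /andP[h1 h2]; congr pair.
by apply: floor_def; rewrite intrD /=; apply/andP; split; lra.
Qed.

Lemma offset_nearest m : `|offset (nearest m)| <= 2^-1.
Proof.
have := floor_itv (beta * m%:~R + 2^-1); rewrite intrD => /andP[].
rewrite /offset /nearest /=; set n := (Num.floor _)%:~R => h1 h2.
by rewrite ler_norml; apply/andP; split; lra.
Qed.

Lemma width_gt0 : 0 < width. Proof. by rewrite /width lt_min b0 invr_gt0 ltr0n. Qed.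
Lemma width_le : width <= 4^-1. Proof. by rewrite /width ge_min lexx orbT. Qed.

Lemma tent_ge0 m : 0 <= tent m. Proof. by rewrite /tent le_max lexx. Qed.

Lemma tent_le1 m : tent m <= 1.
Proof.
rewrite /tent ge_max ler01 /=; have := width_le; have := normr_ge0 (offset (nearest m)); lra.
Qed.

Lemma bdd_tent : bdd tent.
Proof. by exists 1 => m; rewrite ger0_norm ?tent_ge0 ?tent_le1. Qed.

Lemma tent_neq0 m : tent m != 0 -> `|offset (nearest m)| < width / 2.
Proof.
by move=> h; rewrite ltNge; apply: contra h => h; rewrite /tent max_l // subr_le0.
Qed.

Lemma tent_strip m : tent m != 0 -> strip beta b (nearest m).
Proof.
move=> /tent_neq0 h; rewrite offset_strip (le_trans (ltW h)) // ler_pM2r ?invr_gt0 //.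
by rewrite /width ge_min lexx.
Qed.

(** If one of the two weights is nonzero then both points are so close to the
    axis that taking the nearest point commutes with subtracting u, and the
    offsets differ by the offset of u. *)
Lemma tent_shift (u : int * int) m : `|offset u| <= 8^-1 ->
  (nearest (m - u.1) = nearest m - u /\ `|tent m - tent (m - u.1)| <= `|offset u|)
  \/ (tent m = 0 /\ tent (m - u.1) = 0).
Proof.
move=> u8; have w4 := width_le.
have key : nearest (m - u.1) = nearest m - u ->
    `|tent m - tent (m - u.1)| <= `|offset u|.
  move=> e; rewrite /tent e offsetB.
  have lip : `| `|offset (nearest m)| - `|offset (nearest m) - offset u| | <= `|offset u|.
    by rewrite (le_trans (ler_dist_dist _ _)) // opprB addrC subrK.
  move: lip; set x := `|offset (nearest m)|; set y := `|offset (nearest m) - offset u|.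
  set z := `|offset u|; rewrite ler_norml => /andP[h1 h2].
  case: (lerP 0 (width / 2 - x)) => hx; case: (lerP 0 (width / 2 - y)) => hy;
    by rewrite ler_norml; apply/andP; split; lra.
have [t0|t0] := eqVneq (tent m) 0; last first.
  left; have h := tent_neq0 t0.
  have e : nearest (m - u.1) = nearest m - u.
    apply: (@nearest_unique _ ((nearest m).2 - u.2)).
    have -> : (m - u.1, (nearest m).2 - u.2) = nearest m - u by case: (u).
    by rewrite offsetB (le_lt_trans (ler_normB _ _)) //; lra.
  by split => //; exact: key.
have [t1|t1] := eqVneq (tent (m - u.1)) 0; [by right|left].
have h := tent_neq0 t1.
have e : nearest m = nearest (m - u.1) + u.
  rewrite -[X in nearest X](subrK u.1 m).
  apply: (@nearest_unique _ ((nearest (m - u.1)).2 + u.2)).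
  have -> : (m - u.1 + u.1, (nearest (m - u.1)).2 + u.2) = nearest (m - u.1) - (- u).
    by rewrite opprK; case: (u).
  rewrite offsetB (le_lt_trans (ler_normB _ _)) //.
  have -> : offset (- u) = - offset u by rewrite -[- u]add0r offsetB /offset /= !mulr0 subrr sub0r.
  by rewrite normrN; lra.
have {}e : nearest (m - u.1) = nearest m - u by rewrite e addrK.
by split => //; exact: key.
Qed.

Variable E : (int -> R) -> R.
Hypothesis hE : invariant_mean E.

Lemma imean_le a c : bdd a -> bdd c -> (forall m, a m <= c m) -> E a <= E c.
Proof.
move=> ba bc ac; rewrite -subr_ge0.
have bN : bdd (fun m => (-1) * a m) by apply: bddM => //; exact: bdd_cst.
have -> : E c - E a = E (fun m => c m + (-1) * a m).
  by rewrite (imeanD hE) // (imeanZ hE) // mulN1r.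
apply: (imean_ge0 hE); first exact: bddD.
by move=> m; rewrite mulN1r subr_ge0.
Qed.

Lemma imean_ge0_tail a (M : int) : bdd a -> (forall m, M < m -> 0 <= a m) -> 0 <= E a.
Proof.
move=> ba a0; have [C aC] := ba.
pose a' m := if M < m then a m else 0; pose a'' m := if M < m then 0 else a m.
have C0 : 0 <= C := le_trans (normr_ge0 _) (aC 0).
have ba' : bdd a' by exists C => m; rewrite /a'; case: ifP => // _; rewrite normr0.
have ba'' : bdd a'' by exists C => m; rewrite /a''; case: ifP => // _; rewrite normr0.
have -> : a = (fun m => a' m + a'' m).
  by apply/funext => m; rewrite /a' /a''; case: ifP; rewrite ?addr0 ?add0r.
rewrite (imeanD hE) // (imean_tail hE (M := M) ba''); last by move=> m Mm; rewrite /a'' Mm.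
by rewrite addr0; apply: (imean_ge0 hE) => // m; rewrite /a'; case: ifP => // /a0.
Qed.

Lemma imean_sum (J : Type) (s : seq J) (a : J -> int -> R) : (forall j, bdd (a j)) ->
  bdd (fun m => \sum_(j <- s) a j m) /\ E (fun m => \sum_(j <- s) a j m) = \sum_(j <- s) E (a j).
Proof.
move=> ba; elim: s => [|j s [bs ih]].
  split; first by under eq_fun do rewrite big_nil; exact: bdd_cst.
  by under eq_fun do rewrite big_nil; rewrite (imean_cst hE) big_nil.
split; first by under eq_fun do rewrite big_cons; exact: bddD.
by under eq_fun do rewrite big_cons; rewrite (imeanD hE) // ih big_cons.
Qed.

(** Colour the integers by the offset of their nearest point, with classes of
    diameter at most width / 4.  Some class has positive mean, and translating it
    by one of its members moves it into the set where the tent is at least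
    width / 4. *)
Lemma imean_tent_gt0 : 0 < E tent.
Proof.
have w0 := width_gt0; have w4 := width_le.
have w40 : 0 < width / 4 by rewrite divr_gt0.
have [J [Q [_ Qe]]] := interval_coloring (2^-1 : R) w40.
pose ind j m : R := (Q (offset (nearest m)) == j)%:R.
have bind j : bdd (ind j) by exists 1 => m; rewrite /ind; case: (_ == _); rewrite ?normr0 ?normr1.
have [bs Es] := imean_sum (index_enum J) bind.
have s1 : \sum_(j : J) E (ind j) = 1.
  rewrite -Es -[RHS](imean_cst hE); congr E; apply/funext => m.
  rewrite (bigD1 (Q (offset (nearest m)))) //= /ind eqxx big1 ?addr0 // => j.
  by rewrite eq_sym => /negbTE ->.
have [j Ej] : exists j, 0 < E (ind j).
  apply: contrapT => nj; have : \sum_(j : J) E (ind j) <= 0.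
    by apply: sumr_le0 => j _; rewrite leNgt; apply/negP => ?; apply: nj; exists j.
  by rewrite s1 ler10.
have [m0 m0j] : exists m0, Q (offset (nearest m0)) = j.
  apply: contrapT => nm; move: Ej; have -> : ind j = fun=> 0; last by rewrite (imean_cst hE) ltxx.
  by apply/funext => m; rewrite /ind; case: eqP => // ?; exfalso; apply: nm; exists m.
apply: (@lt_le_trans _ _ (width / 4 * E (ind j))); first exact: mulr_gt0.
rewrite -(imeanZ hE) // -(imean_shift hE (- m0) bdd_tent).
have bt : bdd (fun m => tent (m - m0)) by have [C tC] := bdd_tent; exists C.
apply: imean_le => // [|m]; first by apply: bddM => //; exact: bdd_cst.
rewrite /ind; case: eqP => mj; last by rewrite mulr0 tent_ge0.
have /= := Qe _ _ (offset_nearest m) (offset_nearest m0); rewrite mj m0j => /(_ erefl).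
rewrite -offsetB mulr1 => h.
have e : nearest (m - m0) = nearest m - nearest m0.
  by apply: nearest_unique; rewrite (le_lt_trans h) //; lra.
by rewrite /tent e le_max; apply/orP; right; lra.
Qed.

End strip_points.

(** * Averaged correlations along a strip *)

Section strip_form.
Context {d} {Y : measurableType d} {R : realType}.
Variables (mu : probability Y R) (T : int * int -> Y -> Y).
Hypothesis hT : mp_action mu T.
Variables (beta b : R).
Hypothesis b0 : 0 < b.
Variable E : (int -> R) -> R.
Hypothesis hE : invariant_mean E.
Variables (f : Y -> R) (Cf : R).
Hypotheses (bf : bm f) (Cf0 : 0 < Cf) (fC : forall x, `|f x| <= Cf).
Implicit Types h k : Y -> R.

Definition correlation (m : int) h : R := mean mu (fun x => f (T (nearest beta m) x) * h x).

(** The averaged product of correlations of f with h and k: the bilinear form of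
    the mean of the rank-one operators h |-> <U^w(m) f, h> U^w(m) f. *)
Definition strip_form h k : R :=
  E (fun m => tent beta b m * (correlation m h * correlation m k)).

Let bfT w : bm (fun x => f (T w x)). Proof. exact: (bm_T hT). Qed.

Lemma correlation_le m h : bm h -> `|correlation m h| <= Cf * mean mu (fun x => `|h x|).
Proof.
move=> bh; rewrite (le_trans (le_norm_mean _ _)) //; first exact: bmM.
rewrite -meanZ; last exact: bm_norm.
apply: le_mean => [||x]; [by apply: bm_norm; exact: bmM|by bm|].
by rewrite normrM ler_wpM2r.
Qed.

Lemma correlation_bound m h C : bm h -> (forall x, `|h x| <= C) -> `|correlation m h| <= Cf * C.
Proof.
move=> bh hC; rewrite (le_trans (correlation_le m bh)) // ler_pM2l //.
rewrite (le_trans (ler_norm _)) //; apply: norm_mean_le => [|x]; first exact: bm_norm.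
by rewrite normr_id.
Qed.

Lemma bdd_correlation h : bm h -> bdd (fun m => correlation m h).
Proof.
by move=> bh; exists (Cf * mean mu (fun x => `|h x|)) => m; exact: correlation_le.
Qed.

Lemma bdd_integrand h k : bm h -> bm k ->
  bdd (fun m => tent beta b m * (correlation m h * correlation m k)).
Proof. by move=> bh bk; apply: bddM; [exact: bdd_tent|apply: bddM; exact: bdd_correlation]. Qed.

Lemma correlationD m h k : bm h -> bm k ->
  correlation m (fun x => h x + k x) = correlation m h + correlation m k.
Proof.
move=> bh bk; rewrite /correlation -meanD; try exact: bmM.
by apply: eq_mean => x; rewrite mulrDr.
Qed.

Lemma correlationZ m c h : bm h -> correlation m (fun x => c * h x) = c * correlation m h.
Proof.
move=> bh; rewrite /correlation -meanZ; last exact: bmM.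
by apply: eq_mean => x; rewrite mulrCA.
Qed.

Lemma correlationB m h k : bm h -> bm k ->
  correlation m (fun x => h x - k x) = correlation m h - correlation m k.
Proof.
move=> bh bk; rewrite correlationD //; last exact: bmN.
rewrite -(mulN1r (correlation m k)) -correlationZ //; congr (_ + correlation m _).
by apply/funext => x; rewrite mulN1r.
Qed.

Lemma strip_formC h k : strip_form h k = strip_form k h.
Proof. by rewrite /strip_form; congr E; apply/funext => m; congr (_ * _); rewrite mulrC. Qed.

Lemma strip_formD h k l : bm h -> bm k -> bm l ->
  strip_form h (fun x => k x + l x) = strip_form h k + strip_form h l.
Proof.
move=> bh bk bl; rewrite /strip_form -(imeanD hE); try exact: bdd_integrand.
by congr E; apply/funext => m; rewrite correlationD // -mulrDr -mulrDr.
Qed.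

Lemma strip_formZ c h k : bm h -> bm k ->
  strip_form h (fun x => c * k x) = c * strip_form h k.
Proof.
move=> bh bk; rewrite /strip_form -(imeanZ hE); last exact: bdd_integrand.
by congr E; apply/funext => m; rewrite correlationZ //; ring.
Qed.

Lemma strip_formB h k l : bm h -> bm k -> bm l ->
  strip_form h (fun x => k x - l x) = strip_form h k - strip_form h l.
Proof.
move=> bh bk bl; rewrite strip_formD //; last exact: bmN.
rewrite -(mulN1r (strip_form h l)) -strip_formZ //; congr (_ + strip_form h _).
by apply/funext => x; rewrite mulN1r.
Qed.

Lemma strip_form_ge0 h : bm h -> 0 <= strip_form h h.
Proof.
move=> bh; apply: (imean_ge0 hE); first exact: bdd_integrand.
by move=> m; rewrite mulr_ge0 ?tent_ge0 // -expr2 sqr_ge0.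
Qed.

Lemma strip_form_sub_le h k : bm h -> bm k ->
  strip_form (fun x => h x - k x) (fun x => h x - k x) <=
  2 * strip_form h h + 2 * strip_form k k.
Proof.
move=> bh bk; have bB : bm (fun x => h x - k x) by bm.
have bD : bm (fun x => h x + k x) by bm.
have := strip_form_ge0 bD.
rewrite strip_formB // ![strip_form (fun x => h x - k x) _]strip_formC !strip_formB //.
rewrite strip_formD // ![strip_form (fun x => h x + k x) _]strip_formC !strip_formD //.
by rewrite (strip_formC k h); lra.
Qed.

Lemma strip_form_cauchy_schwarz h k : bm h -> bm k ->
  strip_form h k ^+ 2 <= strip_form h h * strip_form k k.
Proof.
move=> bh bk; apply: discriminant_le; try exact: strip_form_ge0.
move=> t; have bl : bm (fun x => t * h x - k x) by bm.
suff -> : t ^+ 2 * strip_form h h - 2 * t * strip_form h k + strip_form k k =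
  strip_form (fun x => t * h x - k x) (fun x => t * h x - k x) by exact: strip_form_ge0.
have -> : strip_form (fun x => t * h x - k x) (fun x => t * h x - k x) =
   E (fun m => (t ^+ 2 * (tent beta b m * (correlation m h * correlation m h)) +
               (- (2 * t)) * (tent beta b m * (correlation m h * correlation m k))) +
               tent beta b m * (correlation m k * correlation m k)).
  congr E; apply/funext => m; rewrite correlationB //; last by bm.
  by rewrite correlationZ //; ring.
have bi := bdd_integrand; have bc := @bdd_cst R int.
rewrite !(imeanD hE) ?(imeanZ hE) //; try by [exact: bi|apply: bddM; [exact: bc|exact: bi]|
  apply: bddD; apply: bddM; [exact: bc|exact: bi|exact: bc|exact: bi]].
by rewrite /strip_form; ring.
Qed.

Lemma strip_form_le h k : bm h -> bm k ->
  `|strip_form h k| <= (Cf * mean mu (fun x => `|h x|)) * (Cf * mean mu (fun x => `|k x|)).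
Proof.
move=> bh bk; set M := (_ * _) * _.
have bM : bdd (fun _ : int => M) by exact: bdd_cst.
have bMN : bdd (fun _ : int => - M) by exact: bdd_cst.
have bi := bdd_integrand bh bk.
have hM m : `|tent beta b m * (correlation m h * correlation m k)| <= M.
  rewrite normrM (ger0_norm (tent_ge0 _ _ _)) -[M]mul1r ler_pM ?tent_ge0 ?tent_le1 //.
  by rewrite normrM ler_pM // correlation_le.
rewrite ler_norml -{1}(imean_cst hE (- M)) -{2}(imean_cst hE M); apply/andP; split.
  by apply: (imean_le hE) => // m; have := hM m; rewrite ler_norml => /andP[].
by apply: (imean_le hE) => // m; rewrite (le_trans (ler_norm _)).
Qed.

Lemma strip_form_bound h k Ch Ck : bm h -> bm k ->
  (forall x, `|h x| <= Ch) -> (forall x, `|k x| <= Ck) ->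
  `|strip_form h k| <= (Cf * Ch) * (Cf * Ck).
Proof.
move=> bh bk hC kC; rewrite (le_trans (strip_form_le bh bk)) //.
have le_m (l : Y -> R) C : bm l -> (forall x, `|l x| <= C) -> mean mu (fun x => `|l x|) <= C.
  move=> bl lC; rewrite (le_trans (ler_norm _)) //; apply: norm_mean_le => [|x]; first exact: bm_norm.
  by rewrite normr_id.
have m0 (l : Y -> R) : 0 <= Cf * mean mu (fun x => `|l x|).
  by rewrite mulr_ge0 ?(ltW Cf0) // mean_ge0.
by apply: ler_pM => //; rewrite ler_pM2l // le_m.
Qed.

(** Shift the averaging variable by the first coordinate of u: by [tent_shift] the
    correlations match exactly and only the weights change. *)
Lemma strip_form_translate (u : int * int) h k Ch Ck : `|offset beta u| <= 8^-1 ->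
  bm h -> bm k -> (forall x, `|h x| <= Ch) -> (forall x, `|k x| <= Ck) ->
  `|strip_form (fun x => h (T u x)) (fun x => k (T u x)) - strip_form h k|
    <= `|offset beta u| * ((Cf * Ch) * (Cf * Ck)).
Proof.
move=> u8 bh bk hC kC; set M := (Cf * Ch) * (Cf * Ck); set s := offset beta u.
have bi := bdd_integrand.
have bhu : bm (fun x => h (T u x)) by exact: (bm_T hT).
have bku : bm (fun x => k (T u x)) by exact: (bm_T hT).
have bsh : bdd (fun m => tent beta b (m - u.1) * (correlation (m - u.1) h * correlation (m - u.1) k)).
  by have [C aC] := bi _ _ bh bk; exists C.
rewrite /strip_form -(imean_shift hE (- u.1) (bi _ _ bh bk)).
have corr_shift m l : bm l -> nearest beta (m - u.1) = nearest beta m - u ->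
    correlation m (fun x => l (T u x)) = correlation (m - u.1) l.
  move=> bl e; rewrite /correlation e.
  rewrite -[RHS](mean_T hT u); last exact: (bmM (bfT _) bl).
  by apply: eq_mean => x; rewrite (mp_add hT) subrK.
have CM m : `|correlation m h * correlation m k| <= M.
  by rewrite normrM ler_pM // correlation_bound.
have hM m : `|tent beta b m * (correlation m (fun x => h (T u x)) * correlation m (fun x => k (T u x)))
   - tent beta b (m - u.1) * (correlation (m - u.1) h * correlation (m - u.1) k)| <= `|s| * M.
  have [[e ts]|[-> ->]] := tent_shift b m u8; last first.
    by rewrite !mul0r subrr normr0 mulr_ge0 // (le_trans _ (CM m)).
  by rewrite !corr_shift // -mulrBl normrM ler_pM.
set a1 := fun m => _ : R; set a2 := fun m => _ : R.
have ba1 : bdd a1 by exact: bi.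
have bN : bdd (fun m => (-1) * a2 m) by apply: bddM => //; exact: bdd_cst.
have -> : E a1 - E a2 = E (fun m => a1 m + (-1) * a2 m).
  by rewrite (imeanD hE) // (imeanZ hE) // mulN1r.
have bD : bdd (fun m => a1 m + (-1) * a2 m) by exact: bddD.
rewrite ler_norml -{1}(imean_cst hE (- (`|s| * M))) -{2}(imean_cst hE (`|s| * M)); apply/andP; split.
  apply: (imean_le hE) => //; first exact: bdd_cst.
  by move=> m; rewrite mulN1r; have := hM m; rewrite ler_norml => /andP[].
apply: (imean_le hE) => //; first exact: bdd_cst.
by move=> m; rewrite mulN1r (le_trans (ler_norm _)) // hM.
Qed.

(** Otherwise the ultrafilter contains the set where the form exceeds e, and from
    it one can select arbitrarily many almost orthogonal k_u.  Averaging Bessel's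
    inequality bounds the sum of their values, a contradiction. *)
Lemma strip_form_weakly_null (W : Type) (G : set_system W) (k : W -> Y -> R) (K e : R) :
  UltraFilter G -> 0 < e -> (forall u, bm (k u)) -> (forall u x, `|k u x| <= K) ->
  (forall h, bm h -> (fun u => mean mu (fun x => k u x * h x)) @ G --> (0 : R)) ->
  \forall u \near G, strip_form (k u) (k u) <= e.
Proof.
move=> UG e0 bk kK k0.
have [//|GQ] := in_ultra_setVsetC [set u | strip_form (k u) (k u) <= e] UG.
exfalso.
(* the bound that Bessel's inequality gives for the sum of the squared correlations *)
pose B := Cf ^+ 2 * (K ^+ 2 + 1).
pose n := (Num.trunc (B / e)).+1.
have n0 : 0 < n%:R^-1 :> R by rewrite invr_gt0 ltr0n.
have sep v : \forall w \near G, `|mean mu (fun x => k w x * k v x)| <= n%:R^-1.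
  by move/cvgr0Pnorm_le : (k0 (k v) (bk v)); apply.
have [u hu] := ultra_select (P := fun v w => `|mean mu (fun x => k w x * k v x)| <= n%:R^-1)
  UG GQ sep n.
pose kk (i : 'I_n) := k (u i).
have K2 : 0 <= K ^+ 2 by exact: sqr_ge0.
have bessel m : \sum_(i < n) correlation m (kk i) ^+ 2 <= B.
  apply: (le_trans (@almost_bessel _ _ _ mu n kk _ (K ^+ 2) K2 (bfT _) _ _ _)).
  - by move=> i; exact: bk.
  - move=> i; rewrite -[leRHS](mean_cst mu); apply: le_mean => [||x]; [by apply: bmX; exact: bk|exact: bm_cst|].
    have := kK (u i) x; rewrite -[_ ^+ 2]real_normK ?num_real // => h.
    by rewrite lerXn2r // nnegrE // (le_trans _ h).
  - move=> i j ij; rewrite /kk.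
    have [lt_ij|lt_ji|/val_inj eq_ij] := ltngtP i j; last by rewrite eq_ij eqxx in ij.
      have [_ /(_ i lt_ij)] := hu j (ltn_ord j).
      by rewrite (@eq_mean _ _ _ _ _ (fun x => k (u i) x * k (u j) x)) // => x; rewrite mulrC.
    by have [_ /(_ j lt_ji)] := hu i (ltn_ord i).
  - rewrite ler_wpM2r ?addr_ge0 // -[leRHS](mean_cst mu).
    apply: le_mean => [||x]; [by apply: bmX|exact: bm_cst|].
    rewrite -[_ ^+ 2]real_normK ?num_real // lerXn2r ?nnegrE // ltW //.
have bi i : bdd (fun m => tent beta b m * (correlation m (kk i) * correlation m (kk i))).
  by apply: bdd_integrand; exact: bk.
have [bS ES] := imean_sum hE (index_enum 'I_n) bi.
have leB : \sum_(i < n) strip_form (kk i) (kk i) <= B.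
  rewrite -ES -(imean_cst hE B); apply: (imean_le hE) => //; first exact: bdd_cst.
  move=> m; rewrite -mulr_sumr -[B]mul1r ler_pM ?tent_ge0 ?tent_le1 //; last first.
    by under eq_bigr do rewrite -expr2.
  by apply: sumr_ge0 => i _; rewrite -expr2 sqr_ge0.
have : n%:R * e <= B.
  apply: le_trans leB; rewrite mulr_natl -[X in _ *+ X]card_ord -sumr_const.
  apply: ler_sum => i _; have [/= /negP] := hu i (ltn_ord i).
  by rewrite -ltNge => /ltW.
by rewrite -ler_pdivlMr // leNgt /n truncnS_gt.
Qed.

End strip_form.

(** * Weak mixing along a strip *)

Section weak_mixing.
Context {d} {Y : measurableType d} {R : realType}.
Variables (mu : probability Y R) (T : int * int -> Y -> Y).
Hypothesis hT : mp_action mu T.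
Variables (beta b : R).
Hypothesis b0 : 0 < b.
Implicit Types f g h : Y -> R.

(** Along an ultrafilter on the strip the offsets converge, so for u, v in a
    suitable set of it and u0 fixed there, u - u0 and v - u0 have tiny offsets.  By
    near invariance, <U^u g - U^v g, kap> is close to
    B(U^(u-u0) h - U^(v-u0) h, U^(-u0) kap); the first argument is
    a difference of two members of a family that is weakly null once its weak limit
    is subtracted, so this is small.  Take kap = U^u g - U^v g. *)
Lemma strip_form_density_ap E (hE : invariant_mean E) f Cf g h : bm f -> 0 < Cf ->
  (forall x, `|f x| <= Cf) -> bm g -> bm h ->
  (forall k, bm k -> mean mu (fun x => g x * k x) = strip_form mu T beta b E f h k) ->
  almost_periodic mu T (strip beta b) g.
Proof.
move=> bf Cf0 fC bg bh gE e e0.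
have bT (k : Y -> R) w : bm k -> bm (fun x => k (T w x)) by exact: (bm_T hT).
have [Cg Cg0 gC] := bm_bound bg; have [Ch Ch0 hC] := bm_bound bh.
apply: ultra_coloring => G UG GL.
pose B := strip_form mu T beta b E f.
(* bounds on the form for the functions that occur below *)
pose M1 := (Cf * Ch) * (Cf * (Cg + Cg)).
pose M2 := (Cf * (Cg + Cg)) * (Cf * (Cg + Cg)).
have M10 : 0 < M1 by rewrite !mulr_gt0 // addr_gt0.
have M20 : 0 < M2 by rewrite !mulr_gt0 // addr_gt0.
(* near invariance requires offsets at most 1/8 and costs eta M1 for each of u and v *)
pose eta := Num.min 8^-1 (e / (4 * M1)).
have eta0 : 0 < eta by rewrite lt_min invr_gt0 ltr0n /= divr_gt0 // mulr_gt0.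
have [A0 GA0 A0eta] : exists2 A, G A & forall u v, A u -> A v ->
    `|offset beta u - offset beta v| <= eta.
  pose a u := if `|offset beta u| <= b / 2 then offset beta u else 0.
  have ba : bdd a.
    by exists (b / 2) => u; rewrite /a; case: ifP => // _; rewrite normr0 divr_ge0 // ltW.
  have /cvgrPdist_le := ulim_cvg UG ba.
  move=> /(_ (eta / 2)); rewrite divr_gt0 // => /(_ isT) Ga.
  exists ([set u | `|ulim G a - a u| <= eta / 2] `&` strip beta b); first exact: filterI.
  move=> u v [/= au]; rewrite offset_strip => su [/= av]; rewrite offset_strip => sv.
  move: au av; rewrite /a su sv !ler_norml => /andP[? ?] /andP[? ?]; apply/andP; split; lra.
have [u0 A0u0] := filter_ex GA0.
pose hu (u : int * int) x := h (T (u - u0) x).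
have bhu u : bm (hu u) by exact: bT.
have [hi bhi hiE] := @weak_ulim _ _ _ mu _ G hu Ch UG bhu (fun _ _ => hC _).
have [Chi Chi0 hiC] := bm_bound bhi.
pose ku u x := hu u x - hi x.
have bku u : bm (ku u) by rewrite /ku; bm.
(* chosen so that Cauchy-Schwarz bounds the remaining form by e / 2 *)
pose e1 := (e / 2) ^+ 2 / (4 * M2).
have e10 : 0 < e1 by apply: divr_gt0; [apply: exprn_gt0; exact: divr_gt0|exact: mulr_gt0].
have GA1 : \forall u \near G, B (ku u) (ku u) <= e1.
  apply: (strip_form_weakly_null hT beta b hE bf Cf0 fC (K := Ch + Chi)) => //.
    by move=> u x; rewrite (le_trans (ler_normB _ _)) // lerD // hC.
  move=> k bk.
  rewrite (_ : (fun u => _) = (fun u => mean mu (fun x => hu u x * k x) - mean mu (fun x => hi x * k x))).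
    by rewrite -(subrr (mean mu (fun x => hi x * k x))); apply: cvgB; [exact: hiE|exact: cvg_cst].
  apply/funext => u; rewrite -meanB; try exact: bmM.
  by apply: eq_mean => x; rewrite /ku mulrBl.
exists (A0 `&` [set u | B (ku u) (ku u) <= e1]); first exact: filterI.
move=> u v [A0u Bu] [A0v Bv].
pose kap x := g (T u x) - g (T v x).
have bkap : bm kap by rewrite /kap; apply: bmD; [exact: bT|apply: bmN; exact: bT].
have kapC x : `|kap x| <= Cg + Cg by rewrite (le_trans (ler_normB _ _)) // lerD.
pose kap' x := kap (T (- u0) x).
have bkap' : bm kap' by exact: bT.
have step w : A0 w -> `|mean mu (fun x => g (T w x) * kap x) - B (hu w) kap'| <= eta * M1.
  move=> A0w.
  have -> : mean mu (fun x => g (T w x) * kap x) = B h (fun x => kap (T (- w) x)).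
    rewrite /B -gE; last exact: bT.
    rewrite -[RHS](mean_T hT w); last by apply: bmM => //; exact: bT.
    by apply: eq_mean => x; rewrite (mp_add hT) addNr (mp_0 hT).
  have s8 : `|offset beta (w - u0)| <= eta by rewrite offsetB; exact: A0eta.
  have s8' : `|offset beta (w - u0)| <= 8^-1 by rewrite (le_trans s8) // /eta ge_min lexx.
  have bkw : bm (fun x => kap (T (- w) x)) by exact: bT.
  have := strip_form_translate hT b hE bf Cf0 fC s8' bh bkw hC (fun x => kapC _).
  rewrite (_ : (fun x => kap (T (- w) (T (w - u0) x))) = kap'); last first.
    by apply/funext => x; rewrite (mp_add hT) addrA addNr add0r.
  rewrite distrC => h1; apply: (le_trans h1); rewrite ler_wpM2r // ltW //.
have -> : mean mu (fun x => (g (T u x) - g (T v x)) ^+ 2) =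
    mean mu (fun x => g (T u x) * kap x) - mean mu (fun x => g (T v x) * kap x).
  rewrite -meanB; try by apply: bmM => //; exact: bT.
  by apply: eq_mean => x; rewrite -mulrBl expr2.
have hu_ku : B (fun x => ku u x - ku v x) kap' = B (hu u) kap' - B (hu v) kap'.
  rewrite (_ : (fun x => ku u x - ku v x) = (fun x => hu u x - hu v x)).
    by rewrite /B strip_formC (strip_formB hT beta b hE bf fC) // ![strip_form _ _ _ _ _ _ kap' _]strip_formC.
  by apply/funext => x; rewrite /ku; ring.
have diff : `|B (hu u) kap' - B (hu v) kap'| <= e / 2.
  rewrite -hu_ku; have bD : bm (fun x => ku u x - ku v x) by bm.
  have CS := strip_form_cauchy_schwarz hT beta b hE bf fC bD bkap'.
  have DD := strip_form_sub_le hT beta b hE bf fC (bku u) (bku v).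
  have KK := strip_form_bound hT beta b hE bf Cf0 fC bkap' bkap' (fun x => kapC _) (fun x => kapC _).
  have D0 := strip_form_ge0 hT beta b hE bf fC bD.
  have K0 := strip_form_ge0 hT beta b hE bf fC bkap'.
  rewrite -(@ler_pXn2r _ 2) ?nnegrE ?divr_ge0 ?(ltW e0) // real_normK ?num_real //.
  rewrite (le_trans CS) //; have -> : (e / 2) ^+ 2 = (4 * e1) * M2.
    by rewrite /e1; field; rewrite gt_eqF.
  apply: ler_pM => //; last by rewrite (le_trans (ler_norm _)).
  rewrite (le_trans DD) //; move: Bu Bv => /= Bu Bv; rewrite -/B; lra.
have := step u A0u; have := step v A0v.
have : eta * M1 <= e / 4.
  rewrite -ler_pdivlMr // /eta ge_min; apply/orP; right.
  by rewrite invfM mulrA.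
rewrite !ler_norml => h1 /andP[h2 h3] /andP[h4 h5].
move: diff; rewrite ler_norml => /andP[h6 h7]; lra.
Qed.

(** Orthogonality to the L2 space of the directional Kronecker algebra. *)
Definition ap_orthogonal f := forall g, bm g -> almost_periodic mu T (strip beta b) g ->
  mean mu (fun x => f x * g x) = 0.

Lemma ap_orthogonal_strip_form E (hE : invariant_mean E) f h : bm f -> ap_orthogonal f ->
  bm h -> strip_form mu T beta b E f h h = 0.
Proof.
move=> bf fo bh; have [Cf Cf0 fC] := bm_bound bf.
pose C := (Cf * mean mu (fun x => `|h x|)) * Cf.
have [||g bg gE] := @L1_dual_density _ _ _ mu (strip_form mu T beta b E f h) C.
- split; first by move=> k l bk bl; exact: (strip_formD hT beta b hE bf fC).
  by move=> c k bk; exact: (strip_formZ hT beta b hE bf fC).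
- by move=> k bk; have := strip_form_le hT beta b hE bf fC bh bk; rewrite mulrA.
have apg : almost_periodic mu T (strip beta b) g.
  by apply: (strip_form_density_ap hE bf Cf0 fC bg bh) => k bk; rewrite gE.
have g0 : mean mu (fun x => g x ^+ 2) = 0.
  rewrite (@eq_mean _ _ _ _ _ (fun x => g x * g x)) // -gE //.
  rewrite /strip_form -(imean_cst hE 0); congr E; apply/funext => m.
  suff -> : correlation mu T beta f m g = 0 by rewrite !mulr0.
  rewrite /correlation -(mean_T hT (- nearest beta m)); last first.
    by apply: bmM => //; exact: (bm_T hT).
  rewrite -[RHS](fo (fun x => g (T (- nearest beta m) x))).
  - by apply: eq_mean => x; rewrite (mp_add hT) subrr (mp_0 hT).
  - exact: (bm_T hT).
  - exact: ap_translate.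
have := mean_cauchy_schwarz mu bg bh; rewrite g0 mul0r gE // => sq0.
by apply/eqP; rewrite -sqrf_eq0 eq_le sq0 sqr_ge0.
Qed.

(** Otherwise, at every point of the strip far enough to the right one of the
    finitely many correlations has square at least e^2, and the sum of the forms,
    which is 0, would be at least e^2 times the mean of the tent. *)
Lemma directional_weak_mixing (J1 J2 : finType) (f : J1 -> Y -> R) (h : J2 -> Y -> R)
    (e : R) (M : int) :
  (forall j, bm (f j)) -> (forall j, ap_orthogonal (f j)) -> (forall l, bm (h l)) -> 0 < e ->
  exists w, [/\ strip beta b w, M < w.1 &
    forall j l, `|mean mu (fun x => f j (T w x) * h l x)| <= e].
Proof.
move=> bf fo bh e0; have [E hE] := @invariant_mean_exists R.
apply: contrapT => nw.
pose a (jl : J1 * J2) m := tent beta b m *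
  (correlation mu T beta (f jl.1) m (h jl.2) * correlation mu T beta (f jl.1) m (h jl.2)).
have ba jl : bdd (a jl).
  have [Cf Cf0 fC] := bm_bound (bf jl.1).
  exact: (bdd_integrand hT beta b (bf jl.1) fC).
have [bS ES] := imean_sum hE (index_enum (J1 * J2)%type) ba.
have E0 : E (fun m => \sum_(jl : J1 * J2) a jl m) = 0.
  rewrite ES big1 // => jl _; exact: ap_orthogonal_strip_form.
have bt := bdd_tent beta b.
have be : bdd (fun m => - e ^+ 2 * tent beta b m) by apply: bddM => //; exact: bdd_cst.
have : 0 <= E (fun m => \sum_(jl : J1 * J2) a jl m + - e ^+ 2 * tent beta b m).
  apply: (imean_ge0_tail hE (M := M)); first exact: bddD.
  move=> m Mm; rewrite mulNr subr_ge0 /a -mulr_sumr mulrC.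
  have [->|tm] := eqVneq (tent beta b m) 0; first by rewrite !mul0r.
  rewrite ler_wpM2l ?tent_ge0 //.
  have [jl hjl] : exists jl : J1 * J2, e < `|correlation mu T beta (f jl.1) m (h jl.2)|.
    apply: contrapT => njl; apply: nw; exists (nearest beta m); split => //.
      exact: tent_strip.
    by move=> j l; rewrite leNgt; apply/negP => ?; apply: njl; exists (j, l).
  rewrite (bigD1 jl) //= ler_wpDr //.
    by apply: sumr_ge0 => i _; rewrite -expr2 sqr_ge0.
  by rewrite -expr2 -[leRHS]real_normK ?num_real // lerXn2r ?nnegrE // ltW.
rewrite (imeanD hE) // (imeanZ hE) // E0 add0r mulNr oppr_ge0 pmulr_rle0 ?exprn_gt0 //.
by rewrite leNgt (imean_tent_gt0 beta b0 hE).
Qed.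

End weak_mixing.

(** * The function - t ln t *)

Section phi.
Context {R : realType}.
Implicit Types x y : R.

Definition phi x : R := - (x * ln x).

Lemma phi0 : phi 0 = 0. Proof. by rewrite /phi mul0r oppr0. Qed.

Lemma ln_le_sub1 x : 0 < x -> ln x <= x - 1.
Proof. by move=> x0; rewrite {1}(_ : x = 1 + (x - 1)); [apply: le_ln1Dx; lra|ring]. Qed.

(** The inequality ln z <= z - 1 at z = x / y, in a form that survives y = 0. *)
Lemma mul_lnB_le x y : 0 < x -> 0 <= y -> y * (ln x - ln y) <= x - y.
Proof.
move=> x0; rewrite le_eqVlt => /predU1P[<-|y0]; first by rewrite mul0r subr0 ltW.
rewrite -ln_div ?posrE //; have := ln_le_sub1 (divr_gt0 x0 y0).
rewrite -(ler_pM2l y0) mulrBr mulr1 mulrCA mulfV ?gt_eqF // mulr1 //.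
Qed.

(** The graph of phi lies below its tangent at x. *)
Lemma phi_le x y : 0 < x -> 0 <= y -> phi y <= - (y * ln x) + x - y.
Proof. by move=> x0 y0; have := mul_lnB_le x0 y0; rewrite /phi; lra. Qed.

Lemma phi_ge0 x : 0 <= x <= 1 -> 0 <= phi x.
Proof.
move=> /andP[x0 x1]; rewrite /phi -mulrN mulr_ge0 // oppr_ge0.
have [->|xn0] := eqVneq x 0; first by rewrite ln0.
by rewrite (le_trans (ln_le_sub1 _)) ?lt_neqAle 1?eq_sym ?xn0 ?x0 //; lra.
Qed.

Lemma phi_le1 x : 0 <= x <= 1 -> phi x <= 1.
Proof. by move=> /andP[x0 x1]; have := phi_le ltr01 x0; rewrite ln1; lra. Qed.

Lemma phi_subadd x y : 0 <= x -> 0 <= y -> phi (x + y) <= phi x + phi y.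
Proof.
have mono (u v : R) : 0 <= u -> 0 <= v -> u * ln u <= u * ln (u + v).
  rewrite le_eqVlt => /predU1P[<-|u0] v0; first by rewrite !mul0r.
  by rewrite ler_pM2l // ler_ln ?posrE // ?ltr_wpDr // lerDl.
move=> x0 y0; have := mono x y x0 y0; have := mono y x y0 x0.
by rewrite /phi (addrC y x) mulrDl; lra.
Qed.

Lemma phi_sum_le (J : Type) (s : seq J) (P : pred J) (p : J -> R) : (forall j, 0 <= p j) ->
  phi (\sum_(j <- s | P j) p j) <= \sum_(j <- s | P j) phi (p j).
Proof.
move=> p0; elim: s => [|j s ih]; first by rewrite !big_nil phi0.
rewrite !big_cons; case: ifP => // _.
by rewrite (le_trans (phi_subadd _ _)) ?sumr_ge0 // lerD2l.
Qed.

(** For x <= y and z = y - x, subadditivity gives phi y - phi x <= phi z, and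
    phi x - phi y <= z; moreover phi z <= 2 sqrt z. *)
Lemma phi_modulus (e : R) : 0 < e -> exists2 dl, 0 < dl & forall x y,
  0 <= x <= 1 -> 0 <= y <= 1 -> `|x - y| <= dl -> `|phi x - phi y| <= e.
Proof.
move=> e0; pose dl := Num.min 1 ((e / 3) ^+ 2).
have e3 : 0 < e / 3 by rewrite divr_gt0.
exists dl; first by rewrite lt_min ltr01 exprn_gt0.
suff key x y : 0 <= x -> x <= y -> y <= 1 -> y - x <= dl -> `|phi x - phi y| <= e.
  move=> x y /andP[x0 x1] /andP[y0 y1]; rewrite ler_norml => /andP[h1 h2].
  have [xy|/ltW yx] := leP x y; first by apply: key => //; lra.
  by rewrite distrC; apply: key => //; lra.
move=> x0 xy y1 dxy; set z := y - x in dxy *.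
have z0 : 0 <= z by rewrite subr_ge0.
have [z1 z2] : z <= 1 /\ z <= (e / 3) ^+ 2 by move: dxy; rewrite le_min => /andP[].
have yE : y = x + z by rewrite /z addrC subrK.
have up : phi y - phi x <= phi z by have := phi_subadd x0 z0; rewrite -yE; lra.
have dn : phi x - phi y <= z.
  have [y0|] := eqVneq y 0; first by rewrite (_ : x = y) ?subrr //; apply/eqP; rewrite eq_le xy y0.
  move=> yn0; have y0 : 0 < y by rewrite lt_neqAle eq_sym yn0 (le_trans x0).
  have := mul_lnB_le y0 x0; rewrite -/z.
  have : z * ln y <= 0.
    by rewrite mulr_ge0_le0 //; apply: le_trans (ln_le_sub1 y0) _; rewrite subr_le0.
  by rewrite /phi {3}yE; lra.
have phiz : phi z <= 2 * Num.sqrt z.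
  have [->|zn0] := eqVneq z 0; first by rewrite phi0 sqrtr0 mulr0.
  have {}z0 : 0 < z by rewrite lt_neqAle eq_sym zn0.
  have s0 : 0 < Num.sqrt z by rewrite sqrtr_gt0.
  have zE : z = Num.sqrt z ^+ 2 by rewrite sqr_sqrtr // ltW.
  have := @phi_le1 (Num.sqrt z); rewrite sqrtr_ge0 /= => h.
  have {}h : phi (Num.sqrt z) <= 1 by apply: h; rewrite -sqrtr1 ler_sqrt.
  have -> : phi z = 2 * Num.sqrt z * phi (Num.sqrt z).
    by rewrite {1}zE /phi lnXn // -mulr_natr; ring.
  by rewrite -[leRHS]mulr1 ler_wpM2l // mulr_ge0 // ltW.
have sz : Num.sqrt z <= e / 3.
  by rewrite -(ger0_norm (ltW e3)) -sqrtr_sqr ler_sqrt // sqr_ge0.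
have zs : z <= Num.sqrt z.
  have s1 : Num.sqrt z <= 1 by rewrite -sqrtr1 ler_sqrt.
  rewrite -{1}[z](@sqr_sqrtr R) // expr2 -[leRHS]mulr1 ler_wpM2l // sqrtr_ge0 //.
rewrite ler_norml; apply/andP; split; lra.
Qed.

Lemma measurable_phi : measurable_fun setT phi.
Proof. by apply: measurableT_comp => //; apply: measurable_funM => //; exact: measurable_ln. Qed.

End phi.

Section phi_mean.
Context {d} {Y : measurableType d} {R : realType}.
Variable mu : probability Y R.

Lemma bm_phi (g : Y -> R) : bm g -> (forall x, 0 <= g x <= 1) -> bm (fun x => phi (g x)).
Proof.
move=> bg g01; apply: bm_post => //; first exact: measurable_phi.
by exists 1 => x; rewrite ger0_norm ?phi_ge0 ?phi_le1.
Qed.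

(** Jensen's inequality on B for its normalized measure, multiplied by the
    measure of B: with t the integral of g over B and q = mu B, the right-hand side
    is q phi(t / q).  Writing it as phi t + t ln q covers the case q = 0. *)
Lemma mean_phi_jensen (g : Y -> R) (B : set Y) : measurable B -> bm g ->
  (forall x, 0 <= g x <= 1) ->
  mean mu (fun x => phi (g x) * \1_B x) <=
  phi (mean mu (fun x => g x * \1_B x)) + mean mu (fun x => g x * \1_B x) * ln (mean mu \1_B).
Proof.
move=> mB bg g01; set t := mean mu (fun x => g x * \1_B x); set q := mean mu \1_B.
have bB : bm (\1_B : Y -> R) by exact: bm_indic.
have bp := bm_phi bg g01.
have B01 x : 0 <= (\1_B x : R) <= 1 by rewrite indicE; case: (_ \in _); rewrite /= ?lexx ?ler01.
have t0 : 0 <= t by apply: mean_ge0 => x; have /andP[? _] := g01 x; have /andP[? _] := B01 x; exact: mulr_ge0.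
have tq : t <= q.
  apply: le_mean => // [|x]; first exact: bmM.
  by have /andP[h0 h1] := g01 x; have /andP[? _] := B01 x; rewrite ler_piMl.
have tangent s : 0 < s -> mean mu (fun x => phi (g x) * \1_B x) <= - (t * ln s) + s * q - t.
  move=> s0.
  have -> : - (t * ln s) + s * q - t =
      mean mu (fun x => ((- ln s - 1) * (g x * \1_B x)) + s * \1_B x).
    rewrite meanD ?meanZ //; try by bm.
    by rewrite -/t -/q; ring.
  apply: le_mean => [||x].
  - exact: bmM.
  - by apply: bmD; apply: bmM => //; [exact: bm_cst|exact: bmM|exact: bm_cst].
  - have /andP[h0 h1] := g01 x; have /andP[i0 _] := B01 x.
    have := phi_le s0 h0; rewrite -(subr_ge0 (phi _)) => h.
    have := mulr_ge0 h i0; lra.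
have [t00|tn0] := eqVneq t 0.
  rewrite t00 phi0 mul0r addr0; apply/ler_addgt0Pl => e e0; rewrite addr0.
  have q1 : 0 < q + 1 by rewrite ltr_wpDl // (le_trans t0).
  have := tangent (e / (q + 1)) (divr_gt0 e0 q1); rewrite t00 !(mul0r, oppr0, add0r, addr0).
  move=> h; apply: (le_trans h); rewrite -mulrA ler_piMr ?(ltW e0) // mulrC ler_pdivrMr // mul1r; lra.
have {}t0 : 0 < t by rewrite lt_neqAle eq_sym tn0.
have q0 : 0 < q by exact: lt_le_trans tq.
have := tangent (t / q) (divr_gt0 t0 q0).
rewrite ln_div ?posrE // divfK ?gt_eqF // /phi; lra.
Qed.

End phi_mean.

(** * Entropy of finite-valued measurable maps *)

Lemma sum_pairE (R : nmodType) (J K : finType) (G : J * K -> R) :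
  \sum_p G p = \sum_j \sum_k G (j, k).
Proof. by rewrite pair_bigA; apply: eq_bigr => -[]. Qed.

Section finite_variables.
Context {d} {Y : measurableType d} {R : realType}.
Variable mu : probability Y R.

Definition fvar {J : finType} (a : Y -> J) := forall j, measurable (a @^-1` [set j]).

Definition law {J : finType} (a : Y -> J) (j : J) : R := fine (mu (a @^-1` [set j])).

Definition ent {J : finType} (a : Y -> J) : R := \sum_j phi (law a j).

Lemma fvar_preimage (J : finType) (a : Y -> J) (Z : set J) : fvar a -> measurable (a @^-1` Z).
Proof.
move=> fa; have -> : a @^-1` Z = \bigcup_(j in Z) a @^-1` [set j].
  by apply/seteqP; split => x /= => [Zx|[j Zj ->]] //; exists (a x).
by apply: fin_bigcup_measurable => //; exact: finite_finset.
Qed.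

Lemma fvar_comp (J K : finType) (a : Y -> J) (h : J -> K) : fvar a -> fvar (h \o a).
Proof. by move=> fa k; rewrite comp_preimage; exact: fvar_preimage. Qed.

Lemma fvar_pair (J K : finType) (a : Y -> J) (c : Y -> K) : fvar a -> fvar c ->
  fvar (fun x => (a x, c x)).
Proof.
move=> fa fc [j k]; have -> : (fun x => (a x, c x)) @^-1` [set (j, k)] =
    a @^-1` [set j] `&` c @^-1` [set k].
  by apply/seteqP; split => x /= => [[-> ->]|[-> ->]].
exact: measurableI.
Qed.

Lemma law_mean (J : finType) (a : Y -> J) j : fvar a -> law a j = mean mu \1_(a @^-1` [set j]).
Proof. by move=> fa; rewrite mean_indic. Qed.

Lemma law_ge0 (J : finType) (a : Y -> J) j : 0 <= law a j.
Proof. by rewrite fine_ge0. Qed.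

Lemma law_le1 (J : finType) (a : Y -> J) j : fvar a -> law a j <= 1.
Proof.
move=> fa; rewrite law_mean // -(mean_cst mu 1); apply: le_mean => [||x]; [exact: bm_indic|exact: bm_cst|].
by rewrite indicE; case: (_ \in _).
Qed.

Lemma indic_sum_fvar (J : finType) (a : Y -> J) (A : set Y) x :
  \sum_j \1_(A `&` a @^-1` [set j]) x = \1_A x :> R.
Proof.
rewrite (bigD1 (a x)) //= big1 ?addr0 => [|j jx].
  by rewrite !indicE in_setI [X in _ && X]mem_set ?andbT.
by rewrite indicE in_setI [X in _ && X]memNset ?andbF //= => /eqP; rewrite eq_sym (negbTE jx).
Qed.

Lemma sum_measure_fvar (J : finType) (a : Y -> J) (A : set Y) : fvar a -> measurable A ->
  \sum_j fine (mu (A `&` a @^-1` [set j])) = fine (mu A).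
Proof.
move=> fa mA; rewrite -mean_indic //.
rewrite -(eq_mean mu (indic_sum_fvar a A)) (@mean_sum _ _ _ _ _ _ (fun j => \1_(A `&` a @^-1` [set j]))).
  by apply: eq_bigr => j _; rewrite mean_indic //; exact: measurableI.
by move=> j; apply: bm_indic; exact: measurableI.
Qed.

Lemma law_fibre (J K : finType) (a : Y -> J) (h : J -> K) k : fvar a ->
  law (h \o a) k = \sum_(j | h j == k) law a j.
Proof.
move=> fa; rewrite /law -(sum_measure_fvar fa); last by exact: fvar_comp.
rewrite [RHS]big_mkcond /=; apply: eq_bigr => j _; case: eqP => [hj|hj].
  congr (fine (mu _)); apply/seteqP; split => x /=; first by case.
  by move=> ax; split => //; rewrite /= ax.
rewrite (_ : _ `&` _ = set0) ?measure0 //.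
by apply/seteqP; split => // x /= [hx ax]; apply: hj; rewrite -ax.
Qed.

Lemma ent_comp_le (J K : finType) (a : Y -> J) (h : J -> K) : fvar a -> ent (h \o a) <= ent a.
Proof.
move=> fa; rewrite /ent.
under eq_bigr do rewrite law_fibre //.
rewrite [leRHS](partition_big h xpredT) //=; apply: ler_sum => k _.
by apply: phi_sum_le => j; exact: law_ge0.
Qed.

Lemma ent_factor_le (J K : finType) (a : Y -> J) (c : Y -> K) (h : K -> J) : fvar c ->
  (forall x, a x = h (c x)) -> ent a <= ent c.
Proof. by move=> fc ac; rewrite (_ : a = h \o c); [exact: ent_comp_le|exact/funext]. Qed.

(** Nonnegativity of the conditional mutual information of a and e given c, by
    the inequality y (ln x - ln y) <= x - y with y the joint law and
    x = p(a, c) p(e, c) / p(c). *)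
Lemma ent_submodular (I J K : finType) (a : Y -> I) (e : Y -> J) (c : Y -> K) :
  fvar a -> fvar e -> fvar c ->
  ent (fun x => ((a x, e x), c x)) + ent c <=
  ent (fun x => (a x, c x)) + ent (fun x => (e x, c x)).
Proof.
move=> fa fe fc.
pose p i j k := fine (mu (a @^-1` [set i] `&` e @^-1` [set j] `&` c @^-1` [set k])).
pose pa i k := fine (mu (a @^-1` [set i] `&` c @^-1` [set k])).
pose pe j k := fine (mu (e @^-1` [set j] `&` c @^-1` [set k])).
pose pc k := law c k.
have sa i k : \sum_j p i j k = pa i k.
  rewrite /pa -(sum_measure_fvar fe); last exact: measurableI.
  by apply: eq_bigr => j _; rewrite /p setIAC.
have se j k : \sum_i p i j k = pe j k.
  rewrite /pe -(sum_measure_fvar fa); last exact: measurableI.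
  by apply: eq_bigr => i _; rewrite /p -setIA setIC.
have sc k : \sum_i pa i k = pc k.
  rewrite /pc /law -(sum_measure_fvar fa); last exact: fc.
  by apply: eq_bigr => i _; rewrite /pa setIC.
have sc' k : \sum_j pe j k = pc k.
  rewrite /pc /law -(sum_measure_fvar fe); last exact: fc.
  by apply: eq_bigr => i _; rewrite /pe setIC.
have lawp (J1 J2 : finType) (u : Y -> J1) (v : Y -> J2) s t :
    law (fun x => (u x, v x)) (s, t) = fine (mu (u @^-1` [set s] `&` v @^-1` [set t])).
  congr (fine (mu _)); by apply/seteqP; split => x /= => [[-> ->]|[-> ->]].
have p0 i j k : 0 <= p i j k by rewrite fine_ge0.
have H3 : ent (fun x => ((a x, e x), c x)) = - \sum_i \sum_j \sum_k p i j k * ln (p i j k).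
  rewrite /ent !sum_pairE.
  rewrite -sumrN; apply: eq_bigr => i _; rewrite -sumrN; apply: eq_bigr => j _.
  rewrite -sumrN; apply: eq_bigr => k _; rewrite lawp /phi /p.
  suff -> : (fun x => (a x, e x)) @^-1` [set (i, j)] = a @^-1` [set i] `&` e @^-1` [set j] by [].
  by apply/seteqP; split => x /= => [[-> ->]|[-> ->]].
have Ha : ent (fun x => (a x, c x)) = - \sum_i \sum_j \sum_k p i j k * ln (pa i k).
  rewrite /ent sum_pairE.
  rewrite -sumrN; apply: eq_bigr => i _; rewrite exchange_big /= -sumrN; apply: eq_bigr => k _.
  by rewrite -mulr_suml sa lawp.
have He : ent (fun x => (e x, c x)) = - \sum_i \sum_j \sum_k p i j k * ln (pe j k).
  rewrite /ent sum_pairE.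
  rewrite [in RHS]exchange_big /= -sumrN; apply: eq_bigr => j _.
  rewrite exchange_big /= -sumrN; apply: eq_bigr => k _.
  by rewrite -mulr_suml se lawp.
have Hc : ent c = - \sum_i \sum_j \sum_k p i j k * ln (pc k).
  rewrite (eq_bigr (fun i => \sum_k pa i k * ln (pc k))); last first.
    by move=> i _; rewrite exchange_big /=; apply: eq_bigr => k _; rewrite -mulr_suml sa.
  rewrite exchange_big /= -sumrN; apply: eq_bigr => k _.
  by rewrite -mulr_suml sc.
pose q i j k := pa i k * pe j k / pc k.
have term i j k : p i j k - q i j k <=
    p i j k * (ln (p i j k) + ln (pc k) - ln (pa i k) - ln (pe j k)).
  have pa0 : 0 <= pa i k by rewrite fine_ge0.
  have pe0 : 0 <= pe j k by rewrite fine_ge0.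
  have ppa : p i j k <= pa i k by rewrite -sa (bigD1 j) //= lerDl sumr_ge0.
  have ppe : p i j k <= pe j k by rewrite -se (bigD1 i) //= lerDl sumr_ge0.
  have papc : pa i k <= pc k.
    by rewrite -sc (bigD1 i) //= lerDl sumr_ge0 // => i' _; rewrite fine_ge0.
  have [p00|pn0] := eqVneq (p i j k) 0.
    by rewrite p00 mul0r sub0r oppr_le0 divr_ge0 ?mulr_ge0 // (le_trans pa0).
  have pp : 0 < p i j k by rewrite lt_neqAle eq_sym pn0 p0.
  have pap := lt_le_trans pp ppa; have pep := lt_le_trans pp ppe; have pcp := lt_le_trans pap papc.
  have qp : 0 < q i j k by rewrite divr_gt0 // mulr_gt0.
  have := mul_lnB_le qp (ltW pp).
  by rewrite {1}/q ln_div ?posrE ?mulr_gt0 // lnM ?posrE //; lra.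
have total : \sum_i \sum_j \sum_k (p i j k - q i j k) = 0.
  rewrite (eq_bigr (fun i => \sum_k \sum_j (p i j k - q i j k))); last by move=> i _; rewrite exchange_big.
  rewrite exchange_big /= big1 // => k _.
  rewrite (eq_bigr (fun i => pa i k - pa i k * (pc k / pc k))); last first.
    move=> i _; rewrite sumrB sa; congr (_ - _); rewrite -(sc' k) mulr_suml mulr_sumr.
    by apply: eq_bigr => j _; rewrite sc' /q mulrA.
  rewrite sumrB -mulr_suml sc; have [->|pc0] := eqVneq (pc k) 0; first by rewrite mul0r subrr.
  by rewrite divff // mulr1 subrr.
rewrite -subr_ge0 H3 Ha He Hc -[leLHS]total.
set S3 := \sum_i \sum_j \sum_k p i j k * ln (p i j k); set Sa := \sum_i \sum_j \sum_k p i j k * ln (pa i k).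
set Se := \sum_i \sum_j \sum_k p i j k * ln (pe j k); set Sc := \sum_i \sum_j \sum_k p i j k * ln (pc k).
have -> : - Sa - Se - (- S3 - Sc) = \sum_i \sum_j \sum_k
    p i j k * (ln (p i j k) + ln (pc k) - ln (pa i k) - ln (pe j k)).
  have -> : - Sa - Se - (- S3 - Sc) = S3 + Sc - Sa - Se by ring.
  rewrite /S3 /Sc /Sa /Se -big_split /= -!sumrB; apply: eq_bigr => i _.
  rewrite -big_split /= -!sumrB; apply: eq_bigr => j _.
  rewrite -big_split /= -!sumrB; apply: eq_bigr => k _; ring.
by apply: ler_sum => i _; apply: ler_sum => j _; apply: ler_sum => k _; exact: term.
Qed.

End finite_variables.

(** * Conditional entropy *)

Section conditional_entropy.
Context {d} {Y : measurableType d} {R : realType}.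
Variable mu : probability Y R.

Definition cond_ent {I J : finType} (a : Y -> I) (c : Y -> J) : R :=
  ent mu (fun x => (a x, c x)) - ent mu c.

Definition joint {I : Type} (a : nat -> Y -> I) (k : nat) (x : Y) : {ffun 'I_k -> I} :=
  [ffun i : 'I_k => a i x].

Lemma fvar_joint (I : finType) (a : nat -> Y -> I) k : (forall i, fvar (a i)) -> fvar (joint a k).
Proof.
move=> fa f; have -> : joint a k @^-1` [set f] = \bigcap_(i in [set: 'I_k]) (a i @^-1` [set f i]).
  apply/seteqP; split => x /=; first by move=> <- i _; rewrite ffunE.
  by move=> h; apply/ffunP => i; rewrite ffunE; exact: h.
by apply: fin_bigcap_measurable => [|i _]; [exact: finite_finset|exact: fa].
Qed.

(** By induction on k for the join of all a i and c i: the new c costs no more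
    than in the join of the c i alone, and the new a no more than given the new c,
    both by submodularity. *)
Lemma ent_joint_le_cond (I J : finType) (a : nat -> Y -> I) (c : nat -> Y -> J) k :
  (forall i, fvar (a i)) -> (forall i, fvar (c i)) ->
  ent mu (joint a k) <= ent mu (joint c k) + \sum_(i < k) cond_ent (a i) (c i).
Proof.
move=> fa fc; have fA n := @fvar_joint _ a n fa; have fC n := @fvar_joint _ c n fc.
pose Z n x := (joint a n x, joint c n x).
have fZ n : fvar (Z n) by exact: fvar_pair.
suff key n : ent mu (Z n) <= ent mu (joint c n) + \sum_(i < n) cond_ent (a i) (c i).
  by apply: le_trans (key k); apply: (@ent_factor_le _ _ _ _ _ _ _ _ fst).
elim: n => [|n ih].
  rewrite big_ord0 addr0; apply: (@ent_factor_le _ _ _ _ _ _ _ _ (fun f => (ffun0 (card_ord 0), f)) (fC 0%N)) => x.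
  by congr pair; apply/ffunP => -[].
pose ext (K : finType) (q : {ffun 'I_n -> K} * K) : {ffun 'I_n.+1 -> K} :=
  [ffun i => if unlift ord_max i is Some j then q.1 j else q.2].
have extE (K : finType) (u : nat -> Y -> K) x : joint u n.+1 x = ext K (joint u n x, u n x).
  apply/ffunP => i; rewrite !ffunE; case: unliftP => [j ->|->] /=; last by [].
  by rewrite ffunE /bump leqNgt ltn_ord.
pose V x := (Z n x, a n x, c n x).
have fV : fvar V by apply: fvar_pair => //; exact: fvar_pair.
have h1 : ent mu (Z n.+1) <= ent mu V.
  apply: (@ent_factor_le _ _ _ _ _ _ _ _
    (fun v => (ext I (v.1.1.1, v.1.2), ext J (v.1.1.2, v.2))) fV) => x.
  by rewrite /Z !extE.
have h2 := ent_submodular mu (fZ n) (fa n) (fc n).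
have h3 := ent_submodular mu (fA n) (fc n) (fC n).
have h4 : ent mu (fun x => (Z n x, c n x)) <= ent mu (fun x => ((joint a n x, c n x), joint c n x)).
  apply: (@ent_factor_le _ _ _ _ _ _ _ _ (fun v => ((v.1.1, v.2), v.1.2))) => //.
  by apply: fvar_pair => //; exact: fvar_pair.
have h5 : ent mu (fun x => (c n x, joint c n x)) <= ent mu (joint c n.+1).
  apply: (@ent_factor_le _ _ _ _ _ _ _ _
    (fun f : {ffun 'I_n.+1 -> J} => (f ord_max, [ffun i : 'I_n => f (lift ord_max i)])) (fC _)) => x.
  rewrite ffunE; congr pair; apply/ffunP => i; rewrite !ffunE /=.
  by rewrite /bump leqNgt ltn_ord.
rewrite big_ord_recr /= [cond_ent (a n) _]/cond_ent; move: h1 h2 h3 h4 h5 ih; rewrite -/(V _); lra.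
Qed.

Lemma ent_joint_ge_cond (I : finType) (a : nat -> Y -> I) k : (forall i, fvar (a i)) ->
  \sum_(i < k) cond_ent (a i) (joint a i) <= ent mu (joint a k).
Proof.
move=> fa; elim: k => [|k ih].
  rewrite big_ord0; apply: sumr_ge0 => f _; apply: phi_ge0.
  by rewrite law_ge0 law_le1 //; exact: fvar_joint.
rewrite big_ord_recr /= {2}/cond_ent.
have : ent mu (fun x => (a k x, joint a k x)) <= ent mu (joint a k.+1); last by move: ih; lra.
apply: (@ent_factor_le _ _ _ _ _ _ _ _
  (fun f : {ffun 'I_k.+1 -> I} => (f ord_max, [ffun i : 'I_k => f (lift ord_max i)])) (@fvar_joint _ a k.+1 fa)) => x.
by rewrite ffunE; congr pair; apply/ffunP => i; rewrite !ffunE /= /bump leqNgt ltn_ord.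
Qed.

Lemma law_pair (I J : finType) (a : Y -> I) (c : Y -> J) i j :
  law mu (fun x => (a x, c x)) (i, j) = fine (mu (a @^-1` [set i] `&` c @^-1` [set j])).
Proof. by congr (fine (mu _)); apply/seteqP; split => x /= => [[-> ->]|[-> ->]]. Qed.

(** A form in which the joint law enters through a continuous function and a
    linear one, without division by the law of c. *)
Lemma cond_entE (I J : finType) (a : Y -> I) (c : Y -> J) : fvar a -> fvar c ->
  cond_ent a c = \sum_i \sum_j (phi (law mu (fun x => (a x, c x)) (i, j)) +
                                law mu (fun x => (a x, c x)) (i, j) * ln (law mu c j)).
Proof.
move=> fa fc; rewrite /cond_ent /ent sum_pairE.
have -> : \sum_j phi (law mu c j) = - \sum_i \sum_j law mu (fun x => (a x, c x)) (i, j) * ln (law mu c j).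
  rewrite exchange_big /= -sumrN; apply: eq_bigr => j _; rewrite -mulr_suml /phi.
  congr (- (_ * _)); rewrite /law -(sum_measure_fvar mu fa) //.
  by apply: eq_bigr => i _; rewrite -[RHS]/(law _ _ _) law_pair setIC.
by rewrite opprK -big_split /=; apply: eq_bigr => i _; rewrite big_split.
Qed.

Lemma law_pair_mean (I J : finType) (a : Y -> I) (c : Y -> J) i j : fvar a -> fvar c ->
  law mu (fun x => (a x, c x)) (i, j) =
  mean mu (fun x => \1_(a @^-1` [set i]) x * \1_(c @^-1` [set j]) x).
Proof.
move=> fa fc; rewrite law_pair -mean_indic; last exact: measurableI.
by apply: eq_mean => x; rewrite indicI.
Qed.

(** The joint laws differ by at most the L1 distance of the indicators, which for
    indicators is the squared L2 distance, and phi is uniformly continuous. *)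
Lemma cond_ent_close (I J : finType) (e : R) : 0 < e -> exists2 dl, 0 < dl &
  forall (a : Y -> I) (c c' : Y -> J), fvar a -> fvar c -> fvar c' ->
  (forall j, mean mu (fun x => (\1_(c @^-1` [set j]) x - \1_(c' @^-1` [set j]) x) ^+ 2) <= dl) ->
  cond_ent a c' <= cond_ent a c + e.
Proof.
move=> e0; pose N := (#|{: I * J}| + #|J|)%:R : R.
have N0 : 0 <= N by [].
have e'0 : 0 < e / (N + 1) by rewrite divr_gt0 // ltr_wpDl.
have [dl dl0 hphi] := phi_modulus e'0; exists dl => // a c c' fa fc fc' cc'.
have bI (A : set Y) : measurable A -> bm (\1_A : Y -> R) by exact: bm_indic.
have I01 (A : set Y) x : (\1_A x : R) = 0 \/ (\1_A x : R) = 1.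
  by rewrite indicE; case: (_ \in _); [right|left].
have bcc j : bm (fun x => \1_(c @^-1` [set j]) x - \1_(c' @^-1` [set j]) x : R).
  by apply: bmD; [exact: bI|apply: bmN; exact: bI].
have hc j : `|phi (law mu c' j) - phi (law mu c j)| <= e / (N + 1).
  apply: hphi; try by rewrite law_ge0 law_le1.
  rewrite distrC !law_mean // -meanB; try exact: bI.
  apply: le_trans (cc' j); rewrite (le_trans (le_norm_mean _ _)) //.
  apply: le_mean => [||x]; [exact: bm_norm|exact: bmX|].
  by case: (I01 (c @^-1` [set j]) x) => ->; case: (I01 (c' @^-1` [set j]) x) => ->;
    rewrite ?subrr ?subr0 ?sub0r ?normrN ?normr0 ?normr1 ?sqrrN ?expr1n ?expr0n.
have hac i j : `|phi (law mu (fun x => (a x, c' x)) (i, j)) - phi (law mu (fun x => (a x, c x)) (i, j))| <= e / (N + 1).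
  apply: hphi; try by rewrite law_ge0 law_le1 //; exact: fvar_pair.
  rewrite distrC !law_pair_mean // -meanB; try by apply: bmM; exact: bI.
  apply: le_trans (cc' j); rewrite (le_trans (le_norm_mean _ _)) //.
    by apply: bmD; [|apply: bmN]; apply: bmM; exact: bI.
  apply: le_mean => [||x]; [by apply: bm_norm; apply: bmD; [|apply: bmN]; apply: bmM; exact: bI|exact: bmX|].
  by case: (I01 (a @^-1` [set i]) x) => ->; case: (I01 (c @^-1` [set j]) x) => ->; case: (I01 (c' @^-1` [set j]) x) => ->;
    rewrite ?mul0r ?mul1r ?subrr ?subr0 ?sub0r ?normrN ?normr0 ?normr1 ?sqrrN ?expr1n ?expr0n.
have s1 : ent mu (fun x => (a x, c' x)) - ent mu (fun x => (a x, c x)) <= #|{: I * J}|%:R * (e / (N + 1)).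
  rewrite /ent -sumrB mulr_natl -sumr_const; apply: ler_sum => -[i j] _.
  exact: le_trans (ler_norm _) (hac i j).
have s2 : ent mu c - ent mu c' <= #|J|%:R * (e / (N + 1)).
  rewrite /ent -sumrB mulr_natl -sumr_const; apply: ler_sum => j _.
  by rewrite (le_trans (ler_norm _)) // distrC; exact: hc.
have : N * (e / (N + 1)) <= e by rewrite mulrCA ler_piMr ?(ltW e0) // ler_pdivrMr ?ltr_wpDl // mul1r lerDl.
by rewrite {1}/N natrD mulrDl /cond_ent; lra.
Qed.

End conditional_entropy.

(** * Conditional entropy against conditional probabilities *)

Section entropy_densities.
Context {d} {Y : measurableType d} {R : realType}.
Variable mu : probability Y R.

Lemma mean_fibres (J : finType) (c : Y -> J) (h : Y -> R) : fvar c -> bm h ->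
  \sum_j mean mu (fun x => h x * \1_(c @^-1` [set j]) x) = mean mu h.
Proof.
move=> fc bh; rewrite -(@mean_sum _ _ _ _ _ _ (fun j x => h x * \1_(c @^-1` [set j]) x)).
  apply: eq_mean => x; rewrite -mulr_sumr.
  have := indic_sum_fvar (R := R) c setT x; under eq_bigr do rewrite setTI.
  by rewrite indicT => ->; rewrite mulr1.
by move=> j; apply: bmM => //; exact: bm_indic.
Qed.

(** On a cell of c the conditional probability r of a = i is an average of g i
    over that cell, hence within dl of every value of g i there, so phi r is close
    to the values of phi (g i) there, by uniform continuity of phi. *)
Lemma cond_ent_le_mean_phi (I : finType) (e : R) : 0 < e -> exists2 dl, 0 < dl &
  forall (J : finType) (a : Y -> I) (c : Y -> J) (g : I -> Y -> R),
  fvar a -> fvar c -> (forall i, bm (g i)) -> (forall i x, 0 <= g i x <= 1) ->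
  (forall i x y, c x = c y -> `|g i x - g i y| <= dl) ->
  (forall i j, law mu (fun x => (a x, c x)) (i, j) = mean mu (fun x => g i x * \1_(c @^-1` [set j]) x)) ->
  cond_ent mu a c <= \sum_i mean mu (fun x => phi (g i x)) + e.
Proof.
move=> e0; pose N := #|I|%:R : R.
have N0 : 0 <= N by [].
pose e' := e / (N + 1).
have e'0 : 0 < e' by rewrite divr_gt0 // ltr_wpDl.
have [dl dl0 hphi] := phi_modulus e'0; exists dl => // J a c g fa fc bg g01 osc pE.
have bI (A : set Y) : measurable A -> bm (\1_A : Y -> R) by exact: bm_indic.
have I01 (A : set Y) x : 0 <= (\1_A x : R) <= 1.
  by rewrite indicE; case: (_ \in _); rewrite /= ?lexx ?ler01.
pose p i j := law mu (fun x => (a x, c x)) (i, j).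
have cell i j : phi (p i j) + p i j * ln (law mu c j) <=
    mean mu (fun x => phi (g i x) * \1_(c @^-1` [set j]) x) + e' * law mu c j.
  have bp := bm_phi (bg i) (g01 i).
  have b1 : bm (fun x => phi (g i x) * \1_(c @^-1` [set j]) x) by apply: bmM => //; exact: bI.
  have bgI : bm (fun x => g i x * \1_(c @^-1` [set j]) x) by apply: bmM => //; exact: bI.
  set q := law mu c j.
  have p0 : 0 <= p i j by exact: law_ge0.
  have pq : p i j <= q.
    rewrite /p pE /q law_mean //; apply: le_mean => // [|x]; first exact: bI.
    by have /andP[h0 h1] := g01 i x; have /andP[? _] := I01 (c @^-1` [set j]) x; rewrite ler_piMl.
  have [q0|qn0] := eqVneq q 0.
    have -> : p i j = 0 by apply/eqP; rewrite eq_le p0 andbT -q0.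
    rewrite phi0 mul0r addr0 q0 mulr0 addr0; apply: mean_ge0 => x.
    by have /andP[? _] := I01 (c @^-1` [set j]) x; rewrite mulr_ge0 // phi_ge0.
  have qp : 0 < q by rewrite lt_neqAle eq_sym qn0 law_ge0.
  pose r := p i j / q.
  have r01 : 0 <= r <= 1 by rewrite divr_ge0 ?(ltW qp) //= ler_pdivrMr // mul1r.
  have -> : phi (p i j) + p i j * ln q = q * phi r.
    have [p00|pn0] := eqVneq (p i j) 0; first by rewrite /r p00 !(mul0r, phi0, mulr0, addr0).
    have pp : 0 < p i j by rewrite lt_neqAle eq_sym pn0.
    by rewrite /phi /r ln_div ?posrE //; field.
  have near_r x : c x = j -> `|r - g i x| <= dl.
    move=> cx.
    have up : p i j <= (g i x + dl) * q.
      rewrite /p pE /q law_mean // -meanZ; last exact: bI.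
      apply: le_mean => // [|y]; first by apply: bmM; [exact: bm_cst|exact: bI].
      rewrite indicE; case: (boolP (y \in _)) => [/set_mem /= cy|_]; last by rewrite !mulr0.
      by rewrite !mulr1; have := osc i y x; rewrite cy cx => /(_ erefl); rewrite ler_norml => /andP[]; lra.
    have dn : (g i x - dl) * q <= p i j.
      rewrite /p pE /q law_mean // -meanZ; last exact: bI.
      apply: le_mean => // [|y]; first by apply: bmM; [exact: bm_cst|exact: bI].
      rewrite indicE; case: (boolP (y \in _)) => [/set_mem /= cy|_]; last by rewrite !mulr0.
      by rewrite !mulr1; have := osc i y x; rewrite cy cx => /(_ erefl); rewrite ler_norml => /andP[]; lra.
    rewrite ler_norml /r lerBrDr lerBlDr ler_pdivlMr // ler_pdivrMr // addrC dn /=.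
    by rewrite addrC.
  rewrite mulrC /q law_mean // -!meanZ; try exact: bI.
  rewrite -meanD //; last by apply: bmM; [exact: bm_cst|exact: bI].
  apply: le_mean => [||x].
  - by apply: bmM; [exact: bm_cst|exact: bI].
  - by apply: bmD => //; apply: bmM; [exact: bm_cst|exact: bI].
  - rewrite indicE; case: (boolP (x \in _)) => [/set_mem /= cx|_]; last by rewrite !mulr0 addr0.
    rewrite !mulr1; have := hphi _ _ r01 (g01 i x) (near_r x cx).
    by rewrite ler_norml => /andP[]; lra.
rewrite cond_entE //.
apply: (@le_trans _ _ (\sum_i \sum_j (mean mu (fun x => phi (g i x) * \1_(c @^-1` [set j]) x) + e' * law mu c j))).
  by apply: ler_sum => i _; apply: ler_sum => j _; exact: cell.
have tot : \sum_j law mu c j = 1.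
  rewrite -(mean_cst mu 1) -(mean_fibres fc (bm_cst 1)); apply: eq_bigr => j _.
  by rewrite law_mean //; apply: eq_mean => x; rewrite mul1r.
rewrite (eq_bigr (fun i => mean mu (fun x => phi (g i x)) + e')); last first.
  by move=> i _; rewrite big_split /= -mulr_sumr tot mulr1 mean_fibres //; exact: bm_phi.
rewrite big_split /= lerD2l sumr_const -mulr_natl -/N /e' mulrCA ler_piMr ?(ltW e0) //.
by rewrite ler_pdivrMr ?ltr_wpDl // mul1r lerDl.
Qed.

(** If the joint law were exactly the integral of g i over the cells of c, this
    would be Jensen's inequality on each cell.  The error enters through phi and
    through the factors ln (law c j); since the latter are fixed by c, dl may depend
    on them. *)
Lemma mean_phi_le_cond_ent (I J : finType) (c : Y -> J) (e : R) : 0 < e -> fvar c ->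
  exists2 dl, 0 < dl & forall (a : Y -> I) (g : I -> Y -> R),
  fvar a -> (forall i, bm (g i)) -> (forall i x, 0 <= g i x <= 1) ->
  (forall i j, `|mean mu (fun x => (\1_(a @^-1` [set i]) x - g i x) * \1_(c @^-1` [set j]) x)| <= dl) ->
  \sum_i mean mu (fun x => phi (g i x)) - e <= cond_ent mu a c.
Proof.
move=> e0 fc; pose N := #|{: I * J}|%:R : R.
have N0 : 0 <= N by [].
pose e' := e / (2 * (N + 1)).
have e'0 : 0 < e' by rewrite divr_gt0 // mulr_gt0 // ltr_wpDl.
have [dl dl0 hphi] := phi_modulus e'0.
pose Lg := \sum_j `|ln (law mu c j)| + 1.
have Lg0 : 0 < Lg by rewrite ltr_wpDl // sumr_ge0.
(* the first bound controls phi of the joint law, the second the linear term *)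
exists (Num.min dl (e' / Lg)); first by rewrite lt_min dl0 divr_gt0.
move=> a g fa bg g01 hclose.
have bI (A : set Y) : measurable A -> bm (\1_A : Y -> R) by exact: bm_indic.
have I01 (A : set Y) x : 0 <= (\1_A x : R) <= 1.
  by rewrite indicE; case: (_ \in _); rewrite /= ?lexx ?ler01.
pose p i j := law mu (fun x => (a x, c x)) (i, j).
pose t i j := mean mu (fun x => g i x * \1_(c @^-1` [set j]) x).
have bgI i j : bm (fun x => g i x * \1_(c @^-1` [set j]) x) by apply: bmM => //; exact: bI.
have pt i j : `|p i j - t i j| <= Num.min dl (e' / Lg).
  rewrite /p law_pair_mean // /t -meanB //; last by apply: bmM; exact: bI.
  rewrite (@eq_mean _ _ _ _ _ (fun x => (\1_(a @^-1` [set i]) x - g i x) * \1_(c @^-1` [set j]) x)) // => x.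
  by rewrite mulrBl.
have t01 i j : 0 <= t i j <= 1.
  apply/andP; split.
    by apply: mean_ge0 => x; have /andP[? _] := g01 i x; have /andP[? _] := I01 (c @^-1` [set j]) x; exact: mulr_ge0.
  rewrite -(mean_cst mu 1); apply: le_mean => // [|x]; first exact: bm_cst.
  by have /andP[? ?] := g01 i x; have /andP[? ?] := I01 (c @^-1` [set j]) x; rewrite mulr_ile1.
have p01 i j : 0 <= p i j <= 1 by rewrite law_ge0 law_le1 //; exact: fvar_pair.
have cell i j : mean mu (fun x => phi (g i x) * \1_(c @^-1` [set j]) x) - (e' + e') <=
    phi (p i j) + p i j * ln (law mu c j).
  have J1 := mean_phi_jensen mu (fc j) (bg i) (g01 i); rewrite -/(t i j) -law_mean // in J1.
  have := pt i j; rewrite le_min => /andP[pt1 pt2].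
  have := hphi _ _ (p01 i j) (t01 i j) pt1; rewrite ler_norml => /andP[h1 h2].
  have : `|(p i j - t i j) * ln (law mu c j)| <= e'.
    have lnL : `|ln (law mu c j)| <= Lg.
      by rewrite /Lg (bigD1 j) //= -addrA lerDl addr_ge0 // sumr_ge0.
    have -> : e' = e' / Lg * Lg by rewrite divfK // gt_eqF.
    by rewrite normrM ler_pM.
  by rewrite ler_norml => /andP[h3 h4]; move: J1 h3; rewrite mulrBl; lra.
rewrite cond_entE //.
apply: (@le_trans _ _ (\sum_i \sum_j (mean mu (fun x => phi (g i x) * \1_(c @^-1` [set j]) x) - (e' + e')))); last first.
  by apply: ler_sum => i _; apply: ler_sum => j _; exact: cell.
rewrite [leRHS](eq_bigr (fun i => mean mu (fun x => phi (g i x)) - (e' + e') *+ #|J|)); last first.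
  by move=> i _; rewrite sumrB mean_fibres // ?sumr_const //; exact: bm_phi.
rewrite sumrB lerD2l lerN2 sumr_const -mulrnA mulnC -card_prod -mulr_natl -/N.
have -> : e' + e' = e / (N + 1) by rewrite /e'; field; rewrite gt_eqF // ltr_wpDl.
by rewrite mulrCA ler_piMr ?(ltW e0) // ler_pdivrMr ?ltr_wpDl // mul1r lerDl.
Qed.

End entropy_densities.

(** * Entropy along sequences in a strip *)

Section recursive_choice.

(** Dependent choice of a sequence whose k-th term depends on all the previous
    ones; the condition may only look at the first k terms. *)
Lemma prefix_recursion (W : Type) (w0 : W) (P : nat -> (nat -> W) -> W -> Prop) :
  (forall k u u' w, (forall i, (i < k)%N -> u i = u' i) -> P k u w -> P k u' w) ->
  (forall k u, exists w, P k u w) -> exists s, forall k, P k s (s k).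
Proof.
move=> Pext Pex.
pose F (l : seq W) := sval (cid (Pex (size l) (nth w0 l))).
have FP l : P (size l) (nth w0 l) (F l) by rewrite /F; case: cid.
pose L := fix L k := if k is k'.+1 then rcons (L k') (F (L k')) else [::].
have sL k : size (L k) = k by elim: k => //= k ih; rewrite size_rcons ih.
have nL k i : (i < k)%N -> nth w0 (L k) i = F (L i).
  elim: k => //= k ih; rewrite ltnS leq_eqVlt nth_rcons sL => /predU1P[->|ik].
    by rewrite ltnn eqxx.
  by rewrite ik ih.
exists (fun k => F (L k)) => k; have := FP (L k); rewrite sL.
by apply: Pext => i ik; rewrite nL.
Qed.

End recursive_choice.

Section strip_entropy.
Context {d} {Y : measurableType d} {R : realType}.
Variables (mu : probability Y R) (T : int * int -> Y -> Y).
Hypothesis hT : mp_action mu T.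
Variables (beta b : R).
Hypothesis b0 : 0 < b.
Notation L := (strip beta b).
Variables (I : finType) (a : Y -> I) (g : I -> Y -> R).
Hypothesis fa : fvar a.
Hypothesis bg : forall i, bm (g i).
Hypothesis g01 : forall i x, 0 <= g i x <= 1.
Hypothesis mg : forall i Z, measurable Z -> ap_set mu T L (g i @^-1` Z).
Hypothesis gE : forall i C, ap_set mu T L C ->
  mean mu (fun x => \1_(a @^-1` [set i]) x * \1_C x) = mean mu (fun x => g i x * \1_C x).

Let H : R := \sum_i mean mu (fun x => phi (g i x)).

Let shift (a' : Y -> I) (s : nat -> int * int) i x := a' (T (s i) x).

Lemma fvar_T (J : finType) (c : Y -> J) w : fvar c -> fvar (fun x => c (T w x)).
Proof.
move=> fc j.
by have := mp_measurable hT w measurableT (fc j); rewrite setTI.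
Qed.

Lemma ent_T (J : finType) (c : Y -> J) w : fvar c -> ent mu (fun x => c (T w x)) = ent mu c.
Proof.
move=> fc; apply: eq_bigr => j _; congr (phi (fine _)).
by rewrite -[RHS](mp_invariant hT w) //; exact: fc.
Qed.

Lemma cond_ent_T (J K : finType) (u : Y -> J) (c : Y -> K) w : fvar u -> fvar c ->
  cond_ent mu (fun x => u (T w x)) (fun x => c (T w x)) = cond_ent mu u c.
Proof.
move=> fu fc; rewrite /cond_ent (ent_T w fc).
by rewrite (@ent_T _ (fun x => (u x, c x)) w) //; exact: fvar_pair.
Qed.

(** The join of the level partitions of the g i at scale e. *)
Lemma ap_partition (e : R) : 0 < e -> exists (J : finType) (c : Y -> J),
  [/\ forall j, ap_set mu T L (c @^-1` [set j]) &
      forall i x y, c x = c y -> `|g i x - g i y| <= e].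
Proof.
move=> e0; have [J [Q [mQ Qe]]] := interval_coloring 1 e0.
exists {ffun I -> J}, (fun x => [ffun i => Q (g i x)]); split.
  move=> f.
  have apI (s : seq I) : ap_set mu T L [set x | forall i, i \in s -> Q (g i x) = f i].
    elim: s => [|i s ih].
      rewrite (_ : [set _ | _] = ~` set0); first by apply: ap_setC => //; exact: ap_set0.
      by rewrite setC0; apply/seteqP.
    rewrite (_ : [set _ | _] = g i @^-1` (Q @^-1` [set f i]) `&`
        [set x | forall i, i \in s -> Q (g i x) = f i]).
      by apply: ap_setI => //; exact: mg.
    apply/seteqP; split => x /= h.
      by split => [|j js]; apply: h; rewrite inE ?eqxx // js orbT.
    by case: h => h1 h2 j; rewrite inE => /predU1P[->|]; [exact: h1|exact: h2].
  rewrite (_ : _ @^-1` _ = [set x | forall i, i \in enum I -> Q (g i x) = f i]) //.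
  apply/seteqP; split => x /= h; first by move=> i _; rewrite -h ffunE.
  by apply/ffunP => i; rewrite ffunE; apply: h; rewrite mem_enum.
move=> i x y /ffunP /(_ i); rewrite !ffunE; apply: Qe.
- by have /andP[? ?] := g01 i x; rewrite ger0_norm.
- by have /andP[? ?] := g01 i y; rewrite ger0_norm.
Qed.

(** A common colouring for finitely many sets, by pairing. *)
Lemma ap_family (J : finType) (F : J -> set Y) (e : R) : 0 < e ->
  (forall j, ap_set mu T L (F j)) -> exists (K : finType) (kappa : int * int -> K),
  forall j u v, L u -> L v -> kappa u = kappa v ->
    mean mu (fun x => (\1_(F j) (T u x) - \1_(F j) (T v x)) ^+ 2) <= e.
Proof.
move=> e0 apF.
have [K [kappa h]] : exists (K : finType) (kappa : int * int -> K),
  forall j, j \in enum J -> forall u v, L u -> L v -> kappa u = kappa v ->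
    mean mu (fun x => (\1_(F j) (T u x) - \1_(F j) (T v x)) ^+ 2) <= e.
  elim: (enum J) => [|j s [K [kappa h]]]; first by exists unit, (fun=> tt).
  have [K' [kappa' h']] := (apF j).2 e e0.
  exists (K' * K)%type, (fun u => (kappa' u, kappa u)) => j'; rewrite inE.
  case/predU1P => [->|js] u v Lu Lv [k1 k2]; [exact: h'|exact: h].
by exists K, kappa => j; apply: h; rewrite mem_enum.
Qed.

(** The partitions c o T^(s i) are replaced by the representatives of their
    colours; the join of the latter is a function of the finitely many
    representatives, whence a constant K that depends only on e. *)
Lemma ent_joint_upper (e : R) : 0 < e -> exists K, forall (s : nat -> int * int) k,
  (forall i, L (s i)) -> ent mu (joint (shift a s) k) <= K + k%:R * (H + e).
Proof.
move=> e0; have e2 : 0 < e / 2 by rewrite divr_gt0.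
have [dl1 dl10 hA] := cond_ent_le_mean_phi mu I e2.
have [J [c [apc osc]]] := ap_partition dl10.
have fc : fvar c by move=> j; case: (apc j).
have ac : cond_ent mu a c <= H + e / 2.
  apply: hA => // i j; rewrite law_pair_mean // gE //.
have [dl2 dl20 hB] := cond_ent_close mu I J e2.
have [K [kappa kh]] := ap_family dl20 apc.
pose r k := xget 0 [set u | L u /\ kappa u = k].
pose D x : {ffun K -> J} := [ffun k => c (T (r k) x)].
exists (ent mu D) => s k Ls.
pose dd i x := c (T (r (kappa (s i))) x).
have fs i : fvar (shift a s i) by exact: fvar_T.
have fdd i : fvar (dd i) by exact: fvar_T.
apply: (le_trans (ent_joint_le_cond mu k fs fdd)).
apply: lerD.
  apply: (@ent_factor_le _ _ _ _ _ _ _ _ (fun f : {ffun K -> J} => [ffun i : 'I_k => f (kappa (s i))])).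
    move=> f; have -> : D @^-1` [set f] = \bigcap_(k in [set: K]) ((fun x => c (T (r k) x)) @^-1` [set f k]).
      apply/seteqP; split => x /=; first by move=> <- i _; rewrite ffunE.
      by move=> h; apply/ffunP => i; rewrite ffunE; exact: h.
    by apply: fin_bigcap_measurable => [|i _]; [exact: finite_finset|exact: fvar_T].
  by move=> x; apply/ffunP => i; rewrite !ffunE.
rewrite mulr_natl -[X in _ *+ X](card_ord k) -sumr_const; apply: ler_sum => i _.
have [Lr kr] : L (r (kappa (s i))) /\ kappa (r (kappa (s i))) = kappa (s i).
  by apply: (xgetPex 0 (P := [set u | L u /\ kappa u = kappa (s i)])); exists (s i).
have : cond_ent mu (shift a s i) (dd i) <= cond_ent mu (shift a s i) (fun x => c (T (s i) x)) + e / 2.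
  apply: hB => //; first exact: fvar_T.
  by move=> j; exact: kh.
rewrite (cond_ent_T (s i) fa fc); move: ac; lra.
Qed.

(** The conditional expectation identity on the cells of the level partitions of
    an almost periodic function, passed to the limit. *)
Lemma residual_orthogonal i :
  ap_orthogonal mu T beta b (fun x => \1_(a @^-1` [set i]) x - g i x).
Proof.
move=> h bh aph.
have bf : bm (fun x => \1_(a @^-1` [set i]) x - g i x : R) by apply: bmD; [apply: bm_indic|exact: bmN].
have [C C0 fC] := bm_bound bf.
apply/eqP; rewrite -normr_le0; apply/ler_addgt0Pl => e e0; rewrite addr0.
have [J [Z [v [mZ hv]]]] := simple_approximation bh (divr_gt0 e0 C0).
pose k x := \sum_(j : J) v j * \1_(h @^-1` Z j) x.
have bI j : bm (\1_(h @^-1` Z j) : Y -> R) by apply: bm_indic; exact: bm_preimage.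
have bk : bm k.
  apply: (@bm_sum _ _ _ _ _ (fun j x => v j * \1_(h @^-1` Z j) x)) => j.
  by apply: bmM => //; exact: bm_cst.
have k0 : mean mu (fun x => (\1_(a @^-1` [set i]) x - g i x) * k x) = 0.
  under eq_mean do rewrite mulr_sumr.
  rewrite (@mean_sum _ _ _ _ _ _ (fun j x => (\1_(a @^-1` [set i]) x - g i x) * (v j * \1_(h @^-1` Z j) x))); last first.
    by move=> j; apply: bmM => //; apply: bmM => //; exact: bm_cst.
  apply: big1 => j _.
  rewrite (@eq_mean _ _ _ _ _ (fun x => v j * (\1_(a @^-1` [set i]) x * \1_(h @^-1` Z j) x - g i x * \1_(h @^-1` Z j) x))); last first.
    by move=> x; ring.
  have b1 : bm (fun x => \1_(a @^-1` [set i]) x * \1_(h @^-1` Z j) x : R) by apply: bmM => //; exact: bm_indic.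
  have b2 : bm (fun x => g i x * \1_(h @^-1` Z j) x) by exact: bmM.
  rewrite meanZ; last by bm.
  by rewrite meanB // gE ?subrr ?mulr0 //; exact: ap_measurable.
rewrite -[X in `|X|]subr0 -[X in _ - X]k0 -meanB; try exact: bmM.
rewrite (@eq_mean _ _ _ _ _ (fun x => (\1_(a @^-1` [set i]) x - g i x) * (h x - k x))); last first.
  by move=> x; rewrite mulrBr.
apply: norm_mean_le => [|x]; first by apply: bmM => //; bm.
by rewrite normrM (@le_trans _ _ (C * (e / C))) ?ler_pM // mulrCA divff ?mulr1 // gt_eqF.
Qed.

Lemma ent_joint_step (s : nat -> int * int) k (M : int) (e : R) : 0 < e ->
  exists w, [/\ L w, M < w.1 & H - e <= cond_ent mu (fun x => a (T w x)) (joint (shift a s) k)].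
Proof.
move=> e0; have fj : fvar (joint (shift a s) k) by apply: fvar_joint => i; exact: fvar_T.
have [dl dl0 hB] := mean_phi_le_cond_ent mu I e0 fj.
have bres i : bm (fun x => \1_(a @^-1` [set i]) x - g i x : R).
  by apply: bmD; [apply: bm_indic|exact: bmN].
have bind f : bm (\1_(joint (shift a s) k @^-1` [set f]) : Y -> R) by exact: bm_indic.
have [w [Lw Mw hw]] := directional_weak_mixing hT b0 M bres residual_orthogonal bind dl0.
exists w; split => //.
have -> : H = \sum_i mean mu (fun x => phi (g i (T w x))).
  by apply: eq_bigr => i _; rewrite -[LHS](mean_T hT w) //; exact: bm_phi.
apply: hB => //; [exact: fvar_T|by move=> i; exact: (bm_T hT)].
Qed.

Lemma ent_joint_lower : exists s : nat -> int * int,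
  [/\ forall i, L (s i), forall i, (s i).1 < (s i.+1).1 &
      forall k, k%:R * H - 2 <= ent mu (joint (shift a s) k)].
Proof.
pose P k (u : nat -> int * int) w := [/\ L w, forall i, k = i.+1 -> (u i).1 < w.1 &
  H - 2^-1 ^+ k <= cond_ent mu (fun x => a (T w x)) (joint (shift a u) k)].
have [||s hs] := @prefix_recursion _ 0 P.
- move=> k u u' w uu' [Lw Mw hw]; split => //.
    by move=> i ki; rewrite -uu' ?ki //; exact: Mw.
  rewrite (_ : joint (shift a u') k = joint (shift a u) k) //.
  by apply/funext => x; apply/ffunP => i; rewrite !ffunE /shift uu'.
- move=> k u; have e0 : 0 < 2^-1 ^+ k :> R by rewrite exprn_gt0 // invr_gt0.
  have [w [Lw Mw hw]] := ent_joint_step u k (u k.-1).1 e0.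
  by exists w; split => // i ki; move: Mw; rewrite ki.
exists s; split.
- by move=> i; case: (hs i).
- by move=> i; have [_ h _] := hs i.+1; exact: h.
- move=> k; have fs i : fvar (shift a s i) by exact: fvar_T.
  apply: le_trans (ent_joint_ge_cond mu k fs).
  apply: (@le_trans _ _ (\sum_(i < k) (H - 2^-1 ^+ i))); last first.
    by apply: ler_sum => i _; have [_ _ h] := hs i.
  rewrite sumrB sumr_const card_ord -(mulr_natl H k) lerD2l lerN2.
  have : \sum_(i < k) 2^-1 ^+ i = 2 - 2 * 2^-1 ^+ k :> R.
    elim: k => [|k ih]; first by rewrite big_ord0 expr0; ring.
    by rewrite big_ord_recr /= ih exprS; field.
  move=> ->; rewrite gerBl mulr_ge0 // exprn_ge0 // invr_ge0 //.
Qed.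

End strip_entropy.

(** * Distances in L2 *)

Section Lspace2.
Context {d} {Y : measurableType d} {R : realType}.
Variable mu : probability Y R.

Lemma Lnorm2_bm (h : Y -> R) (phi : Y -> R) : measurable_fun setT h -> bm phi ->
  h = phi %[ae mu] ->
  'N[mu]_2%:E [EFin \o h]%E = (Num.sqrt (mean mu (fun x => phi x ^+ 2)))%:E.
Proof.
move=> mh bphi hphi; rewrite unlock /Lnorm.
have -> : (\int[mu]_x `|(EFin \o h) x| `^ 2 = \int[mu]_x (phi x ^+ 2)%:E)%E.
  apply: ae_eq_integral => //.
  - rewrite (_ : (fun x => _) = EFin \o (fun x => `|h x| `^ 2)) //.
    apply/measurable_EFinP; rewrite (_ : (fun x => _) = (fun x => `|h x| ^+ 2)); last first.
      by apply/funext => x; rewrite powR_mulrn.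
    by apply: measurable_funX; exact: measurableT_comp.
  - by apply/measurable_EFinP; case: (bmX 2 bphi).
  - move: hphi; apply: filterS => x /(_ I) hx _ /=; rewrite hx //.
    by rewrite powR_mulrn // real_normK // num_real.
rewrite -EFin_mean; last exact: bmX.
by rewrite poweR_EFin powR12_sqrt // mean_ge0 // => x; exact: sqr_ge0.
Qed.

Lemma Lspace_measurable (f : LspaceType2 mu) : measurable_fun setT (f : Y -> R).
Proof. exact: (measurable_funPT (repr (f : {mfun_ mu, Y >-> measurableTypeR R}))). Qed.

Lemma Lspace_dist_bm (f g : LspaceType2 mu) (phi psi : Y -> R) : bm phi -> bm psi ->
  (f : Y -> R) = phi %[ae mu] -> (g : Y -> R) = psi %[ae mu] ->
  mdist f g = Num.sqrt (mean mu (fun x => (phi x - psi x) ^+ 2)).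
Proof.
move=> bphi bpsi ff gg; rewrite [LHS]/(Lspace_dist f g) /Lspace_dist.
rewrite (Lnorm2_bm (phi := fun x => phi x - psi x)) //.
- by apply: measurable_funB; exact: Lspace_measurable.
- by bm.
- by move: ff gg; apply: filterS2 => x fx gx _ /=; rewrite fx // gx.
Qed.

Lemma Lspace_exists (phi : Y -> R) : bm phi ->
  exists f : LspaceType2 mu, (f : Y -> R) = phi %[ae mu].
Proof.
move=> bphi.
have mphi : (phi : Y -> measurableTypeR R) \in mfun by rewrite inE; case: bphi.
pose m : {mfun Y >-> measurableTypeR R} := mfun_Sub mphi.
pose q : {mfun_ mu, Y >-> measurableTypeR R} := (\pi_({mfun_ mu, Y >-> measurableTypeR R}) m)%qT.
have qphi : (q : Y -> R) = phi %[ae mu].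
  have : ((\pi_({mfun_ mu, Y >-> measurableTypeR R}) (repr q))%qT = (\pi_({mfun_ mu, Y >-> measurableTypeR R}) m)%qT).
    by rewrite reprK.
  by move=> /eqmodP /asboolP.
have fq : finite_norm mu 2%:E q.
  rewrite /finite_norm (@Lnorm2_bm _ phi) ?ltry //.
  exact: (measurable_funPT (repr q)).
exists (HB.pack_for (LspaceType2 mu) q (isFinLebesgue.Build _ _ _ mu 2%:E (lee1n 2) q fq)).
exact: qphi.
Qed.

End Lspace2.

(** * The directional Kronecker algebra as an algebra of almost periodic sets *)

Section kronecker.
Context {R : realType} {X : pmetricType R}.
Variables (mu : probability (borel X) R) (T : int * int -> X -> X).
Hypothesis hT : mp_action mu T.
Variables (beta b : R).
Notation L := (strip beta b).
Notation L2 := (LspaceType2 mu).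

Section one_set.
Variable B : set (borel X).
Hypothesis mB : measurable B.
Let phi (w : int * int) (x : borel X) : R := \1_B (T w x).

Let bphi w : bm (phi w).
Proof. by apply: (bm_T hT (f := \1_B)); exact: bm_indic. Qed.

Let orbit_pt w : L2 := sval (cid (Lspace_exists mu (bphi w))).
Let orbit_ptE w : (orbit_pt w : borel X -> R) = phi w %[ae mu].
Proof. by rewrite /orbit_pt; case: cid. Qed.

Let orbit_mem w : L w -> koopman_orbit (mu := mu) T L B (orbit_pt w).
Proof. by move=> Lw; exists w. Qed.

Let dist_pt u v : mdist (orbit_pt u) (orbit_pt v) =
  Num.sqrt (mean mu (fun x => (phi u x - phi v x) ^+ 2)).
Proof. exact: Lspace_dist_bm. Qed.

Let mean_sq_ge0 (h : borel X -> R) : 0 <= mean mu (fun x => h x ^+ 2).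
Proof. by apply: mean_ge0 => x; exact: sqr_ge0. Qed.

(** The image on the orbit of an ultrafilter on the strip converges, so the
    ultrafilter contains sets on which the orbit has small diameter. *)
Lemma compact_orbit_ap : compact (closure (koopman_orbit (mu := mu) T L B)) ->
  almost_periodic mu T L (\1_B : borel X -> R).
Proof.
rewrite compact_ultra => cO e e0; apply: ultra_coloring => G UG GL.
have := cO _ (ultra_fmap orbit_pt UG).
case.
  by rewrite /fmap /=; apply: filterS GL => w Lw; apply: subset_closure; exact: orbit_mem.
move=> p [_ Gp].
have se0 : 0 < Num.sqrt e / 2 by rewrite divr_gt0 // sqrtr_gt0.
exists [set w | mdist p (orbit_pt w) < Num.sqrt e / 2].
  have := Gp _ (nbhsx_ballx p _ se0).
  by rewrite /fmap /= ballEmdist.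
move=> u v /= pu pv.
have : mdist (orbit_pt u) (orbit_pt v) <= Num.sqrt e.
  rewrite (le_trans (metric_triangle _ p _)) // metric_sym.
  by move: pu pv; set s := Num.sqrt e; lra.
by rewrite dist_pt ler_sqrt // ltW.
Qed.

(** An ultrafilter on the closure of the orbit concentrates near orbit points
    f_n at scale 1/n, which form a Cauchy sequence.  Its weak limit g is a strong
    one: |f_n - g|^2 is the limit over m of <f_n - f_m, f_n - g>, at most
    (2/n) |f_n - g|. *)
Lemma ap_compact_orbit : almost_periodic mu T L (\1_B : borel X -> R) ->
  compact (closure (koopman_orbit (mu := mu) T L B)).
Proof.
move=> apB; rewrite compact_ultra => G UG Gcl.
have sep f : koopman_orbit (mu := mu) T L B f -> exists2 u, L u & f = orbit_pt u.
  move=> [u Lu fu]; exists u => //; apply: mdist_positivity.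
  rewrite (Lspace_dist_bm (bphi u) (bphi u) fu (orbit_ptE u)).
  rewrite (@eq_mean _ _ _ _ _ (fun _ => 0)) ?mean_cst ?sqrtr0 // => x.
  by rewrite subrr expr0n.
(* the ultrafilter concentrates near points of the orbit at every scale *)
have near_pt n : exists2 w, L w & G [set f | mdist (orbit_pt w) f <= n.+1%:R^-1].
  pose e : R := n.+1%:R^-1 / 2.
  have e0 : 0 < e by rewrite divr_gt0 // invr_gt0.
  have [K [kappa hk]] := apB (e ^+ 2) (exprn_gt0 2 e0).
  pose r k := xget 0 [set u | L u /\ kappa u = k].
  suff [k Gk] : exists k, G [set f | L (r k) /\ mdist (orbit_pt (r k)) f <= n.+1%:R^-1].
    exists (r k); first by have [f []] := filter_ex Gk.
    by apply: filterS Gk => f [].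
  apply: (ultra_finite_cover UG Gcl) => f clf.
  have [f0 [/sep [u Lu ->]]] := clf _ (nbhsx_ballx f e e0).
  rewrite ballEmdist /= => fu; exists (kappa u).
  have [Lr kr] : L (r (kappa u)) /\ kappa (r (kappa u)) = kappa u.
    by apply: (xgetPex 0 (P := [set v | L v /\ kappa v = kappa u])); exists u.
  split => //; rewrite (le_trans (metric_triangle _ (orbit_pt u) _)) //.
  have -> : n.+1%:R^-1 = e + e :> R by rewrite /e; field.
  rewrite lerD //; last by rewrite metric_sym ltW.
  rewrite dist_pt -[leRHS](ger0_norm (ltW e0)) -sqrtr_sqr ler_sqrt ?sqr_ge0 //.
  exact: hk.
have [w Lw Gw] : exists2 w : nat -> int * int, forall n, L (w n) &
    forall n, G [set f | mdist (orbit_pt (w n)) f <= n.+1%:R^-1].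
  by exists (fun n => s2val (cid2 (near_pt n))) => n; case: cid2.
have dw n m : mdist (orbit_pt (w n)) (orbit_pt (w m)) <= n.+1%:R^-1 + m.+1%:R^-1.
  have [f [/= fn fm]] := filter_ex (filterI (Gw n) (Gw m)).
  by rewrite (le_trans (metric_triangle _ f _)) // lerD // metric_sym.
have [U [UU sU]] := @ultraFilterLemma nat \oo _.
have phi1 w' x : `|phi w' x| <= 1.
  by rewrite /phi indicE; case: (_ \in _); rewrite ?normr0 ?normr1.
have [g bg gE] := @weak_ulim _ _ _ mu nat U (fun n => phi (w n)) 1 UU (fun n => bphi (w n)) (fun n => phi1 (w n)).
have [p pE] := Lspace_exists mu bg.
have dp n : mdist (orbit_pt (w n)) p <= 2 * n.+1%:R^-1.
  rewrite (Lspace_dist_bm (bphi (w n)) bg (orbit_ptE (w n)) pE).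
  set h := fun x : borel X => phi (w n) x - g x.
  have bh : bm h by rewrite /h; bm.
  set Q := mean mu (fun x => h x ^+ 2); set D := 2 * n.+1%:R^-1.
  have D0 : 0 <= D by rewrite mulr_ge0 // invr_ge0.
  have Q0 : 0 <= Q by exact: mean_sq_ge0.
  have cQ : (fun m => mean mu (fun x => phi (w n) x * h x) - mean mu (fun x => phi (w m) x * h x)) @ U --> Q.
    have -> : Q = mean mu (fun x => phi (w n) x * h x) - mean mu (fun x => g x * h x).
      rewrite -meanB; try exact: bmM.
      by apply: eq_mean => x; rewrite /h expr2 -mulrBl.
    by apply: cvgB; [exact: cvg_cst|exact: gE].
  have QD : Q <= D * Num.sqrt Q.
    rewrite -[leLHS](cvg_lim _ cQ) //; apply: limr_le; first by apply/cvg_ex; exists Q.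
    have : U [set m | (n <= m)%N] by apply: sU; exists n.
    apply: filterS => m /= nm; rewrite -meanB; try exact: bmM.
    rewrite (@eq_mean _ _ _ _ _ (fun x => (phi (w n) x - phi (w m) x) * h x)) => [|x]; last by rewrite mulrBl.
    have bd : bm (fun x => phi (w n) x - phi (w m) x) by apply: bmD => //; exact: bmN.
    rewrite (le_trans (ler_norm _)) // -sqrtr_sqr.
    apply: (@le_trans _ _ (Num.sqrt (mean mu (fun x => (phi (w n) x - phi (w m) x) ^+ 2) * Q))).
      by rewrite ler_sqrt ?mulr_ge0 //; exact: mean_cauchy_schwarz.
    rewrite sqrtrM // ler_wpM2r ?sqrtr_ge0 // -dist_pt (le_trans (dw n m)) //.
    by rewrite /D mulr_natl mulr2n lerD2l lef_pV2 ?posrE // ler_nat.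
  have [->|sQ0] := eqVneq (Num.sqrt Q) 0; first by [].
  have sQ : 0 < Num.sqrt Q by rewrite lt_neqAle eq_sym sQ0 sqrtr_ge0.
  by rewrite -(ler_pM2r sQ) -expr2 sqr_sqrtr.
have near_p A : nbhs p A -> exists n, forall f, mdist (orbit_pt (w n)) f <= n.+1%:R^-1 -> A f.
  rewrite -nbhs_ballE => -[e /= e0 pA]; exists (Num.trunc (3 / e)) => f fw; apply: pA.
  rewrite ballEmdist /= (le_lt_trans (metric_triangle _ (orbit_pt (w (Num.trunc (3 / e)))) _)) // metric_sym.
  have := dp (Num.trunc (3 / e)); move: fw; set N : R := (Num.trunc (3 / e)).+1%:R.
  have N0 : 0 < N :> R by rewrite ltr0n.
  have Ne : 3 / e < N by exact: truncnS_gt.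
  have : 3 * N^-1 < e by rewrite ltr_pdivrMr // mulrC -ltr_pdivrMr.
  set A1 := mdist _ _; set A2 := mdist _ _; set c := N^-1 => ? ? ?; lra.
exists p; split.
  move=> A /near_p [n An]; exists (orbit_pt (w n)); split; first exact: orbit_mem.
  by apply: An; rewrite mdistxx invr_ge0.
move=> A /near_p [n An]; apply: filterS (Gw n); exact: An.
Qed.

End one_set.

Lemma directional_kroneckerE : directional_kronecker mu T beta b = ap_set mu T L.
Proof.
apply/seteqP; split => B [mB h]; split => //; [exact: compact_orbit_ap|exact: ap_compact_orbit].
Qed.

End kronecker.

(** * Conditional expectation on a sub-sigma-algebra *)

Section sub_sigma_algebra.
Context {d} {Y : measurableType d} {R : realType}.
Variables (mu : probability Y R) (F : set (set Y)).
Hypothesis sF : sigma_algebra setT F.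
Hypothesis mF : F `<=` measurable.

Let subspace := g_sigma_algebraType F.

Let measurable_subE : @measurable _ subspace = F.
Proof. by rewrite /measurable /= sigma_algebra_id. Qed.

Let mid : measurable_fun [set: Y] (id : Y -> subspace).
Proof. by move=> _ B; rewrite setTI preimage_id measurable_subE; exact: mF. Qed.

(** The restriction of mu to F, on the type carrying F as its sigma-algebra. *)
Definition sub_measure (B : set subspace) : \bar R := mu B.
Let mu' := sub_measure.

Let mu'0 : mu' set0 = 0%E. Proof. exact: measure0. Qed.
Let mu'_ge0 B : (0 <= mu' B)%E. Proof. exact: measure_ge0. Qed.
Let mu'_sigma : semi_sigma_additive mu'.
Proof.
move=> G mG tG mU; rewrite measurable_subE in mG mU.
by apply: (@measure_semi_sigma_additive _ _ _ mu) => // [i|]; apply: mF => //; exact: mG.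
Qed.
HB.instance Definition _ := isMeasure.Build _ _ _ mu' mu'0 mu'_ge0 mu'_sigma.

Let mu'T : mu' setT = 1%E. Proof. exact: probability_setT. Qed.
HB.instance Definition _ := Measure_isProbability.Build _ _ _ mu' mu'T.

Let bm_sub (k : Y -> R) : bm (k : subspace -> R) -> bm k.
Proof.
move=> [mk bk]; split => // _ Z mZ; rewrite setTI; apply: mF.
by have := mk measurableT Z mZ; rewrite setTI measurable_subE.
Qed.

Let mean_sub (k : Y -> R) : bm (k : subspace -> R) -> mean mu' k = mean mu k.
Proof.
move=> bk; apply: EFin_inj; rewrite !EFin_mean //; last exact: bm_sub.
have mk : measurable_fun setT (EFin \o k : subspace -> \bar R).
  by apply/measurable_EFinP; case: bk.
rewrite -[RHS](integral_pushforward mid mk (D := setT)) //; last exact: (bm_integrable mu (bm_sub bk)).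
Qed.

Let integral_in (k : Y -> R) C : bm k -> measurable C ->
  (\int[mu]_(x in C) (k x)%:E)%E = (mean mu (fun x => k x * \1_C x))%:E.
Proof.
move=> bk mC; rewrite EFin_mean; last by apply: bmM => //; exact: bm_indic.
rewrite integral_mkcond; apply: eq_integral => x _; rewrite /patch indicE.
by case: ifP; rewrite ?mulr1 ?mulr0.
Qed.

(** The functional k |-> E(1_A k) on F-measurable functions has an F-measurable
    density. *)
Lemma condexp_exists (A : set Y) : measurable A -> exists g : Y -> R, is_condexp mu F \1_A g.
Proof.
move=> mA; have bA : bm (\1_A : Y -> R) by exact: bm_indic.
pose Lam (k : subspace -> R) := mean mu (fun x => \1_A x * k x).
have [||g bg gE] := @L1_dual_density _ _ _ mu' Lam 1.
- split => [k l /bm_sub bk /bm_sub bl|c k /bm_sub bk]; rewrite /Lam.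
    rewrite -meanD; try exact: bmM.
    by apply: eq_mean => x; rewrite mulrDr.
  rewrite -meanZ; last exact: bmM.
  by apply: eq_mean => x; rewrite mulrCA.
- move=> k bk; have bk' := bm_sub bk; rewrite mul1r mean_sub; last exact: bm_norm.
  rewrite (le_trans (le_norm_mean _ _)) //; first exact: bmM.
  apply: le_mean => [||x]; [by apply: bm_norm; exact: bmM|exact: bm_norm|].
  by rewrite normrM indicE; case: (_ \in _); rewrite ?normr1 ?normr0 ?mul1r ?mul0r.
have bg' := bm_sub bg.
exists g; split.
- move=> Z mZ; have [mg _] := bg.
  by have := mg measurableT Z mZ; rewrite setTI measurable_subE.
- exact: bm_integrable.
- move=> C FC; have mC := mF FC; rewrite !integral_in //; congr EFin.
  have bC : bm (\1_C : subspace -> R) by apply: bm_indic; rewrite measurable_subE.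
  by rewrite -[RHS]/(Lam \1_C) gE // mean_sub //; exact: bmM.
Qed.

(** A version of the conditional expectation takes values in [0, 1] almost
    everywhere, so truncating it gives a bounded version with the same integrals.
    The truncation is needed because versions are only assumed integrable. *)
Lemma condexp_clip (A : set Y) : measurable A -> exists g : Y -> R,
  [/\ bm g /\ (forall x, 0 <= g x <= 1), forall Z, measurable Z -> F (g @^-1` Z),
      forall C, F C -> mean mu (fun x => \1_A x * \1_C x) = mean mu (fun x => g x * \1_C x),
      measurable_fun setT (condexp mu F \1_A) & condexp mu F \1_A = g %[ae mu]].
Proof.
move=> mA; have bA : bm (\1_A : Y -> R) by exact: bm_indic.
have [] : is_condexp mu F \1_A (condexp mu F \1_A).
  by apply: (xgetPex (cst 0)); exact: condexp_exists.
set h := condexp mu F \1_A => Fh ih hE.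
have mh : measurable_fun setT h by move=> _ Z mZ; rewrite setTI; apply: mF; exact: Fh.
pose clip (y : R) := Num.max 0 (Num.min 1 y).
have mclip : measurable_fun setT clip.
  apply: measurable_maxr; first exact: measurable_cst.
  by apply: measurable_minr => //; exact: measurable_cst.
have F1 : F [set x | 1 < h x].
  rewrite (_ : [set _ | _] = h @^-1` [set` `]1, +oo[ ]); first exact: Fh.
  by apply/seteqP; split => x /=; rewrite in_itv /= andbT.
have F0 : F [set x | 0 < - h x].
  rewrite (_ : [set _ | _] = h @^-1` [set` `]-oo, 0[ ]); first exact: Fh.
  by apply/seteqP; split => x /=; rewrite in_itv /= oppr_gt0.
have A01 x : 0 <= (\1_A x : R) <= 1.
  by rewrite indicE; case: (_ \in _); rewrite /= ?lexx ?ler01.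
have up : {ae mu, forall x, h x <= 1}.
  apply: ae_le_level => //; rewrite /Rintegral hE // integral_in //; last exact: mF.
  rewrite mul1r -mean_indic /=; last exact: mF.
  have b1 : bm (\1_[set x | 1 < h x] : Y -> R) by apply: bm_indic; exact: mF.
  apply: le_mean => // [|x]; first exact: bmM.
  by have /andP[? ?] := A01 x; rewrite ler_piMl // indicE.
have dn : {ae mu, forall x, - h x <= 0}.
  apply: ae_le_level; first by have := integrableN ih; apply: eq_integrable.
  rewrite mul0r (_ : \int[mu]_(x in _) _ = \int[mu]_(x in [set x | 0 < - h x]) (-1 * h x)); last first.
    by apply: eq_Rintegral => x _; rewrite mulN1r.
  rewrite RintegralZl; [|exact: mF|by apply: integrableS ih => //; exact: mF].
  rewrite mulN1r oppr_le0 /Rintegral hE // integral_in //=; last exact: mF.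
  by apply: mean_ge0 => x; have /andP[? ?] := A01 x; rewrite mulr_ge0 // indicE.
pose g x := clip (h x).
have g01 x : 0 <= g x <= 1.
  by rewrite /g /clip le_max lexx /= ge_max ler01 ge_min lexx.
have bg : bm g.
  split; first exact: (measurableT_comp mclip mh).
  by exists 1 => x; have /andP[? ?] := g01 x; rewrite ger0_norm.
have hg : h = g %[ae mu].
  move: up dn; apply: filterS2 => x h1; rewrite oppr_le0 => h0 _.
  by rewrite /g /clip min_r // max_r.
exists g; split => //.
- move=> Z mZ; rewrite (_ : g @^-1` Z = h @^-1` (clip @^-1` Z)) //.
  by apply: Fh; rewrite -[_ @^-1` _]setTI; exact: mclip.
- move=> C FC; have mC := mF FC; apply: EFin_inj; rewrite -!integral_in // -hE //.
  apply: ae_eq_integral => //.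
  + by apply: measurable_funTS; apply/measurable_EFinP.
  + by apply: measurable_funTS; apply/measurable_EFinP; case: bg.
  + by move: hg; apply: filterS => x hx _; rewrite hx.
Qed.

Lemma cond_entropy_phi (I : finType) (alpha : I -> set Y) (g : I -> Y -> R) :
  (forall i, bm (g i)) -> (forall i x, 0 <= g i x <= 1) ->
  (forall i, measurable_fun setT (condexp mu F \1_(alpha i))) ->
  (forall i, condexp mu F \1_(alpha i) = g i %[ae mu]) ->
  cond_entropy mu alpha F = (\sum_i mean mu (fun x => phi (g i x)))%:E.
Proof.
move=> bg g01 mc cg; rewrite /cond_entropy.
rewrite (eq_bigr (fun i => (- mean mu (fun x => phi (g i x)))%:E)); last first.
  move=> i _; have bp := bm_phi (bg i) (g01 i).
  have bgl : bm (fun x => g i x * ln (g i x)).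
    by rewrite (_ : (fun x => _) = (fun x => - phi (g i x))); [exact: bmN|apply/funext => x; rewrite opprK].
  rewrite -[X in X%:E]mulN1r -meanZ //.
  rewrite (@eq_mean _ _ _ _ _ (fun x => g i x * ln (g i x))); last by move=> x; rewrite mulN1r opprK.
  rewrite EFin_mean //; apply: ae_eq_integral => //.
  - apply/measurable_EFinP; apply: measurable_funM => //.
    by apply: measurableT_comp => //; exact: measurable_ln.
  - by apply/measurable_EFinP; case: bgl.
  - by move: (cg i); apply: filterS => x hx _; rewrite hx.
by rewrite sumEFin sumrN -EFinN opprK.
Qed.

End sub_sigma_algebra.

(** * Proof of the theorem *)

Section limsup_bounds.
Context {R : realType}.

Lemma limn_esup_le_near (u : nat -> \bar R) (l : \bar R) :
  (\forall k \near \oo, (u k <= l)%E) -> (limn_esup u <= l)%E.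
Proof.
move=> ul; apply: (@le_trans _ _ (ereal_sup (u @` [set k | (u k <= l)%E]))).
  by apply: ereal_inf_lbound; exists [set k | (u k <= l)%E].
by apply: ge_ereal_sup => _ [k /= h <-].
Qed.

Lemma limn_esup_ge_near (u : nat -> \bar R) (l : \bar R) :
  (\forall k \near \oo, (l <= u k)%E) -> (l <= limn_esup u)%E.
Proof.
move=> ul; apply: le_ereal_inf_tmp => _ [V FV <-].
have [k [Vk lk]] := filter_ex (filterI FV ul).
by apply: (le_trans lk); apply: ereal_sup_ubound; exists k.
Qed.

(** The constant K is killed by the division by k. *)
Lemma limn_esup_linear_le (h : nat -> R) (H : R) :
  (forall e, 0 < e -> exists K, forall k, h k <= K + k%:R * (H + e)) ->
  (limn_esup (fun k => (k%:R^-1 * h k)%:E) <= H%:E)%E.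
Proof.
move=> hK; apply/lee_addgt0Pr => e e0; have e2 : 0 < e / 2 by rewrite divr_gt0.
have [K hk] := hK _ e2; rewrite -EFinD; apply: limn_esup_le_near.
near=> k.
have k0 : 0 < k%:R :> R by rewrite ltr0n; near: k; exact: nbhs_infty_gt.
rewrite lee_fin mulrC ler_pdivrMr // (le_trans (hk k)) //.
have : K <= k%:R * (e / 2).
  rewrite -ler_pdivrMr //; near: k; exact: nbhs_infty_ger.
rewrite (_ : (H + e) * k%:R = k%:R * (H + e / 2) + k%:R * (e / 2)); [lra|by field].
Unshelve. all: end_near. Qed.

Lemma limn_esup_linear_ge (h : nat -> R) (H K : R) :
  (forall k, k%:R * H - K <= h k) ->
  (H%:E <= limn_esup (fun k => (k%:R^-1 * h k)%:E))%E.
Proof.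
move=> hK; apply/lee_subgt0Pr => e e0; rewrite -EFinB; apply: limn_esup_ge_near.
near=> k.
have k0 : 0 < k%:R :> R by rewrite ltr0n; near: k; exact: nbhs_infty_gt.
rewrite lee_fin mulrC ler_pdivlMr // (le_trans _ (hK k)) //.
have : K <= k%:R * e.
  rewrite -ler_pdivrMr //; near: k; exact: nbhs_infty_ger.
by lra.
Unshelve. all: end_near. Qed.

End limsup_bounds.

Section Z2_systems.
Context {R : realType} {X : pmetricType R}.
Variables (mu : probability (borel X) R) (T : int * int -> X -> X).

Lemma Z2_mps_action : Z2_mps mu T -> mp_action mu T.
Proof.
move=> [_ Tc Tadd T0 Tinv]; split.
- move=> w; apply: (@measurability _ _ (borel X) (borel X) _ _ open) => //.
  move=> _ [U oU <-]; rewrite setTI; apply: sub_sigma_algebra.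
  by move/continuousP : (Tc w); exact.
- exact: Tinv.
- by move=> w u x; rewrite -Tadd.
- by move=> x; rewrite T0.
Qed.

End Z2_systems.

Theorem theorem1p1 (R : realType) (X : pmetricType R)
    (mu : probability (borel X) R) (T : int * int -> X -> X)
    (beta b : R) (I : finType) (alpha : I -> set (borel X)) :
  Z2_mps mu T -> 0 < b -> measurable_partition alpha ->
  (forall s : nat -> int * int,
     injective s -> (forall i, strip beta b (s i)) ->
     (seq_entropy mu T s alpha
        <= cond_entropy mu alpha (directional_kronecker mu T beta b))%E) /\
  (exists s : nat -> int * int,
     [/\ injective s,
         forall i, strip beta b (s i),
         {homo (fun i => (s i).1) : i j / (i < j)%N >-> i < j} \/
         {homo (fun i => (s i).1) : i j / (i < j)%N >-> j < i} &
         seq_entropy mu T s alpha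
           = cond_entropy mu alpha (directional_kronecker mu T beta b)]).
Proof.
move=> /Z2_mps_action hT b0 [malpha talpha calpha].
rewrite (directional_kroneckerE hT).
set F := ap_set mu T (strip beta b).
have sF : sigma_algebra setT F by exact: sigma_algebra_ap_set.
have mF : F `<=` measurable by move=> B [].
(* the partition as a measurable map to its index set *)
have acell x : exists i, alpha i x by have : setT x by []; rewrite -calpha => -[i _]; exists i.
pose a x := sval (cid (acell x)).
have aE i : a @^-1` [set i] = alpha i.
  apply/seteqP; split => x /=; first by move=> <-; rewrite /a; case: cid.
  by move=> ix; rewrite /a; case: cid => j jx /=; apply: talpha => //; exists x.
have fa : fvar a by move=> i; rewrite aE.
have [g hg] : exists g : I -> borel X -> R, forall i,
    [/\ bm (g i) /\ (forall x, 0 <= g i x <= 1), forall Z, measurable Z -> F (g i @^-1` Z),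
      forall C, F C -> mean mu (fun x => \1_(alpha i) x * \1_C x) = mean mu (fun x => g i x * \1_C x),
      measurable_fun setT (condexp mu F \1_(alpha i)) & condexp mu F \1_(alpha i) = g i %[ae mu]].
  by exists (fun i => sval (cid (condexp_clip mu sF mF (malpha i)))) => i; case: cid.
have bg i : bm (g i) by case: (hg i) => -[].
have g01 i x : 0 <= g i x <= 1 by case: (hg i) => -[].
have mg i Z : measurable Z -> F (g i @^-1` Z) by case: (hg i) => _ + _ _ _; exact.
have gE i C : F C -> mean mu (fun x => \1_(a @^-1` [set i]) x * \1_C x) = mean mu (fun x => g i x * \1_C x).
  by rewrite aE; case: (hg i) => _ _ + _ _; exact.
rewrite (cond_entropy_phi bg g01); [|by move=> i; case: (hg i)..].
set H := \sum_i _.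
pose sh (s : nat -> int * int) i (x : borel X) := a (T (s i) x).
have seqE s : seq_entropy mu T s alpha =
    limn_esup (fun k => (k%:R^-1 * ent mu (joint (sh s) k))%:E).
  rewrite /seq_entropy; congr limn_esup; apply/funext => k; congr (_ * _)%:E.
  rewrite /entropy -sumrN; apply: eq_bigr => f _; rewrite /phi /law.
  suff -> : partition_join (fun (i : 'I_k) j => T (s i) @^-1` alpha j) f = joint (sh s) k @^-1` [set f] by [].
  apply/seteqP; split => x /= h.
    apply/ffunP => i; rewrite ffunE /sh; have := h i Logic.I; rewrite /= -aE; exact.
  by move=> i _ /=; rewrite -aE /= -h ffunE.
have upper s : (forall i, strip beta b (s i)) -> (seq_entropy mu T s alpha <= H%:E)%E.
  move=> Ls; rewrite seqE; apply: limn_esup_linear_le => e e0.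
  have [K hK] := ent_joint_upper hT fa bg g01 mg gE e0.
  by exists K => k; exact: hK.
split; first by move=> s _; exact: upper.
have [s [Ls s1 hs]] := ent_joint_lower hT b0 fa bg g01 gE.
have mono : {homo (fun i => (s i).1) : i j / (i < j)%N >-> i < j} by exact: homo_ltn lt_trans s1.
exists s; split => //.
- move=> i j sij; have [ij|ij|//] := ltngtP i j; have := mono _ _ ij; by rewrite /= sij ltxx.
- by left.
- apply/eqP; rewrite eq_le upper //= seqE; exact: limn_esup_linear_ge hs.
Qed.
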